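(* Let $\Omega\subseteq\mathbb{R}^n$ be open and let $F\in C^2(\mathbb{R}^n)$ be convex. If $u\in C^0(\Omega)\cap W^{1,1}_{\mathrm{loc}}(\Omega)$ is a local minimiser of $E$ in $W^{1,1}_{\mathrm{loc}}(\Omega)$, where $E(u,\mathcal{B})=\int_{\mathcal{B}}F(Du)$, then $u$ is a viscosity solution on $\Omega$ of the expanded Euler–Lagrange equation $$F_{AA}(Du):D^2u=0 .$$
   Context: For $u\in W^{1,1}_{\mathrm{loc}}(\Omega)$ and a Borel set $\mathcal{B}\subseteq\Omega$, $E(u,\mathcal{B}):=\int_{\mathcal{B}}F(Du)$ if $F(Du)\in L^1(\mathcal{B})$, and $E(u,\mathcal{B}):=+\infty$ otherwise. $u\in W^{1,1}_{\mathrm{loc}}(\Omega)$ is a local minimiser of $E$ in $W^{1,1}_{\mathrm{loc}}(\Omega)$ if $E(u,\Omega')\le E(u+\psi,\Omega')$ for every open $\Omega'$ compactly contained in $\Omega$ and every $\psi\in W^{1,1}_0(\Omega')$. $F_{AA}(p)$ denotes the Hessian matrix of $F$ at $p\in\mathbb{R}^n$, and $A:X=\sum_{i,j}A_{ij}X_{ij}$. $\mathbb{S}(n)$ is the space of real symmetric $n\times n$ matrices, and $X:z\otimes z=\sum_{i,j}X_{ij}z_iz_j$. For $u:\Omega\to\mathbb{R}$ and $x\in\Omega$, $\mathcal{J}^{2,+}u(x)$ is the set of all $(p,X)\in\mathbb{R}^n\times\mathbb{S}(n)$ such that $u(x+z)\le u(x)+p\cdot z+\frac12X:z\otimes z+o(|z|^2)$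 as $z\to0$; $\mathcal{J}^{2,-}u(x)$ is defined in the same way with $\le$ replaced by $\ge$. $u\in C^0(\Omega)$ is a viscosity solution of $F_{AA}(Du):D^2u=0$ on $\Omega$ if for all $x\in\Omega$: $F_{AA}(p):X\ge0$ for every $(p,X)\in\mathcal{J}^{2,+}u(x)$, and $F_{AA}(p):X\le0$ for every $(p,X)\in\mathcal{J}^{2,-}u(x)$. *)

(* Defs.v *)
From HB Require Import structures.
From mathcomp Require Import all_boot all_order all_algebra.
From mathcomp Require Import all_classical all_reals all_analysis.
From mathcomp Require Import measurable_realfun.
Set Implicit Arguments.
Unset Strict Implicit.
Unset Printing Implicit Defensive.
Import Order.TTheory GRing.Theory Num.Theory.
Import numFieldNormedType.Exports.
Local Open Scope classical_set_scope.
Local Open Scope ring_scope.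

Section borel_rV.
Variables (R : realType) (n : nat).

(* The Borel sigma-algebra: 'rV[R]_n has no measurable structure in the library. *)
HB.instance Definition _ := @isMeasurable.Build
  (sigma_display (@open 'rV[R]_n)) 'rV[R]_n <<s @open 'rV[R]_n >>
  (@sigma_algebra0 _ setT _) (@sigma_algebraC _ _)
  (@sigma_algebra_bigcup _ setT _).

Lemma open_measurable_rV (U : set 'rV[R]_n) : open U -> measurable U.
Proof. exact: sub_sigma_algebra. Qed.

Lemma measurable_coord_rV (i : 'I_n) :
  measurable_fun [set: 'rV[R]_n] (fun v : 'rV[R]_n => v 0 i).
Proof.
have cE := @measurability _ _ _ _ setT (fun v : 'rV[R]_n => v 0 i) (@RGenOpens.G R).
apply: cE; first exact: RGenOpens.measurableE.
move=> _ [_ [a [b ->]] <-]; rewrite setTI; apply: open_measurable_rV.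
apply: open_comp; last exact: interval_open.
by move=> v _; exact: coord_continuous.
Qed.

Lemma measurable_fun_rV d (T : measurableType d) (f : T -> 'rV[R]_n) :
  (forall i, measurable_fun [set: T] (fun x => f x 0 i)) ->
  measurable_fun [set: T] f.
Proof.
move=> mf; apply: (@measurability _ _ _ _ _ f (@open 'rV[R]_n)) => //.
move=> _ [U oU <-]; rewrite setTI.
pose box (q : {ffun 'I_n -> rat} * rat) : set 'rV[R]_n :=
  [set v | forall i, ball (ratr (q.1 i) : R) (ratr q.2) (v 0 i)].
have -> : U = \bigcup_(q in [set q | box q `<=` U]) box q.
  apply/seteqP; split => [v Uv|v [q /= qU qv]]; last exact: qU.
  have /nbhs_ballP[e /= e0 eU] : nbhs v U by exact: open_nbhs_nbhs.
  have [r] := rat_in_itvoo (divr_gt0 e0 (ltr0n R 2)).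
  rewrite in_itv/= => /andP[r0 re].
  have h (i : 'I_n) : exists q : rat, ball (ratr q : R) (ratr r) (v 0 i).
    have [|q] := @rat_in_itvoo R (v 0 i - ratr r) (v 0 i + ratr r).
      by rewrite ltrBlDr -addrA ltrDl addr_gt0.
    by rewrite in_itv/= => ?; exists q; rewrite /ball/= distrC ltr_distlC.
  have [g gP] := choice h.
  exists ([ffun i => g i], r); last by move=> i /=; rewrite ffunE.
  move=> w /= wP; apply: eU; split => // i0 i; rewrite (ord1 i0).
  have := wP i; rewrite ffunE => wi.
  apply: (@le_ball _ _ _ (ratr r + ratr r)); last first.
    by apply: (ball_triangle _ wi); exact: ball_sym.
  by rewrite [leRHS]splitr lerD// ltW.
rewrite preimage_bigcup bigcup_mkcond.
apply: countable_bigcupT_measurable; first exact: countableP.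
move=> q; case: ifPn => // _.
rewrite (_ : _ @^-1` _ = \bigcap_(i in [set: 'I_n])
    ((fun x => f x 0 i) @^-1` ball (ratr (q.1 i) : R) (ratr q.2))); last first.
  by apply/seteqP; split => [x h i _|x h i]; exact: h.
apply: fin_bigcap_measurable => // i _.
by rewrite -[X in measurable X]setTI; apply: mf => //; exact: measurable_ball.
Qed.

End borel_rV.

Lemma product_measure_sigma_finite d1 d2 (T1 : measurableType d1)
    (T2 : measurableType d2) (R : realType)
    (m1 : {sigma_finite_measure set T1 -> \bar R})
    (m2 : {sigma_finite_measure set T2 -> \bar R}) :
  sigma_finite setT (m1 \x m2)%E.
Proof.
have /sigma_finiteP[F [TF ndF Foo]] := sigma_finiteT m1.
have /sigma_finiteP[G [TG ndG Goo]] := sigma_finiteT m2.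
exists (fun n => F n `*` G n).
  rewrite -setXTT TF TG predeqE => -[x y]; split.
    move=> [/= [n _ Fnx] [k _ Gky]]; exists (maxn n k) => //; split.
    - by move: x Fnx; exact/subsetPset/ndF/leq_maxl.
    - by move: y Gky; exact/subsetPset/ndG/leq_maxr.
  by move=> [n _ []/= ? ?]; split; exists n.
move=> k; have [? ?] := Foo k; have [? ?] := Goo k.
split; first exact: measurableX.
by rewrite product_measure1E// lte_mul_pinfty// ge0_fin_numE.
Qed.

Section lebesgue_rV.
Variable R : realType.

Definition rV_cons n (p : R * 'rV[R]_n) : 'rV[R]_n.+1 :=
  row_mx (p.1%:M : 'rV_1) p.2.

Definition rV_uncons n (v : 'rV[R]_n.+1) : R * 'rV[R]_n :=
  (v 0 0, \row_i v 0 (lift 0 i)).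

Lemma rV_cons0 n (p : R * 'rV[R]_n) : rV_cons p 0 0 = p.1.
Proof. by rewrite /rV_cons mxE; case: splitP => // j _; rewrite (ord1 j) mxE. Qed.

Lemma rV_consS n (p : R * 'rV[R]_n) i : rV_cons p 0 (lift 0 i) = p.2 0 i.
Proof.
rewrite /rV_cons mxE; case: splitP => [j|j /= [/val_inj ->]//].
by rewrite (ord1 j).
Qed.

Lemma rV_consK n : cancel (@rV_cons n) (@rV_uncons n).
Proof.
move=> [t v]; rewrite /rV_uncons rV_cons0; congr pair.
by apply/rowP => i; rewrite mxE rV_consS.
Qed.

Lemma measurable_rV_cons n : measurable_fun setT (@rV_cons n).
Proof.
apply: measurable_fun_rV => i.
case: (fintype.unliftP 0 i) => [j|] ->; last first.
  apply: (@eq_measurable_fun _ _ _ _ _ (@fst R 'rV[R]_n)) => //.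
  by move=> p _; rewrite rV_cons0.
apply: (@eq_measurable_fun _ _ _ _ _ (fun p : R * 'rV[R]_n => p.2 0 j)).
  by move=> p _; rewrite rV_consS.
exact: measurableT_comp (@measurable_coord_rV R n j) measurable_snd.
Qed.

Lemma measurable_rV_uncons n : measurable_fun setT (@rV_uncons n).
Proof.
apply/measurable_fun_pairP; split; first exact: measurable_coord_rV.
apply: measurable_fun_rV => i.
apply: (@eq_measurable_fun _ _ _ _ _ (fun v : 'rV[R]_n.+1 => v 0 (lift 0 i))).
  by move=> v _; rewrite /= mxE.
exact: measurable_coord_rV.
Qed.

Section lebesgue_rVS.
Variables (n : nat) (m : {sigma_finite_measure set 'rV[R]_n -> \bar R}).

Definition lebesgue_rVS : set 'rV[R]_n.+1 -> \bar R :=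
  pushforward (@lebesgue_measure R \x m)%E (@rV_cons n).

Let mrV_cons := @measurable_rV_cons n.

Let lebesgue_rVS0 : lebesgue_rVS set0 = 0%E.
Proof. by rewrite /lebesgue_rVS /pushforward preimage_set0 measure0. Qed.

Let lebesgue_rVS_ge0 A : (0 <= lebesgue_rVS A)%E.
Proof.
by rewrite /lebesgue_rVS /pushforward;
  exact: (measure_ge0 (lebesgue_measure \x m)%E).
Qed.

Let lebesgue_rVS_sigma_additive : semi_sigma_additive lebesgue_rVS.
Proof.
exact: (@measure_semi_sigma_additive _ _ _
  (measure_function_pushforward__canonical__measure_function_Measure
     (lebesgue_measure \x m)%E mrV_cons)).
Qed.

HB.instance Definition _ := isMeasure.Build _ _ _ lebesgue_rVS
  lebesgue_rVS0 lebesgue_rVS_ge0 lebesgue_rVS_sigma_additive.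

Let lebesgue_rVS_sigma_finite : sigma_finite setT lebesgue_rVS.
Proof.
have [F FT Ffin] : sigma_finite setT (@lebesgue_measure R \x m)%E.
  exact: (@product_measure_sigma_finite _ _ _ _ _ (@lebesgue_measure R)).
exists (fun k => @rV_uncons n @^-1` F k).
  by rewrite -preimage_bigcup -FT preimage_setT.
move=> k; have [mF Foo] := Ffin k; split.
  by rewrite -[X in measurable X]setTI; exact: measurable_rV_uncons.
rewrite /lebesgue_rVS /pushforward (_ : _ @^-1` _ = F k)//.
by apply/seteqP; split => p /=; rewrite rV_consK.
Qed.

HB.instance Definition _ := Measure_isSigmaFinite.Build _ _ _ lebesgue_rVS
  lebesgue_rVS_sigma_finite.

End lebesgue_rVS.

(* Lebesgue measure on R^n as an iterated product, transported to row vectors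
   by rV_cons; lebesgue_rV_box gives its value on boxes. *)
Fixpoint lebesgue_rV n : {sigma_finite_measure set 'rV[R]_n -> \bar R} :=
  match n return {sigma_finite_measure set 'rV[R]_n -> \bar R} with
  | 0%N => \d_(0 : 'rV[R]_0)
  | n.+1 => lebesgue_rVS (lebesgue_rV n)
  end.

Lemma lebesgue_rV_box n (A : 'I_n -> set R) : (forall i, measurable (A i)) ->
  lebesgue_rV n [set v | forall i, A i (v 0 i)] =
  (\prod_(i < n) lebesgue_measure (A i))%E.
Proof.
elim: n A => [|n IH] A mA.
  by rewrite big_ord0 /= diracE mem_set//= => -[].
pose B := [set v : 'rV[R]_n | forall i, A (lift ord0 i) (v 0 i)].
have mB : measurable B.
  rewrite (_ : B = \bigcap_(i in [set: 'I_n])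
      ((fun v : 'rV[R]_n => v 0 i) @^-1` A (lift ord0 i))).
    apply: fin_bigcap_measurable => // i _.
    by rewrite -[X in measurable X]setTI; apply: measurable_coord_rV.
  by apply/seteqP; split => [v h i _|v h i]; exact: h.
transitivity ((@lebesgue_measure R \x lebesgue_rV n)%E (A ord0 `*` B)).
  2: {
    rewrite big_ord_recl -IH//.
    exact: (@product_measure1E _ _ (measurableTypeR R) _ R lebesgue_measure
      (lebesgue_rV n) _ _ (mA ord0) mB).
  }
rewrite /= /lebesgue_rVS /pushforward; congr product_measure1; apply/seteqP; split => [p /= h|p /= [h0 h] i].
  by split=> [|i]; [rewrite -rV_cons0|rewrite -rV_consS]; exact: h.
by case: (fintype.unliftP 0 i) => [j|] ->; rewrite ?rV_consS ?rV_cons0.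
Qed.

End lebesgue_rV.

Section function_spaces.
Variables (R : realType) (n : nat).
Local Notation rV := 'rV[R]_n.
Implicit Types (f u psi : rV -> R) (Omega : set rV) (g : rV -> rV).

Local Notation mu := (lebesgue_rV R n).

Definition partial (i : 'I_n) f : rV -> R := 'D_(delta_mx 0 i) f.

Fixpoint Ck (k : nat) f : Prop :=
  continuous f /\
  if k is k'.+1 then
    forall i, (forall x, derivable f x (delta_mx 0 i)) /\ Ck k' (partial i f)
  else True.

(* C_c^infty(Omega), with elements being extended by 0 outside Omega *)
Definition test_function Omega f : Prop :=
  [/\ forall k, Ck k f, compact (closure [set x | f x != 0])
    & closure [set x | f x != 0] `<=` Omega].

Definition L1 (A : set rV) f : Prop := mu.-integrable A (EFin \o f).

Definition L1loc Omega f : Prop :=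
  forall K, compact K -> K `<=` Omega -> L1 K f.

Definition is_weak_gradient Omega u g : Prop :=
  [/\ L1loc Omega u, forall i, L1loc Omega (fun x => g x 0 i)
    & forall phi, test_function Omega phi -> forall i,
        \int[mu]_(x in Omega) (u x * partial i phi x) =
        - \int[mu]_(x in Omega) (g x 0 i * phi x)].

Definition W11loc Omega u : Prop := exists g, is_weak_gradient Omega u g.

(* A representative is chosen; it is unique almost everywhere on Omega, hence the
   norms and the energy below do not depend on the choice. *)
Definition weak_gradient Omega u : rV -> rV :=
  xget (fun=> 0) [set g | is_weak_gradient Omega u g].

Definition W11 Omega u : Prop :=
  [/\ W11loc Omega u, L1 Omega u
    & forall i, L1 Omega (fun x => weak_gradient Omega u x 0 i)].

Definition W11norm Omega u : \bar R :=
  (\int[mu]_(x in Omega) `|u x|%:E +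
   \sum_(i < n) \int[mu]_(x in Omega) `|weak_gradient Omega u x 0 i|%:E)%E.

(* W^{1,1}_0(Omega): the closure of C_c^infty(Omega) in W^{1,1}(Omega) *)
Definition W11_0 Omega psi : Prop :=
  W11 Omega psi /\
  exists2 phi : nat -> rV -> R, (forall k, test_function Omega (phi k)) &
    W11norm Omega (phi k \- psi) @[k --> \oo] --> 0%E.

End function_spaces.

Section minimisers_and_viscosity.
Variables (R : realType) (n : nat).
Local Notation rV := 'rV[R]_n.
Implicit Types (F u psi : rV -> R) (Omega : set rV).

Local Notation mu := (lebesgue_rV R n).

Definition energy F Omega u (B : set rV) : \bar R :=
  if `[< L1 B (F \o weak_gradient Omega u) >]
  then (\int[mu]_(x in B) (F (weak_gradient Omega u x))%:E)%E
  else +oo%E.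

(* psi in W^{1,1}_0(Omega') acts on Omega through its extension by 0 *)
Definition local_minimiser F Omega u : Prop :=
  W11loc Omega u /\
  forall Omega' : set rV, open Omega' -> compact (closure Omega') ->
    closure Omega' `<=` Omega ->
  forall psi, W11_0 Omega' psi ->
  (energy F Omega u Omega' <=
   energy F Omega (u \+ patch (cst 0) Omega' psi)%R Omega')%E.

Definition hessian F (p : rV) : 'M[R]_n :=
  \matrix_(i, j) partial i (partial j F) p.

Definition mxdot (A X : 'M[R]_n) : R := \sum_i \sum_j A i j * X i j.

Definition dot (p z : rV) : R := \sum_i p 0 i * z 0 i.

Definition quad (X : 'M[R]_n) (z : rV) : R :=
  \sum_i \sum_j X i j * z 0 i * z 0 j.

Definition superjet u (x : rV) : set (rV * 'M[R]_n) :=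
  [set pX | pX.2^T = pX.2 /\
    exists2 r : rV -> R, r =o_ (0 : rV) (fun z => dot z z) &
      \forall z \near (0 : rV),
        u (x + z) <= u x + dot pX.1 z + 2^-1 * quad pX.2 z + r z].

Definition subjet u (x : rV) : set (rV * 'M[R]_n) :=
  [set pX | pX.2^T = pX.2 /\
    exists2 r : rV -> R, r =o_ (0 : rV) (fun z => dot z z) &
      \forall z \near (0 : rV),
        u (x + z) >= u x + dot pX.1 z + 2^-1 * quad pX.2 z + r z].

Definition viscosity_solution F Omega u : Prop :=
  {within Omega, continuous u} /\
  forall x, Omega x ->
    (forall p X, superjet u x (p, X) -> 0 <= mxdot (hessian F p) X) /\
    (forall p X, subjet u x (p, X) -> mxdot (hessian F p) X <= 0).

End minimisers_and_viscosity.

(* Main.v *)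
Require Import Defs.
From HB Require Import structures.
From mathcomp Require Import all_boot all_order all_algebra.
From mathcomp Require Import all_classical all_reals all_analysis.
From mathcomp Require Import measurable_realfun.
From mathcomp Require Import ring lra.
Import Order.TTheory GRing.Theory Num.Theory.
Import numFieldNormedType.Exports.
Set Implicit Arguments.
Unset Strict Implicit.
Unset Printing Implicit Defensive.
Local Open Scope classical_set_scope.
Local Open Scope ring_scope.

(** Suppose that a jet of [u] at [a] has the wrong sign, say that
    [(p, X)] is a superjet with [F_AA(p) : X < 0]. Adding a small multiple of
    the identity to [X] gives a quadratic [q] that touches [u] from above at
    [a] only, and such that the field [F_A(Dq)] has negative divergence near
    [a]. For a small [k > 0] put [w := u - q + k]; then
    [D := {w > 0}] is an open set inside a small ball around [a], and [w]
    vanishes on its boundary.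

    Replacing [u] by [q - k] on [D] is an admissible competitor whose energy
    is finite whatever the growth of [F], so minimality first shows that [u]
    has finite energy on [D], and then that [\int_D F(Du) <= \int_D F(Dq)].
    Convexity of [F] bounds [F(Du) - F(Dq)] from below by [F_A(Dq) . Dw],
    so that [\int_D F_A(Dq) . Dw <= 0]. But integrating by parts,
    [\int_D F_A(Dq) . Dw = - \int_D div(F_A(Dq)) w > 0], because [w > 0] on [D].
    This contradiction is [minimiser_not_touched]; a factor [sg = 1] or
    [sg = -1] treats superjets and subjets at once, and
    [no_jet_of_wrong_sign] makes the link with jets.

    The analytic core is that [w] belongs to [W^{1,1}_0(D)], as the limit of
    explicit test functions ([W11_approx_superlevel]). They are [H(w_e)], with
    [w_e] a mollification of [w] and [H] a smooth function that is zero below a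
    level [d], is close to the identity, and has a derivative bounded
    independently of [d] and equal to 1 above [2 * d]. Since [w] is continuous,
    [w_e] is uniformly close to [w], and this makes the support of [H(w_e)] a
    compact subset of [D]; the gradients converge in [L^1] by dominated
    convergence. The same approximations yield the integration by parts and the
    weak gradient of the competitor.

    The chosen representative [weak_gradient] is controlled by uniqueness
    almost everywhere ([weak_gradient_unique]), which also rests on
    mollification: convolutions converge in [L^1] because translations are
    continuous in [L^1] ([translation_continuous]), and this follows from the
    density of compactly supported continuous functions ([Cc_dense]). *)

(** * Lebesgue measure: cubes and translations *)

Section lebesgue_translation.
Variable R : realType.

Lemma lebesgue_measure_shift (a : R) (A : set R) : measurable A ->
  lebesgue_measure ((fun x => x + a) @^-1` A) = lebesgue_measure A.
Proof.
move=> mA.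
have mf : measurable_fun setT (fun x : measurableTypeR R => x + a : measurableTypeR R).
  by apply: measurable_funD => //; exact: measurable_cst.
have H := @lebesgue_measure_unique R
  (measure_function_pushforward__canonical__measure_function_Measure
     lebesgue_measure mf).
rewrite [RHS]H//.
move=> _ [[x y] _ <-]; rewrite /= /pushforward.
rewrite (_ : _ @^-1` _ = [set` `]x - a, y - a]]); last first.
  apply/seteqP; split => z /=; rewrite !in_itv/=; lra.
rewrite !lebesgue_measure_itv/= !lte_fin ltrD2r.
by case: ifPn => // _; rewrite -!EFinB; congr EFin; ring.
Qed.

Variable n : nat.
Local Notation rV := 'rV[R]_n.
Local Notation mu := (lebesgue_rV R n).

Definition box (A : 'I_n -> set R) : set rV := [set v | forall i, A i (v 0 i)].

Definition measurable_boxes : set (set rV) :=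
  [set B | exists2 A, (forall i, measurable (A i)) & B = box A].

Lemma measurable_box A : (forall i, measurable (A i)) -> measurable (box A).
Proof.
move=> mA; rewrite (_ : box A = \bigcap_(i in [set: 'I_n])
    ((fun v : rV => v 0 i) @^-1` A i)).
  apply: fin_bigcap_measurable => // i _.
  by rewrite -[X in measurable X]setTI; exact: measurable_coord_rV.
by apply/seteqP; split => [v h i _|v h i]; exact: h.
Qed.

(** The identity map into the Borel sets is measurable for the sigma-algebra
    generated by boxes because its coordinates are. *)
Lemma sigma_boxesE : @measurable _ rV = <<s measurable_boxes >>.
Proof.
apply/seteqP; split; last first.
  apply: smallest_sub; first exact: sigma_algebra_measurable.
  by move=> _ [A mA ->]; exact: measurable_box.
move=> B mB.
have mid : measurable_fun [set: g_sigma_algebraType measurable_boxes]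
    (id : g_sigma_algebraType measurable_boxes -> rV).
  apply: measurable_fun_rV => i _ A mA; rewrite setTI.
  apply: sub_sigma_algebra; exists (fun j => if j == i then A else setT).
    by move=> j; case: ifPn.
  apply/seteqP; split => [v /= Av j|v /= /(_ i)]; last by rewrite eqxx.
  by case: ifPn => [/eqP->|].
by have := mid measurableT B mB; rewrite setTI.
Qed.

Lemma cube_boxE (x : rV) (r : R) : 0 < r ->
  ball x r = box (fun i => ball (x 0 i) r).
Proof.
move=> r0; apply/seteqP; split => v /= h.
  by move=> i; case: h => _; exact.
by split => // i j; rewrite (ord1 i); exact: h.
Qed.

Lemma lebesgue_box A : (forall i, measurable (A i)) ->
  mu (box A) = (\prod_(i < n) lebesgue_measure (A i))%E.
Proof. exact: lebesgue_rV_box. Qed.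

Lemma lebesgue_cube (x : rV) (r : R) : 0 < r -> mu (ball x r) = ((r *+ 2) ^+ n)%:E.
Proof.
move=> r0; rewrite cube_boxE// lebesgue_box; last by move=> i; exact: measurable_ball.
under eq_bigr do rewrite lebesgue_measure_ball ?ltW//.
by rewrite prodEFin prodr_const card_ord.
Qed.

Lemma bigcup_cube (x : rV) : \bigcup_k ball x k.+1%:R = setT.
Proof.
apply/seteqP; split => // v _.
exists (Num.truncn `|x - v|) => //.
by rewrite -ball_normE/=; exact: truncnS_gt.
Qed.

Lemma measurable_shift_rV (a : rV) : measurable_fun setT (fun x : rV => x + a).
Proof.
apply: measurable_fun_rV => i.
apply: (@eq_measurable_fun _ _ _ _ _ (fun x : rV => x 0 i + a 0 i)).
  by move=> v _; rewrite mxE.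
by apply: measurable_funD => //; exact: measurable_coord_rV.
Qed.

(** Boxes form a generating pi-system, and on a box the claim is the
    one-dimensional invariance in each factor. *)
Lemma lebesgue_rV_shift (a : rV) (A : set rV) : measurable A ->
  mu ((fun x => x + a) @^-1` A) = mu A.
Proof.
move=> mA; apply/esym.
apply: (@measure_unique _ _ _ measurable_boxes (fun k => ball (0 : rV) k.+1%:R)
  sigma_boxesE _ _ _ mu
  (measure_function_pushforward__canonical__measure_function_Measure
     mu (measurable_shift_rV a))) => //.
- move=> _ _ [A1 mA1 ->] [A2 mA2 ->]; exists (fun i => A1 i `&` A2 i).
    by move=> i; exact: measurableI.
  apply/seteqP; split => v /=; first by move=> [h1 h2] i; split.
  by move=> h; split => i; have [] := h i.
- move=> k; exists (fun i => ball 0 k.+1%:R); first by move=> i; exact: measurable_ball.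
  by rewrite cube_boxE//; congr box; apply/funext => i; rewrite mxE.
- exact: bigcup_cube.
- move=> _ [B mB ->]; apply: (etrans (lebesgue_box mB)); rewrite /= /pushforward.
  rewrite (_ : _ @^-1` _ = box (fun i => (fun x => x + a 0 i) @^-1` B i)); last first.
    apply/seteqP; split => v /= h i; first by have := h i; rewrite mxE.
    by rewrite mxE; exact: h.
  rewrite lebesgue_box.
    by apply: eq_bigr => i _; rewrite lebesgue_measure_shift.
  move=> i; rewrite -[X in measurable X]setTI.
  by apply: (measurable_funD (@measurable_id _ _ _) (@measurable_cst _ _ _ _ setT (a 0 i))).
- move=> k; have := ltry (((k.+1%:R : R) *+ 2) ^+ n).
  by rewrite -(lebesgue_cube 0).
Qed.

End lebesgue_translation.

(** * Integrable functions *)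

Section integral_rV.
Variables (R : realType) (n : nat).
Local Notation rV := 'rV[R]_n.
Local Notation mu := (lebesgue_rV R n).
Implicit Types (f g : rV -> R).

Lemma continuous_measurable_rV f : continuous f -> measurable_fun setT f.
Proof.
move=> cf.
apply: (@measurability _ _ _ _ setT f (@RGenOpens.G R)).
  exact: RGenOpens.measurableE.
move=> _ [_ [a [b ->]] <-]; rewrite setTI; apply: open_measurable_rV.
by apply: open_comp; [move=> v _; exact: cf|exact: interval_open].
Qed.

Lemma L1_measurable A f : L1 A f -> measurable_fun A f.
Proof. by move=> /integrableP[/measurable_EFinP]. Qed.

Lemma L1_0 A : L1 A (cst 0 : rV -> R).
Proof. exact: integrable0. Qed.

Lemma L1D A f g : measurable A -> L1 A f -> L1 A g -> L1 A (fun x => f x + g x).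
Proof. by move=> mA; exact: integrableD. Qed.

Lemma L1B A f g : measurable A -> L1 A f -> L1 A g -> L1 A (fun x => f x - g x).
Proof. by move=> mA; exact: integrableB. Qed.

Lemma L1Z A (k : R) f : measurable A -> L1 A f -> L1 A (fun x => k * f x).
Proof. by move=> mA; exact: integrableZl. Qed.

Lemma L1_norm A f : L1 A f -> L1 A (fun x => `|f x|).
Proof. exact: integrable_norm. Qed.

Lemma L1_le A f g : measurable A -> measurable_fun A f -> L1 A g ->
  (forall x, A x -> `|f x| <= `|g x|) -> L1 A f.
Proof.
move=> mA mf Lg fg; apply: le_integrable Lg => //.
exact/measurable_EFinP.
Qed.

Lemma L1M A f g (M : R) : measurable A -> measurable_fun A f ->
  (forall x, A x -> `|f x| <= M) -> L1 A g -> L1 A (fun x => f x * g x).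
Proof.
move=> mA mf fM Lg; apply: (@L1_le _ _ (fun x => M * g x)) => //.
- by apply: measurable_funM => //; exact: L1_measurable Lg.
- exact: L1Z.
- move=> x Ax; rewrite !normrM ler_wpM2r//.
  exact: le_trans (fM _ Ax) (ler_norm _).
Qed.

Lemma L1_sum (I : eqType) A (s : seq I) (F : I -> rV -> R) : measurable A ->
  (forall i, i \in s -> L1 A (F i)) -> L1 A (fun x => \sum_(i <- s) F i x).
Proof.
move=> mA; elim: s => [|i s IH] H.
  by under [X in L1 _ X]eq_fun do rewrite big_nil; exact: L1_0.
under [X in L1 _ X]eq_fun do rewrite big_cons.
apply: L1D => //; first by apply: H; rewrite mem_head.
by apply: IH => j js; apply: H; rewrite inE js orbT.
Qed.

Lemma L1_restrict A f : measurable A -> L1 A f <-> L1 setT (f \_ A).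
Proof.
move=> mA; rewrite /L1 -restrict_EFin.
exact: integrable_mkcond.
Qed.

Lemma L1S A B f : measurable A -> measurable B -> B `<=` A -> L1 A f -> L1 B f.
Proof. by move=> mA mB BA; exact: integrableS. Qed.

Lemma L1_eq A f g : measurable A -> (forall x, A x -> f x = g x) ->
  L1 A f -> L1 A g.
Proof.
move=> mA fg; apply: eq_integrable => //.
by move=> x; rewrite inE => Ax /=; rewrite fg.
Qed.

Lemma Rintegral_sum (I : eqType) A (s : seq I) (F : I -> rV -> R) : measurable A ->
  (forall i, i \in s -> L1 A (F i)) ->
  \int[mu]_(x in A) (\sum_(i <- s) F i x) = \sum_(i <- s) \int[mu]_(x in A) F i x.
Proof.
move=> mA; elim: s => [|i s IH] H.
  under eq_Rintegral do rewrite big_nil.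
  by rewrite big_nil Rintegral_cst// mul0r.
under eq_Rintegral do rewrite big_cons.
have Ls : forall j, j \in s -> L1 A (F j) by move=> j js; apply: H; rewrite inE js orbT.
rewrite RintegralD ?IH ?big_cons//; first by apply: H; rewrite mem_head.
exact: L1_sum.
Qed.

Lemma ge0_integral_shift (a : rV) (f : rV -> \bar R) :
  measurable_fun setT f -> (forall x, 0 <= f x)%E ->
  (\int[mu]_x f (x + a)%R = \int[mu]_x f x)%E.
Proof.
move=> mf f0.
have := @ge0_integral_pushforward _ _ _ _ R _ (measurable_shift_rV a) mu setT f
  measurableT mf (fun x _ => f0 x).
rewrite preimage_setT => <-.
apply: eq_measure_integral => [|? A mA _]; first exact: measurable_shift_rV.
exact: lebesgue_rV_shift.
Qed.

Lemma L1_shift (a : rV) f : L1 setT f -> L1 setT (fun x => f (x + a)).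
Proof.
move=> /integrableP[mf foo]; apply/integrableP; split.
  by apply: measurableT_comp mf _; exact: measurable_shift_rV.
rewrite (ge0_integral_shift a (f := fun x => `|(f x)%:E|%E))//.
exact: measurableT_comp.
Qed.

Lemma Rintegral_shift (a : rV) f : L1 setT f ->
  \int[mu]_x f (x + a) = \int[mu]_x f x.
Proof.
move=> Lf; congr fine.
have := @integral_pushforward _ _ _ _ R _ (measurable_shift_rV a) mu setT
  (EFin \o f) (measurable_int mu Lf).
rewrite preimage_setT => /(_ (L1_shift a Lf) measurableT) <-.
apply: eq_measure_integral => [|? A mA _]; first exact: measurable_shift_rV.
exact: lebesgue_rV_shift.
Qed.

End integral_rV.

(** * Derivatives along lines *)

Section line_calculus.
Variables (R : realType) (n : nat).
Local Notation rV := 'rV[R]_n.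
Implicit Types (f g : rV -> R) (x v w : rV).

Lemma is_derive_line f v x (t : R) : derivable f (t *: v + x) v ->
  is_derive t 1 (fun s : R => f (s *: v + x)) ('D_v f (t *: v + x)).
Proof.
move=> df.
have E : (fun h : R => h^-1 *: ((fun s => f (s *: v + x)) (h *: (1:R) + t) -
    f (t *: v + x))) =
  (fun h : R => h^-1 *: (f (h *: v + (t *: v + x)) - f (t *: v + x))).
  apply/funext => h; congr (_ *: (f _ - _)).
  by rewrite -[h *: 1]/(h * 1) mulr1 scalerDl addrA.
apply: DeriveDef; last by rewrite /derive E.
by rewrite /derivable E.
Qed.

Lemma line_MVT f v x (h : R) : (forall y, derivable f y v) ->
  exists2 c : R, `|c| <= `|h| & f (h *: v + x) - f x = h * 'D_v f (c *: v + x).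
Proof.
move=> df; pose g s := f (s *: v + x); pose dg s := 'D_v f (s *: v + x).
have gd s : is_derive (s : R) (1 : R) g (dg s) by exact: is_derive_line.
have gc : continuous g.
  move=> s; apply: differentiable_continuous; apply/derivable1_diffP.
  by have [] := gd s.
have E : f (h *: v + x) - f x = g h - g 0 by rewrite /g scale0r add0r.
have [h0|h0] := leP 0 h.
- have [|c cI] := @MVT_segment R g dg 0 h h0 (fun s _ => gd s).
    exact: continuous_subspaceT.
  rewrite subr0 mulrC => gE; exists c; last by rewrite E gE.
  by move: cI; rewrite in_itv/= => /andP[c0 ch]; rewrite !ger0_norm.
- have [|c cI] := @MVT_segment R g dg h 0 (ltW h0) (fun s _ => gd s).
    exact: continuous_subspaceT.
  rewrite sub0r => gE; exists c; last first.
    by rewrite E -opprB gE mulrN opprK mulrC.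
  move: cI; rewrite in_itv/= => /andP[ch c0].
  by rewrite ler0_norm// ltr0_norm// lerN2.
Qed.

(** The increment along [v + c *: w] is split at the intermediate point
    [h *: v + x]. The leg along [v] converges by hypothesis; the mean value
    theorem expresses the leg along [w] as ['D_w f] at a point that tends to
    [x]. *)
Lemma is_deriveD_dir f v w x a (c : R) : is_derive x v f a ->
  (forall y, derivable f y w) -> {for x, continuous ('D_w f)} ->
  is_derive x (v + c *: w) f (a + c * 'D_w f x).
Proof.
move=> [dfv Ea] dfw cw.
have H : h^-1 *: (f (h *: (v + c *: w) + x) - f x) @[h --> 0^'] -->
    a + c * 'D_w f x.
  have E : (fun h : R => h^-1 *: (f (h *: (v + c *: w) + x) - f x)) =
    (fun h => h^-1 *: (f (h *: v + x) - f x)) \+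
    (fun h => h^-1 *: (f ((h * c) *: w + (h *: v + x)) - f (h *: v + x))).
    apply/funext => h /=; rewrite -scalerDr; congr (_ *: _).
    rewrite (_ : h *: (v + c *: w) + x = (h * c) *: w + (h *: v + x)); last first.
      by rewrite scalerDr scalerA addrA [h *: v + _]addrC.
    ring.
  rewrite E; apply: cvgD; first by rewrite -Ea; exact: dfv.
  apply/cvgrPdist_le => /= e e0.
  have c0 : 0 < `|c| + 1 by rewrite ltr_wpDl.
  have /cvgrPdist_le/(_ _ (divr_gt0 e0 c0))/nbhs_ballP[d /= d0 de] := cw.
  have M0 : 0 < `|c| * `|w| + `|v| + 1.
    by rewrite ltr_wpDl// addr_ge0// mulr_ge0.
  near=> h.
  have h0 : h != 0 by near: h; exact: nbhs_dnbhs_neq.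
  have [b bh ->] := line_MVT (h *: v + x) (h * c) dfw.
  rewrite /GRing.scale/= -mulrA mulKf// -mulrBr normrM.
  rewrite (@le_trans _ _ (`|c| * (e / (`|c| + 1))))//; last first.
    rewrite mulrA ler_pdivrMr// [`|c| * e]mulrC ler_wpM2l//; first exact: ltW.
    by rewrite lerDl.
  apply: ler_wpM2l => //; apply: de.
  rewrite -ball_normE/= addrA opprD addrCA subrr addr0 normrN.
  apply: (@le_lt_trans _ _ (`|h| * (`|c| * `|w| + `|v| + 1))).
    rewrite (le_trans (ler_normD _ _))// !normrZ mulrDr mulrDr mulr1.
    rewrite -[leLHS]addr0 lerD// lerD2r mulrA ler_wpM2r//.
    by rewrite -normrM.
  rewrite -ltr_pdivlMr//.
  near: h; apply: dnbhs0_lt; exact: divr_gt0.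
apply: DeriveDef; first by apply/cvg_ex; exists (a + c * 'D_w f x).
exact/cvg_lim.
Unshelve. all: by end_near. Qed.

(** The coordinate directions are added one at a time; each step uses the
    continuity of one partial derivative. *)
Lemma is_derive_C1 f x v : Ck 1 f ->
  is_derive x v f (\sum_i v 0 i * partial i f x).
Proof.
move=> [_ C1f]; rewrite {1}[v]row_sum_delta.
rewrite /index_enum; elim: (Finite.enum _) => [|i s IH].
  by rewrite !big_nil; exact: is_derive0.
rewrite !big_cons [X in is_derive _ X _ _]addrC [X in is_derive _ _ _ X]addrC.
have [dfi [ci _]] := C1f i.
by apply: is_deriveD_dir => //; exact: ci.
Qed.

End line_calculus.

(** * Functions of class C^k *)

Section Ck_closure.
Variables (R : realType) (n : nat).
Local Notation rV := 'rV[R]_n.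
Implicit Types (f g : rV -> R) (x : rV) (k : nat).

Definition smooth f := forall k, Ck k f.

Lemma Ck_continuous k f : Ck k f -> continuous f.
Proof. by case: k => [|k] []. Qed.

Lemma CkW k f : Ck k.+1 f -> Ck k f.
Proof.
elim: k f => [|k IH] f [cf df]; split => // i.
by have [dfi /IH Cfi] := df i.
Qed.

Lemma Ck_derivable k f i x : Ck k.+1 f -> derivable f x (delta_mx 0 i).
Proof. by move=> [_ /(_ i)[+ _]]; exact. Qed.

Lemma Ck_partial k f i : Ck k.+1 f -> Ck k (partial i f).
Proof. by move=> [_ /(_ i)[]]. Qed.

Lemma smooth_partial f i : smooth f -> smooth (partial i f).
Proof. by move=> sf k; exact: Ck_partial (sf k.+1). Qed.

(** Smoothness is a greatest fixed point: this is its coinduction principle.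
    It applies to convolutions, whose derivatives are again convolutions. *)
Lemma smooth_coind (P : (rV -> R) -> Prop) :
  (forall f, P f -> continuous f) ->
  (forall f i, P f -> (forall x, derivable f x (delta_mx 0 i)) /\ P (partial i f)) ->
  forall f, P f -> smooth f.
Proof.
move=> Pc Pd f Pf k; elim: k f Pf => [|k IH] f Pf; first by split; [exact: Pc|].
split; [exact: Pc|move=> i; have [dfi Pfi] := Pd f i Pf].
by split; [|exact: IH].
Qed.

Lemma partialD f g i : (forall x, derivable f x (delta_mx 0 i)) ->
  (forall x, derivable g x (delta_mx 0 i)) ->
  partial i (fun x => f x + g x) = (fun x => partial i f x + partial i g x).
Proof. by move=> df dg; apply/funext => x; exact: (deriveD (df x) (dg x)). Qed.

Lemma partialM f g i : (forall x, derivable f x (delta_mx 0 i)) ->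
  (forall x, derivable g x (delta_mx 0 i)) ->
  partial i (fun x => f x * g x) =
  (fun x => f x * partial i g x + g x * partial i f x).
Proof. by move=> df dg; apply/funext => x; exact: (deriveM (df x) (dg x)). Qed.

Lemma CkD k f g : Ck k f -> Ck k g -> Ck k (fun x => f x + g x).
Proof.
elim: k f g => [|k IH] f g [cf df] [cg dg]; split => //;
  try by move=> x; exact: continuousD (cf x) (cg x).
move=> i; have [dfi Cfi] := df i; have [dgi Cgi] := dg i.
split; first by move=> x; exact: (derivableD (dfi x) (dgi x)).
by rewrite (partialD dfi dgi); exact: IH.
Qed.

Lemma CkM k f g : Ck k f -> Ck k g -> Ck k (fun x => f x * g x).
Proof.
elim: k f g => [|k IH] f g Cf Cg; have [cf df] := Cf; have [cg dg] := Cg;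
  split => //; try by move=> x; exact: continuousM (cf x) (cg x).
move=> i; have [dfi Cfi] := df i; have [dgi Cgi] := dg i.
split; first by move=> x; exact: (derivableM (dfi x) (dgi x)).
rewrite (partialM dfi dgi).
by apply: CkD; apply: IH => //; exact: CkW.
Qed.

Lemma Ck_cst k (c : R) : Ck k (fun _ : rV => c).
Proof.
elim: k c => [|k IH] c; split => //; try exact: cst_continuous.
move=> i; split; first by move=> x; exact: (derivable_cst c x (delta_mx 0 i)).
rewrite (_ : partial i _ = fun=> 0)//.
by apply/funext => x; exact: (derive_cst c x (delta_mx 0 i)).
Qed.

Lemma is_derive_coord (j : 'I_n) x v :
  is_derive x v (fun y : rV => y 0 j) (v 0 j).
Proof.
have H : h^-1 *: ((h *: v + x) 0 j - x 0 j) @[h --> 0^'] --> v 0 j.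
  apply: (cvg_trans (near_eq_cvg _) (cvg_cst _)).
  near=> h; have h0 : h != 0 by near: h; exact: nbhs_dnbhs_neq.
  by rewrite !mxE addrK /GRing.scale/= mulKf.
apply: DeriveDef; first by apply/cvg_ex; exists (v 0 j).
exact/cvg_lim.
Unshelve. all: by end_near. Qed.

Lemma Ck_coord k j : Ck k (fun x : rV => x 0 j).
Proof.
case: k => [|k]; first by split => // x; exact: coord_continuous.
split; first by move=> x; exact: coord_continuous.
move=> i; split; first by move=> x; have [] := is_derive_coord j x (delta_mx 0 i).
rewrite (_ : partial i _ = fun=> (delta_mx 0 i : rV) 0 j); first exact: Ck_cst.
by apply/funext => x; have [] := is_derive_coord j x (delta_mx 0 i).
Qed.

Lemma CkZ k (c : R) f : Ck k f -> Ck k (fun x => c * f x).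
Proof. by apply: CkM; exact: Ck_cst. Qed.

Lemma CkN k f : Ck k f -> Ck k (fun x => - f x).
Proof.
move=> /(CkZ (-1)); rewrite (_ : (fun x => - f x) = (fun x => -1 * f x))//.
by apply/funext => x; rewrite mulN1r.
Qed.

Lemma Ck_sum (I : Type) k (s : seq I) (F : I -> rV -> R) :
  (forall i, Ck k (F i)) -> Ck k (fun x => \sum_(i <- s) F i x).
Proof.
move=> CF; elim: s => [|i s IH].
  by under [X in Ck _ X]eq_fun do rewrite big_nil; exact: Ck_cst.
by under [X in Ck _ X]eq_fun do rewrite big_cons; exact: CkD.
Qed.

Lemma is_derive_shift_rV f x (a : rV) v d : is_derive (x + a) v f d ->
  is_derive x v (fun y => f (y + a)) d.
Proof.
move=> [df <-].
have E : (fun h : R => h^-1 *: (f (h *: v + x + a) - f (x + a))) =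
  (fun h : R => h^-1 *: (f (h *: v + (x + a)) - f (x + a))).
  by apply/funext => h; rewrite addrA.
by apply: DeriveDef; [rewrite /derivable E; exact: df|rewrite /derive E].
Qed.

Lemma partial_shift f i (a : rV) : (forall x, derivable f x (delta_mx 0 i)) ->
  partial i (fun y => f (y + a)) = (fun y => partial i f (y + a)).
Proof.
move=> df; apply/funext => x.
by have [] := is_derive_shift_rV (derivableP (df (x + a))).
Qed.

Lemma Ck_shift k f (a : rV) : Ck k f -> Ck k (fun x => f (x + a)).
Proof.
have cs g : continuous g -> continuous (fun x : rV => g (x + a)).
  move=> cg x; apply: continuous_comp; last exact: cg.
  by apply: continuousD; [exact: cvg_id|exact: cst_continuous].
elim: k f => [|k IH] f [cf df]; split => //; try exact: cs.
move=> i; have [dfi Cfi] := df i; split.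
  move=> x; apply: ex_derive; apply: is_derive_shift_rV.
  exact: derivableP.
by rewrite partial_shift//; exact: IH.
Qed.

(** The analogue of [Ck] in one variable, for outer functions of
    compositions. *)
Fixpoint CkR k (h : R -> R) : Prop :=
  continuous h /\
  if k is k'.+1 then (forall t, derivable h t 1) /\ CkR k' (derive1 h) else True.

Lemma is_derive_comp_rV (h : R -> R) f x v : derivable h (f x) 1 ->
  derivable f x v -> is_derive x v (h \o f) (derive1 h (f x) * 'D_v f x).
Proof.
move=> dh df; pose l (s : R) := f (s *: v + x).
have l0 : l 0 = f x by rewrite /l scale0r add0r.
(* the chain rule in one variable is applied on the line through [x] along [v] *)
have dl : is_derive (0 : R) (1 : R) l ('D_v f x).
  have df0 : derivable f (0 *: v + x) v by rewrite scale0r add0r.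
  by have := is_derive_line df0; rewrite scale0r add0r.
have dhl : is_derive (l 0) (1 : R) h (derive1 h (f x)).
  rewrite l0 derive1E; exact: (derivableP dh).
have [dc Ec] := is_derive1_comp dhl dl.
have E : (fun s : R => s^-1 *: ((h \o f) (s *: v + x) - (h \o f) x)) =
  (fun s : R => s^-1 *: ((h \o l) (s *: (1 : R) + 0) - (h \o l) 0)).
  apply/funext => s /=.
  by rewrite -[s *: 1]/(s * 1) mulr1 addr0 l0.
apply: DeriveDef; first by rewrite /derivable E; exact: dc.
by rewrite /derive E; exact: Ec.
Qed.

Lemma partial_comp (h : R -> R) f i : (forall t, derivable h t 1) ->
  (forall x, derivable f x (delta_mx 0 i)) ->
  partial i (h \o f) = (fun x => derive1 h (f x) * partial i f x).
Proof.
move=> dh df; apply/funext => x.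
by have [] := is_derive_comp_rV (dh (f x)) (df x).
Qed.

Lemma Ck_comp k (h : R -> R) f : CkR k h -> Ck k f -> Ck k (h \o f).
Proof.
elim: k h f => [|k IH] h f [ch dh] Cf; have [cf df] := Cf; split => //;
  try by move=> x; apply: continuous_comp; [exact: cf|exact: ch].
move=> i; have [dfi Cfi] := df i; have [dht Ch] := dh; split.
  by move=> x; apply: ex_derive; apply: is_derive_comp_rV.
by rewrite partial_comp//; apply: CkM => //; apply: IH => //; exact: CkW.
Qed.

End Ck_closure.

(** * Flat functions of one variable *)

Section flat_exponential.
Variable R : realType.
Implicit Types (t : R) (m k : nat).

(** The exponent [m] makes the family stable under differentiation, up to
    linear combinations. *)
Definition flat_exp m t : R := if 0 < t then t^-1 ^+ m * expR (- t^-1) else 0.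

Lemma flat_exp_ge0 m t : 0 <= flat_exp m t.
Proof.
rewrite /flat_exp; case: ifPn => // t0.
by rewrite mulr_ge0 ?expR_ge0// exprn_ge0// invr_ge0 ltW.
Qed.

(** From [s ^+ m.+1 / m.+1`! <= expR s] at [s = t^-1]. A bound that is linear
    in [t] is what differentiability at 0 requires. *)
Lemma flat_exp_bound m t : `|flat_exp m t| <= (m.+1)`!%:R * `|t|.
Proof.
rewrite ger0_norm ?flat_exp_ge0// /flat_exp; case: ifPn => t0; last first.
  by rewrite mulr_ge0.
rewrite gtr0_norm// expRN; set s := t^-1; have s0 : 0 < s by rewrite invr_gt0.
rewrite ler_pdivrMr ?expR_gt0// -ler_pdivrMl; last by rewrite mulr_gt0// ltr0n fact_gt0.
rewrite invfM -/s; apply: le_trans (expR_ge1Dxn m (ltW s0)).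
rewrite exprS; have -> : m.+1`!%:R^-1 * s * s ^+ m = s * s ^+ m / m.+1`!%:R by ring.
by rewrite lerDr.
Qed.

(** At 0, the difference quotient of [flat_exp m] is [flat_exp m.+1], which
    tends to 0 by the linear bound. *)
Lemma is_derive_flat_exp m t :
  is_derive t (1:R) (flat_exp m) (- m%:R * flat_exp m.+1 t + flat_exp m.+2 t).
Proof.
have [t0|t0|->] := ltgtP t 0.
- apply: (@near_eq_is_derive _ _ _ (cst 0)).
    near=> s; rewrite /flat_exp ifN// -leNgt ltW//.
    by near: s; exact: lt_nbhsl.
  rewrite /flat_exp !ifN ?mulr0 ?addr0//; try by rewrite -leNgt ltW.
  exact: is_derive_cst.
- apply: (@near_eq_is_derive R R R (fun s : R => s^-1 ^+ m * expR (- s^-1))).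
    near=> s; rewrite /flat_exp ifT//.
    by near: s; exact: lt_nbhsr.
  have tn0 : t != 0 by rewrite gt_eqF.
  have d1 : is_derive t (1:R) (fun s : R => s^-1) (- t ^- 2).
    apply: DeriveDef; first exact: (derivableV tn0 (@derivable_id _ _ t 1)).
    rewrite (deriveV (f := id) tn0 (@derivable_id _ _ t 1)) derive_id.
    by rewrite /GRing.scale/= mulr1.
  have d2 : is_derive t (1:R) (fun s : R => expR (- s^-1)) (expR (- t^-1) * t ^- 2).
    have := is_derive1_comp (g := fun s : R => - s^-1) (is_derive_expR (- t^-1))
      (is_deriveN d1).
    by rewrite opprK.
  have d3 : is_derive t (1:R) (fun s : R => s^-1 ^+ m)
      (m%:R * t^-1 ^+ m.-1 * (- t ^- 2)).
    have -> : (fun s : R => s^-1 ^+ m) = (fun s : R => s^-1) ^+ m.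
      by rewrite exprfctE.
    exact: (is_deriveX m d1).
  have := is_deriveM d3 d2; congr is_derive.
  rewrite /flat_exp !ifT// /GRing.scale/=.
  case: m {d3} => [|m]/=; rewrite -exprVn; first by ring.
  by rewrite !exprS; ring.
- have H : h^-1 *: (flat_exp m (h *: 1 + 0) - flat_exp m 0) @[h --> (0:R)^'] --> (0:R).
    have -> : (fun h : R => h^-1 *: (flat_exp m (h *: 1 + 0) - flat_exp m 0)) =
        flat_exp m.+1.
      apply/funext => h; rewrite addr0 -[h *: 1]/(h * 1) mulr1.
      rewrite [X in _ - X]/flat_exp ltxx subr0 /flat_exp.
      case: ifPn => _; last by rewrite scaler0.
      by rewrite /GRing.scale/= exprS mulrA.
    apply/cvgr0Pnorm_lt => e e0.
    have M0 : 0 < m.+2`!%:R :> R by rewrite ltr0n fact_gt0.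
    near=> h; apply: (le_lt_trans (flat_exp_bound _ _)).
    rewrite mulrC -ltr_pdivlMr//.
    by near: h; apply: dnbhs0_lt; exact: divr_gt0.
  rewrite [flat_exp m.+1 0]/flat_exp [flat_exp m.+2 0]/flat_exp ltxx mulr0 addr0.
  apply: DeriveDef; first by apply/cvg_ex; exists 0.
  exact/cvg_lim.
Unshelve. all: by end_near. Qed.

Lemma continuous_flat_exp m : continuous (flat_exp m).
Proof.
move=> t; apply: differentiable_continuous; apply/derivable1_diffP.
by have [] := is_derive_flat_exp m t.
Qed.

Lemma CkRD k (g h : R -> R) : CkR k g -> CkR k h -> CkR k (fun t => g t + h t).
Proof.
elim: k g h => [|k IH] g h [cg dg] [ch dh]; split => //;
  try by move=> t; exact: continuousD (cg t) (ch t).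
have [dgt Cg] := dg; have [dht Ch] := dh; split.
  by move=> t; exact: (derivableD (dgt t) (dht t)).
rewrite (_ : derive1 _ = fun t => derive1 g t + derive1 h t); first exact: IH.
apply/funext => t; rewrite !derive1E.
exact: (deriveD (dgt t) (dht t)).
Qed.

Lemma CkRZ k (c : R) (h : R -> R) : CkR k h -> CkR k (fun t => c * h t).
Proof.
elim: k h => [|k IH] h [ch dh]; split => //;
  try by move=> t; apply: continuousM; [exact: cvg_cst|exact: ch].
have [dht Ch] := dh; split.
  by move=> t; exact: derivableZ.
rewrite (_ : derive1 _ = fun t => c * derive1 h t); first exact: IH.
apply/funext => t; rewrite !derive1E.
exact: deriveZ.
Qed.

Lemma CkR_flat_exp k m : CkR k (flat_exp m).
Proof.
elim: k m => [|k IH] m; split; try exact: continuous_flat_exp; first by [].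
split; first by move=> t; have [] := is_derive_flat_exp m t.
rewrite (_ : derive1 _ =
  fun t => - m%:R * flat_exp m.+1 t + flat_exp m.+2 t).
  by apply: CkRD => //; exact: CkRZ.
by apply/funext => t; rewrite derive1E; have [] := is_derive_flat_exp m t.
Qed.

End flat_exponential.

(** * Compact sets and compactly supported functions *)

Section compact_rV.
Variables (R : realType) (n : nat).
Local Notation rV := 'rV[R]_n.
Local Notation mu := (lebesgue_rV R n).
Implicit Types (f g : rV -> R) (x : rV).

Definition cball x (r : R) : set rV := [set y | `|x - y| <= r].

Lemma closed_cball x (r : R) : closed (cball x r).
Proof. exact: closed_closed_ball_. Qed.

Lemma compact_cball x (r : R) : compact (cball x r).
Proof.
apply: bounded_closed_compact; last exact: closed_cball.
exists (r + `|x|); split; first exact: num_real.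
move=> M rM y /= xy; apply: le_trans (ltW rM).
rewrite -[y](subrK x) (le_trans (ler_normD _ _))// lerD2r distrC//.
Qed.

Lemma compact_sub_ball (K : set rV) : compact K -> exists2 M : R, 0 < M & K `<=` ball (0 : rV) M.
Proof.
move=> /compact_bounded[M [_ KM]]; exists (`|M| + 2); first by rewrite ltr_wpDl.
move=> x Kx; rewrite -ball_normE/= sub0r normrN.
apply: (@le_lt_trans _ _ (`|M| + 1)); last by rewrite ltrD2l ltr1n.
by apply: KM => //; rewrite (le_lt_trans (ler_norm _))// ltrDl.
Qed.

Lemma measurable_closed_rV (K : set rV) : closed K -> measurable K.
Proof.
move=> cK; rewrite -[K]setCK; apply: measurableC; apply: open_measurable_rV.
exact: closed_openC.
Qed.

Lemma measurable_compact_rV (K : set rV) : compact K -> measurable K.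
Proof.
by move=> cK; apply: measurable_closed_rV; apply: compact_closed => //; exact: norm_hausdorff.
Qed.

Lemma measurable_ball_rV x (r : R) : measurable (ball x r).
Proof. by apply: open_measurable_rV; exact: ball_open. Qed.

Lemma lebesgue_ball_fin x (r : R) : (mu (ball x r) < +oo)%E.
Proof.
have [r0|r0] := ltP 0 r; first by rewrite lebesgue_cube// ltry.
rewrite (_ : ball x r = set0) ?measure0//.
apply/seteqP; split => // y; rewrite -ball_normE/= => xy.
by have := le_lt_trans (normr_ge0 (x - y)) xy; rewrite ltNge r0.
Qed.

Lemma lebesgue_compact_fin (K : set rV) : compact K -> (mu K < +oo)%E.
Proof.
move=> cK; have [M _ KM] := compact_sub_ball cK.
apply: le_lt_trans (lebesgue_ball_fin 0 M).
by apply: le_measure => //; rewrite inE;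
  [exact: measurable_compact_rV|exact: measurable_ball_rV].
Qed.

Lemma L1_bounded A f (M : R) : measurable A -> (mu A < +oo)%E ->
  measurable_fun A f -> (forall x, A x -> `|f x| <= M) -> L1 A f.
Proof.
move=> mA Afin mf fM; apply: measurable_bounded_integrable => //.
exists M; split; first exact: num_real.
by move=> N MN x Ax; apply: le_trans (ltW MN); exact: fM.
Qed.

Lemma compact_continuous_bounded (K : set rV) f : compact K -> continuous f ->
  exists2 M : R, 0 <= M & forall x, K x -> `|f x| <= M.
Proof.
move=> cK cf.
have [K0|/set0P] := eqVneq K set0; first by exists 0 => // x; rewrite K0.
move=> Kn0.
have [|c _ cM] := @EVT_max_rV R n (fun x => `|f x|) K Kn0 cK.
  by apply: continuous_subspaceT => x; apply: continuous_comp; [exact: cf|exact: norm_continuous].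
by exists `|f c|; [exact: normr_ge0|move=> x Kx; apply: cM; exact: mem_set].
Qed.

Lemma L1_compact (K : set rV) f : compact K -> continuous f -> L1 K f.
Proof.
move=> cK cf; have [M _ fM] := compact_continuous_bounded cK cf.
apply: (@L1_bounded _ _ M) => //; first exact: measurable_compact_rV.
  exact: lebesgue_compact_fin.
by apply: measurable_funTS; exact: continuous_measurable_rV.
Qed.

Definition vanishes_off (K : set rV) f := forall x, ~ K x -> f x = 0.

Lemma restrict_vanishing (K : set rV) f : vanishes_off K f -> f \_ K = f.
Proof.
move=> fK; apply/funext => x; rewrite patchE; case: ifPn => //.
by rewrite notin_setE => /fK.
Qed.

Lemma L1_Cc (K : set rV) f : compact K -> continuous f -> vanishes_off K f ->
  L1 setT f.
Proof.
move=> cK cf fK; rewrite -(restrict_vanishing fK); apply: (L1_restrict _ (measurable_compact_rV cK)).1.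
exact: L1_compact.
Qed.

Lemma Cc_bounded (K : set rV) f : compact K -> continuous f -> vanishes_off K f ->
  exists2 M : R, 0 <= M & forall x, `|f x| <= M.
Proof.
move=> cK cf fK; have [M M0 fM] := compact_continuous_bounded cK cf.
exists M => // x; have [/fM//|/fK->] := pselect (K x).
by rewrite normr0.
Qed.

(** Heine-Cantor theorem. Only [x] ranges over the compact set, so that [f] may
    be continuous merely on an open neighbourhood of it. *)
Lemma unif_continuous_compact (K : set rV) f (e : R) : compact K ->
  (forall x, K x -> {for x, continuous f}) -> 0 < e ->
  exists2 d : R, 0 < d & forall x y, K x -> `|x - y| < d -> `|f x - f y| <= e.
Proof.
move=> /compact_near_coveringP cK cf e0.
have := @cK R (0^'+) (fun d x => forall y, `|x - y| < d -> `|f x - f y| <= e) _.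
case.
  move=> x Kx.
  have /cvgrPdist_le/(_ _ (divr_gt0 e0 (ltr0n R 2)))/nbhs_ballP[d /= d0 de] := cf x Kx.
  exists (ball x (d / 2), [set r | r < d / 2]).
    split; first by apply: nbhsx_ballx; exact: divr_gt0.
    by apply: nbhs_right_lt; exact: divr_gt0.
  move=> [x' d'] /= [xx' d'd] y x'y.
  rewrite -ball_normE/= in xx'.
  have xd : ball x d x'.
    by rewrite -ball_normE/= (lt_le_trans xx')// ler_pdivrMr// ler_peMr// ?ler1n// ltW.
  have yd : ball x d y.
    rewrite -ball_normE/= (le_lt_trans (ler_distD x' _ _))// [ltRHS]splitr.
    by rewrite ltrD// (lt_trans x'y).
  rewrite (le_trans (ler_distD (f x) _ _))// [leRHS]splitr lerD//; last exact: de.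
  by rewrite distrC; exact: de.
move=> d /= d0 H; exists (d / 2); first exact: divr_gt0.
move=> x y Kx xy; apply: (H (d / 2)) => //=; last exact: divr_gt0.
rewrite sub0r normrN gtr0_norm ?divr_gt0//.
by rewrite ltr_pdivrMr// ltr_pMr// ltr1n.
Qed.

Lemma unif_continuous_Cc (K : set rV) f (e : R) : compact K -> continuous f ->
  vanishes_off K f -> 0 < e ->
  exists2 d : R, 0 < d & forall x y, `|x - y| < d -> `|f x - f y| <= e.
Proof.
move=> cK cf fK e0.
have [d d0 H] := unif_continuous_compact cK (fun x _ => cf x) e0.
exists d => // x y xy; have [Kx|/fK fx] := pselect (K x); first exact: H.
have [Ky|/fK fy] := pselect (K y); first by rewrite distrC H// distrC.
by rewrite fx fy subrr normr0 ltW.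
Qed.

Lemma vanishes_off_partial (K : set rV) f i : closed K -> vanishes_off K f ->
  vanishes_off K (partial i f).
Proof.
move=> cK fK x nKx.
have := near_eq_derive (delta_mx 0 i) (f := f) (g := cst 0) (a := x).
rewrite derive_cst; apply.
have : nbhs x (~` K) by apply: open_nbhs_nbhs; split => //; exact: closed_openC.
by apply: filterS => y /fK.
Qed.

End compact_rV.

(** * Cutoffs and mollifying kernels *)

Section cutoff.
Variable R : realType.
Implicit Types (t : R) (k : nat).

Lemma CkRW k (h : R -> R) : CkR k.+1 h -> CkR k h.
Proof.
elim: k h => [|k IH] h [ch [dh Ch]]; split => //.
by split => //; exact: IH.
Qed.

Lemma CkR_cst k (c : R) : CkR k (fun _ => c).
Proof.
elim: k c => [|k IH] c; split => //; try exact: cst_continuous.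
split; first by move=> t; exact: (derivable_cst (c : R) t (1 : R)).
rewrite (_ : derive1 _ = fun=> (0 : R))//.
by apply/funext => t; rewrite derive1_cst.
Qed.

Lemma CkR_id k : CkR k (fun t => t).
Proof.
case: k => [|k]; split => //; try by move=> t; exact: cvg_id.
split; first by move=> t; exact: (@derivable_id R R t 1).
rewrite (_ : derive1 _ = fun=> (1 : R)); first exact: CkR_cst.
by apply/funext => t; rewrite derive1_id.
Qed.

Lemma CkRM k (g h : R -> R) : CkR k g -> CkR k h -> CkR k (fun t => g t * h t).
Proof.
elim: k g h => [|k IH] g h Cg Ch; have [cg dg] := Cg; have [ch dh] := Ch;
  split => //; try by move=> t; exact: continuousM (cg t) (ch t).
have [dgt Cg'] := dg; have [dht Ch'] := dh; split.
  by move=> t; exact: (derivableM (dgt t) (dht t)).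
rewrite (_ : derive1 _ = fun t => g t * derive1 h t + h t * derive1 g t).
  by apply: CkRD; apply: IH => //; exact: CkRW.
apply/funext => t; rewrite !derive1E.
exact: (deriveM (dgt t) (dht t)).
Qed.

Lemma CkR_comp k (g h : R -> R) : CkR k g -> CkR k h -> CkR k (fun t => g (h t)).
Proof.
elim: k g h => [|k IH] g h Cg Ch; have [cg dg] := Cg; have [ch dh] := Ch;
  split => //; try by move=> t; apply: continuous_comp; [exact: ch|exact: cg].
have [dgt Cg'] := dg; have [dht Ch'] := dh; split.
  move=> t; apply/derivable1_diffP.
  by apply: (@differentiable_comp _ _ _ _ h g t); exact/derivable1_diffP.
rewrite (_ : derive1 _ = fun t => derive1 g (h t) * derive1 h t).
  by apply: CkRM => //; apply: IH => //; exact: CkRW.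
by apply/funext => t; exact: (derive1_comp (dht t) (dgt (h t))).
Qed.

(** With [e := flat_exp 0], the number [e (2 - t)] is zero for [2 <= t] and at
    least [e 1] for [t <= 1]. Hence [e (e 1 - e (2 - t))] is zero for [t <= 1]
    and constant for [2 <= t]. *)
Lemma smooth_step : exists s : R -> R, [/\ forall k, CkR k s,
  forall t, 0 <= s t <= 1, forall t, t <= 1 -> s t = 0 &
  forall t, 2 <= t -> s t = 1].
Proof.
pose e := @flat_exp R 0; have eE t : e t = if 0 < t then expR (- t^-1) else 0.
  by rewrite /e /flat_exp expr0 mul1r.
have e_ge0 t : 0 <= e t by exact: flat_exp_ge0.
have e_gt0 t : 0 < t -> 0 < e t by move=> t0; rewrite eE t0 expR_gt0.
have e_le0 t : t <= 0 -> e t = 0 by rewrite eE ltNge => ->.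
have e_mono : {homo e : x y / x <= y}.
  move=> x y xy; have [x0|x0] := leP x 0; first by rewrite (e_le0 x)//.
  rewrite !eE x0 (lt_le_trans x0 xy) ler_expR lerN2 lef_pV2 ?posrE//.
  exact: lt_le_trans xy.
pose a := e 1; have a0 : 0 < a by exact: e_gt0.
pose s t := (e a)^-1 * e (a + (-1) * e (2 + (-1) * t)).
exists s; split.
- move=> k; apply: CkRZ; apply: CkR_comp; first exact: CkR_flat_exp.
  apply: CkRD; first exact: CkR_cst.
  apply: CkRZ; apply: CkR_comp; first exact: CkR_flat_exp.
  by apply: CkRD; [exact: CkR_cst|apply: CkRZ; exact: CkR_id].
- move=> t; apply/andP; split; first by rewrite /s mulr_ge0// invr_ge0.
  rewrite /s mulrC ler_pdivrMr ?e_gt0// mul1r; apply: e_mono.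
  by rewrite mulN1r gerBl.
- move=> t t1; rewrite /s (e_le0 (a + _)) ?mulr0// mulN1r subr_le0 mulN1r.
  by apply: e_mono; lra.
- move=> t t2; rewrite /s (e_le0 (2 + _)) ?mulr0 ?addr0 ?mulVf//; last lra.
  by rewrite gt_eqF// e_gt0.
Qed.

(** [H] is [t * s t] for a smooth step [s], rescaled to [d * H (d^-1 * t)].
    The rescaling does not change the range of the derivative, which is why
    [M] does not depend on [d]. *)
Lemma smooth_truncation : exists2 M : R, 0 <= M & forall d : R, 0 < d ->
  exists H : R -> R, [/\ forall k, CkR k H, forall t, t <= d -> H t = 0,
    forall t, 0 <= t -> `|H t - t| <= 2 * d,
    forall t, `|derive1 H t| <= M & forall t, 2 * d < t -> derive1 H t = 1].
Proof.
have [s [Cs s01 s0 s1]] := smooth_step.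
pose H t := t * s t.
have CH k : CkR k H by apply: CkRM => //; exact: CkR_id.
have H0 t : t <= 1 -> H t = 0 by move=> t1; rewrite /H s0 ?mulr0.
have Hd t : 0 <= t -> `|H t - t| <= 2.
  move=> t0; have [t2|t2] := leP 2 t; first by rewrite /H s1// mulr1 subrr normr0.
  have /andP[st0 st1] := s01 t.
  rewrite (_ : H t - t = - (t * (1 - s t))); last by rewrite /H; ring.
  rewrite normrN ger0_norm; last by rewrite mulr_ge0// subr_ge0.
  by apply: le_trans (ltW t2); rewrite ler_piMr// gerBl.
have H'0 t : t < 1 -> derive1 H t = 0.
  move=> t1; rewrite derive1E (@near_eq_derive _ _ _ H (cst 0)) ?derive_cst//.
  near=> r; rewrite H0//; apply: ltW.
  by near: r; exact: lt_nbhsl.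
have H'1 t : 2 < t -> derive1 H t = 1.
  move=> t2; rewrite derive1E (@near_eq_derive _ _ _ H id) ?derive_id//.
  near=> r; rewrite /H s1 ?mulr1//; apply: ltW.
  by near: r; exact: lt_nbhsr.
have cH' : continuous (derive1 H) by have [_ [_ []]] := CH 1%N.
have [|c _ cM] := @EVT_max R (fun t => `|derive1 H t|) 1 2 (ler1n _ 2).
  by apply: continuous_subspaceT => t; apply: continuous_comp; [exact: cH'|exact: norm_continuous].
pose M := Num.max 1 `|derive1 H c|.
have H'M t : `|derive1 H t| <= M.
  have [t1|t1] := ltP t 1; first by rewrite H'0// normr0 le_max ler01.
  have [t2|t2] := ltP 2 t; first by rewrite H'1// normr1 le_max lexx.
  by rewrite le_max cM ?orbT// in_itv/= t1.
exists M; first by rewrite le_max ler01.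
move=> d d0; pose G t := d * H (d^-1 * t).
have G' t : derive1 G t = derive1 H (d^-1 * t).
  have dl : is_derive t (1 : R) (fun r : R => d^-1 * r) (d^-1 * 1).
    exact: is_deriveZ.
  have dH : is_derive (d^-1 * t) (1 : R) H (derive1 H (d^-1 * t)).
    by rewrite derive1E; apply: derivableP; have [_ []] := CH 1%N.
  have [_ E] := is_deriveZ d (is_derive1_comp dH dl).
  rewrite derive1E; apply: (etrans E).
  by rewrite /GRing.scale/= mulr1 mulrCA divff ?mulr1// gt_eqF.
exists G; split.
- by move=> k; apply: CkRZ; apply: (@CkR_comp k H) => //; apply: CkRZ; exact: CkR_id.
- by move=> t td; rewrite /G H0 ?mulr0// mulrC ler_pdivrMr// mul1r.
- move=> t t0; rewrite (_ : G t - t = d * (H (d^-1 * t) - d^-1 * t)); last first.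
    by rewrite mulrBr mulVKf// gt_eqF.
  rewrite normrM gtr0_norm// mulrC ler_pM2r// Hd// mulr_ge0// invr_ge0 ltW//.
- by move=> t; rewrite G'.
- by move=> t td; rewrite G' H'1// mulrC ltr_pdivlMr.
Unshelve. all: by end_near. Qed.

End cutoff.

Section kernel.
Variables (R : realType) (n : nat).
Local Notation rV := 'rV[R]_n.
Local Notation mu := (lebesgue_rV R n).

Definition is_kernel (e : R) (K : rV -> R) :=
  [/\ smooth K, forall x, 0 <= K x, vanishes_off (cball 0 e) K &
    \int[mu]_x K x = 1].

(** The kernel is [flat_exp 0 (e ^+ 2 - |x|^2)] normalised, with the Euclidean
    norm: a single composition is smooth in every dimension. *)
Lemma is_kernel_exists (e : R) : 0 < e -> exists K, is_kernel e K.
Proof.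
move=> e0; pose q (x : rV) : R := e ^+ 2 + (-1) * \sum_i x 0 i * x 0 i.
pose b x := flat_exp 0 (q x).
have sq k : Ck k q.
  apply: CkD; first exact: Ck_cst.
  by apply: CkZ; apply: Ck_sum => i; apply: CkM; exact: Ck_coord.
have sb : smooth b by move=> k; apply: Ck_comp => //; exact: CkR_flat_exp.
have b0 x : 0 <= b x by exact: flat_exp_ge0.
have bv : vanishes_off (cball 0 e) b.
  move=> x xe; rewrite /b /flat_exp ifN// -leNgt /q mulN1r subr_le0.
  have [i xi] : exists i, e < `|x 0 i|.
    apply: contrapT => /forallNP h; apply: xe; rewrite /cball/= sub0r normrN.
    rewrite [leLHS]/Num.norm/= mx_normrE; apply: bigmax_le; first exact: ltW.
    by move=> [i j] _; rewrite (ord1 i) leNgt; apply/negP/h.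
  rewrite (bigD1 i)//= -[leLHS]addr0 lerD//.
    by rewrite -expr2 -[leRHS]real_normK ?num_real// ler_pXn2r ?nnegrE ?(ltW e0)// ltW.
  by apply: sumr_ge0 => j _; rewrite -expr2 sqr_ge0.
have cb := Ck_continuous (sb 0%N).
have Lb : L1 setT b by apply: (L1_Cc (@compact_cball _ _ 0 e)).
have bp : 0 < \int[mu]_x b x.
  pose c := b 0; have c0 : 0 < c.
    rewrite /c /b /flat_exp ifT ?mulr_gt0 ?expR_gt0// /q big1.
      by rewrite mulr0 addr0 exprn_gt0.
    by move=> i _; rewrite mxE mul0r.
  have /cvgrPdist_le/(_ _ (divr_gt0 c0 (ltr0n R 2)))/nbhs_ballP[d /= d0 de] := cb 0.
  have mB := measurable_ball_rV (0:rV) d.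
  apply: (@lt_le_trans _ _ (\int[mu]_(x in ball (0:rV) d) (c / 2))).
    rewrite Rintegral_cst// mulr_gt0//; first exact: divr_gt0.
    rewrite (_ : fine _ = (d *+ 2) ^+ n); first by rewrite exprn_gt0// mulrn_wgt0.
    by rewrite -[RHS]/(fine ((d *+ 2) ^+ n)%:E); congr fine; exact: lebesgue_cube.
  rewrite [leLHS]Rintegral_mkcond; apply: le_Rintegral => //.
    apply: (L1_restrict _ mB).1; apply: (@L1_bounded _ _ _ _ (c / 2)) => //.
      exact: lebesgue_ball_fin.
    by move=> x _; rewrite gtr0_norm// divr_gt0.
  move=> x _; rewrite patchE; case: ifPn => //; rewrite inE => /de.
  by rewrite ler_norml => /andP[_]; rewrite -/c; lra.
exists (fun x => (\int[mu]_x b x)^-1 * b x); split.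
- by move=> k; exact: CkZ.
- by move=> x; rewrite mulr_ge0// invr_ge0 ltW.
- by move=> x /bv ->; rewrite mulr0.
- by rewrite RintegralZl// mulVf// gt_eqF.
Qed.

End kernel.

(** * Density of compactly supported continuous functions in L^1 *)

Section continuity.
Variables (R : realType) (T : topologicalType).
Implicit Types f g : T -> R.

Lemma fun_continuousD f g : continuous f -> continuous g -> continuous (fun x => f x + g x).
Proof. by move=> cf cg x; exact: continuousD (cf x) (cg x). Qed.

Lemma fun_continuousM f g : continuous f -> continuous g -> continuous (fun x => f x * g x).
Proof. by move=> cf cg x; exact: continuousM (cf x) (cg x). Qed.

Lemma fun_continuousN f : continuous f -> continuous (fun x => - f x).
Proof. by move=> cf x; exact: continuousN (cf x). Qed.

Lemma fun_continuous_min f g : continuous f -> continuous g ->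
  continuous (fun x => Num.min (f x) (g x)).
Proof. by move=> cf cg x; apply: continuous_min; [exact: cf|exact: cg]. Qed.

Lemma fun_continuous_max f g : continuous f -> continuous g ->
  continuous (fun x => Num.max (f x) (g x)).
Proof. by move=> cf cg x; apply: continuous_max; [exact: cf|exact: cg]. Qed.

End continuity.

Section L1_density.
Variables (R : realType) (n : nat).
Local Notation rV := 'rV[R]_n.
Local Notation mu := (lebesgue_rV R n).
Implicit Types (f g h b : rV -> R) (A : set rV).

Lemma L1_dominated A (f_ : nat -> rV -> R) f g : measurable A ->
  (forall k, measurable_fun A (f_ k)) -> measurable_fun A f ->
  (forall x, A x -> f_ ^~ x @ \oo --> f x) -> L1 A g ->
  (forall k x, A x -> `|f_ k x| <= g x) ->
  L1 A f /\ (fun k => \int[mu]_(x in A) `|f_ k x - f x|) @ \oo --> (0 : R).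
Proof.
move=> mA mf_ mf cf Lg fg.
have [|||||h1 h2 _] := @dominated_convergence _ _ R mu A mA
  (fun k x => (f_ k x)%:E) (fun x => (f x)%:E) (fun x => (g x)%:E).
- by move=> k; exact/measurable_EFinP.
- exact/measurable_EFinP.
- apply: aeW => x Ax; apply/fine_cvgP; split; first exact: nearW.
  exact: cf.
- exact: Lg.
- by apply: aeW => x k Ax; rewrite lee_fin; exact: fg.
split => //.
exact: (fine_cvg h2).
Qed.

Definition L1dist f g : R := \int[mu]_x `|f x - g x|.

Lemma L1_absB f g : L1 setT f -> L1 setT g -> L1 setT (fun x => `|f x - g x|).
Proof. by move=> Lf Lg; apply: L1_norm; exact: L1B. Qed.

Lemma L1dist_triangle h f g : L1 setT f -> L1 setT g -> L1 setT h ->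
  L1dist f g <= L1dist f h + L1dist h g.
Proof.
move=> Lf Lg Lh; rewrite -RintegralD//; try exact: L1_absB.
apply: le_Rintegral => //; try exact: L1_absB.
  by apply: L1D => //; exact: L1_absB.
by move=> x _; exact: ler_distD.
Qed.

Lemma L1dist_sym f g : L1dist f g = L1dist g f.
Proof. by apply: eq_Rintegral => x _; rewrite distrC. Qed.

Definition Cc f := continuous f /\ exists2 K, compact K & vanishes_off K f.

Lemma Cc_L1 f : Cc f -> L1 setT f.
Proof. by move=> [cf [K cK fK]]; exact: (L1_Cc cK). Qed.

Lemma CcM b f : Cc b -> continuous f -> Cc (fun x => f x * b x).
Proof.
move=> [cb [K cK bK]] cf; split; last first.
  by exists K => // x /bK ->; rewrite mulr0.
by move=> x; exact: continuousM (cf x) (cb x).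
Qed.

Lemma Cc_lin (c : R) f g : Cc f -> Cc g -> Cc (fun x => f x + c * g x).
Proof.
move=> [cf [K cK fK]] [cg [K' cK' gK]]; split.
  by apply: fun_continuousD => //; apply: fun_continuousM => //; exact: cst_continuous.
exists (K `|` K'); first exact: compactU.
move=> x /not_orP[/fK -> /gK ->]; by rewrite mulr0 addr0.
Qed.

Definition Cc_approx f := L1 setT f /\
  forall e : R, 0 < e -> exists2 g, Cc g & L1dist f g <= e.

Lemma Cc_approx_Cc f : Cc f -> Cc_approx f.
Proof.
move=> cf; split; first exact: Cc_L1.
move=> e e0; exists f => //; rewrite /L1dist.
under eq_Rintegral do rewrite subrr normr0.
by rewrite Rintegral_cst// mul0r ltW.
Qed.

Lemma Cc_approx_lin (c : R) f g : Cc_approx f -> Cc_approx g ->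
  Cc_approx (fun x => f x + c * g x).
Proof.
move=> [Lf af] [Lg ag]; have Lcg := L1Z c measurableT Lg.
split; first exact: L1D.
move=> e e0; have e20 : 0 < e / 2 by exact: divr_gt0.
have c0 : 0 < `|c| + 1 by rewrite ltr_wpDl.
have [f' cf' ff'] := af _ e20.
have [g' cg' gg'] := ag _ (divr_gt0 e20 c0).
exists (fun x => f' x + c * g' x); first exact: Cc_lin.
have Lf' := Cc_L1 cf'; have Lg' := Cc_L1 cg'.
have Lff := L1_absB Lf Lf'; have Lgg := L1_absB Lg Lg'.
apply: (@le_trans _ _ (\int[mu]_x (`|f x - f' x| + (`|c| + 1) * `|g x - g' x|))).
  apply: le_Rintegral => //.
  - by apply: L1_absB; apply: L1D => //; exact: L1Z.
  - by apply: L1D => //; exact: L1Z.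
  move=> x _; rewrite opprD addrACA -mulrBr (le_trans (ler_normD _ _))// lerD2l.
  by rewrite normrM ler_wpM2r// lerDl.
rewrite RintegralD//; last exact: L1Z.
rewrite RintegralZl// [leRHS]splitr lerD//.
by rewrite mulrC -ler_pdivlMr.
Qed.

Lemma Cc_approx_lim f : L1 setT f ->
  (forall e : R, 0 < e -> exists2 g, Cc_approx g & L1dist f g <= e) -> Cc_approx f.
Proof.
move=> Lf H; split => // e e0; have e20 : 0 < e / 2 by exact: divr_gt0.
have [g [Lg ag] fg] := H _ e20; have [h ch gh] := ag _ e20.
exists h => //; rewrite (le_trans (L1dist_triangle Lf (Cc_L1 ch) Lg))//.
by rewrite [leRHS]splitr lerD.
Qed.

Lemma Cc_approx_dominated (f_ : nat -> rV -> R) f g :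
  (forall k, Cc_approx (f_ k)) -> measurable_fun setT f ->
  (forall x, f_ ^~ x @ \oo --> f x) -> L1 setT g ->
  (forall k x, `|f_ k x| <= g x) -> Cc_approx f.
Proof.
move=> af mf cf Lg fg.
have mf_ k : measurable_fun setT (f_ k).
  by apply: L1_measurable; have [] := af k.
have [Lf cd] := L1_dominated measurableT mf_ mf (fun x _ => cf x) Lg
  (fun k x _ => fg k x).
apply: Cc_approx_lim => // e e0.
have /cvgrPdist_le/(_ _ e0)[N _ /(_ N (leqnn N))] := cd.
rewrite sub0r normrN => H; exists (f_ N) => //.
by rewrite L1dist_sym; exact: le_trans (ler_norm _) H.
Qed.

(** These sets generate because coordinates are continuous. As a pi-system
    they suit [Cc_approx_indic]: the indicator of [0 < f] is a limit of
    continuous functions. *)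
Lemma sigma_positivity : @measurable _ rV =
  <<s [set A | exists2 f : rV -> R, continuous f & A = [set x | 0 < f x]] >>.
Proof.
set G := [set A | _].
apply/seteqP; split; last first.
  apply: smallest_sub; first exact: sigma_algebra_measurable.
  move=> _ [f cf ->]; apply: open_measurable_rV.
  rewrite (_ : [set x | _] = f @^-1` [set t | 0 < t]) //.
  by apply: open_comp; [move=> x _; exact: cf|exact: open_gt].
move=> B mB.
have mid : measurable_fun [set: g_sigma_algebraType G]
    (id : g_sigma_algebraType G -> rV).
  apply: measurable_fun_rV => i.
  have cE := @measurability _ _ (g_sigma_algebraType G) _ setT
    (fun v : g_sigma_algebraType G => (v : rV) 0 i) (@RGenOInfty.G R).
  apply: cE.
    exact: RGenOInfty.measurableE.
  move=> _ [_ [a ->] <-]; rewrite setTI; apply: sub_sigma_algebra.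
  exists (fun v : rV => v 0 i - a).
    by apply: fun_continuousD; [exact: coord_continuous|exact: cst_continuous].
  by apply/seteqP; split => v /=; rewrite in_itv/= andbT subr_gt0.
by have := mid measurableT B mB; rewrite setTI.
Qed.

(** Dynkin induction on [A]. The weight [b] keeps everything integrable, even
    for complements and for the whole space. *)
Lemma Cc_approx_indic b A : Cc b -> measurable A ->
  Cc_approx (fun x => \1_A x * b x).
Proof.
move=> cb; rewrite [measurable]sigma_positivity; move: A.
have Lb := Cc_L1 cb; have mb := L1_measurable Lb.
have ind_le1 A x : `|\1_A x * b x| <= `|b x|.
  rewrite normrM ler_piMl// indicE; case: (_ \in _); by rewrite ?normr1 ?normr0.
apply: (dynkin_induction sigma_positivity).
- move=> _ _ [f cf ->] [g cg ->]; exists (fun x => Num.min (f x) (g x)).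
    exact: fun_continuous_min.
  by apply/seteqP; split => x /=; rewrite lt_min => /andP.
- rewrite (_ : (fun _ => _) = b); first exact: Cc_approx_Cc.
  by apply/funext => x; rewrite indicT mul1r.
- move=> _ [f cf ->].
  (* increases to the indicator of [0 < f] *)
  pose f_ k x := Num.min 1 (k%:R * Num.max 0 (f x)).
  have cf_ k : continuous (f_ k).
    apply: fun_continuous_min; first exact: cst_continuous.
    by apply: fun_continuousM; [exact: cst_continuous|apply: fun_continuous_max => //; exact: cst_continuous].
  apply: (@Cc_approx_dominated (fun k x => f_ k x * b x) _ (fun x => `|b x|)).
  + by move=> k; apply: Cc_approx_Cc; exact: CcM.
  + apply: measurable_funM => //; apply: measurable_indic.
    by rewrite sigma_positivity; apply: sub_sigma_algebra; exists f.
  + move=> x; apply: cvgMl; rewrite indicE.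
    have [fx|fx] := ltP 0 (f x).
      rewrite mem_set//; apply: cvg_near_cst.
      near=> k; rewrite /f_ max_r ?ltW//; apply/min_idPl.
      rewrite -ler_pdivrMr// mul1r.
      by near: k; exact: nbhs_infty_ger.
    rewrite memNset//=; last by apply/negP; rewrite -leNgt.
    apply: cvg_near_cst; apply: nearW => k.
    by rewrite /f_ max_l// mulr0; apply/min_idPr.
  + exact: L1_norm.
  + move=> k x; rewrite normrM ler_piMl// ger0_norm.
      by rewrite /f_ ge_min lexx.
    by rewrite /f_ le_min ler01 mulr_ge0// le_max lexx.
- move=> A mA aA; rewrite (_ : (fun _ => _) = (fun x => b x + (-1) * (\1_A x * b x))).
    by apply: Cc_approx_lin => //; exact: Cc_approx_Cc.
  by apply/funext => x; rewrite !indicE in_setC; case: (_ \in _);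
    rewrite /= ?mulr1n ?mulr0n; ring.
- move=> F mF tF aF.
  apply: (@Cc_approx_dominated (fun k x => \1_(\bigcup_(i in `I_k) F i) x * b x) _
    (fun x => `|b x|)).
  + elim=> [|k IH].
      rewrite II0 bigcup_set0 (_ : (fun _ => _) = (fun x => b x + (-1) * b x)).
        by apply: Cc_approx_lin; exact: Cc_approx_Cc.
      by apply/funext => x; rewrite indic0 mul0r mulN1r subrr.
    rewrite (_ : (fun _ => _) = (fun x => \1_(\bigcup_(i in `I_k) F i) x * b x
        + 1 * (\1_(F k) x * b x))); first exact: Cc_approx_lin.
    apply/funext => x; rewrite mul1r -mulrDl; congr (_ * _).
    rewrite IIS bigcup_setU bigcup_set1 !indicE in_setU.
    case: (boolP (x \in F k)) => [xk|]; last by rewrite orbF addr0.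
    rewrite orbT memNset ?add0r// => -[i /= ik Fix].
    have := tF i k Logic.I Logic.I; rewrite inE in xk.
    by case/(_ (ex_intro _ x (conj Fix xk))) => iE; rewrite iE ltnn in ik.
  + apply: measurable_funM => //; apply: measurable_indic.
    exact: bigcup_measurable.
  + move=> x; apply: cvgMl; apply: cvg_near_cst; rewrite !indicE.
    have [[N _ FNx]|nF] := pselect ((\bigcup_k F k) x).
      have xU : x \in \bigcup_k F k by rewrite inE; exists N.
      exists N.+1 => // k /= Nk.
      have xk : x \in \bigcup_(i in `I_k) F i by rewrite inE; exists N.
      by congr (_%:R); congr nat_of_bool; transitivity true; [exact: xk|exact/esym/xU].
    apply: nearW => k; congr (_%:R); congr nat_of_bool.
    apply/idP/idP => /set_mem; last by move/nF.
    by move=> [i _ Fix]; exfalso; apply: nF; exists i.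
  + exact: L1_norm.
  + by move=> k x; exact: ind_le1.
Unshelve. all: by end_near. Qed.

End L1_density.

(** * Continuity of translations in L^1 *)

Section translation_continuity.
Variables (R : realType) (n : nat).
Local Notation rV := 'rV[R]_n.
Local Notation mu := (lebesgue_rV R n).
Implicit Types (f g h b : rV -> R) (A : set rV).
Import HBSimple.

Definition plateau (m : nat) (x : rV) : R := Num.max 0 (Num.min 1 (m%:R - `|x|)).

Lemma Cc_plateau m : Cc (plateau m).
Proof.
split.
  apply: fun_continuous_max; first exact: cst_continuous.
  apply: fun_continuous_min; first exact: cst_continuous.
  apply: fun_continuousD; first exact: cst_continuous.
  by apply: fun_continuousN; exact: norm_continuous.
exists (cball 0 m%:R); first exact: compact_cball.
move=> x; rewrite /cball/= sub0r normrN => /negP; rewrite -ltNge => mx.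
by apply/max_idPl; rewrite ge_min subr_le0 (ltW mx) orbT.
Qed.

Lemma plateau_ge0 m x : 0 <= plateau m x.
Proof. by rewrite le_max lexx. Qed.

Lemma plateau_le1 m x : plateau m x <= 1.
Proof. by rewrite ge_max ler01 ge_min lexx. Qed.

Lemma plateau_cvg (x : rV) : plateau^~ x @ \oo --> (1 : R).
Proof.
apply: cvg_near_cst; near=> m.
rewrite /plateau; have -> : Num.min 1 (m%:R - `|x|) = 1 :> R.
  apply/min_idPl; rewrite lerBrDr.
  by near: m; exact: nbhs_infty_ger.
by apply/max_idPr; exact: ler01.
Unshelve. all: by end_near. Qed.

Lemma Cc_approx_sfun (s : {sfun rV >-> R}) b : Cc b ->
  Cc_approx (fun x => s x * b x).
Proof.
move=> cb.
have H (r : seq R) : Cc_approx (fun x => (\sum_(c <- r) c * \1_(s @^-1` [set c]) x) * b x).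
  elim: r => [|c r IH].
    rewrite (_ : (fun _ => _) = (fun x => b x + (-1) * b x)).
      by apply: Cc_approx_lin; exact: Cc_approx_Cc.
    by apply/funext => x; rewrite big_nil mul0r mulN1r subrr.
  rewrite (_ : (fun _ => _) = (fun x => (\sum_(c <- r) c * \1_(s @^-1` [set c]) x) * b x
     + c * (\1_(s @^-1` [set c]) x * b x))).
    apply: Cc_approx_lin => //; apply: Cc_approx_indic => //.
  by apply/funext => x; rewrite big_cons mulrDl addrC mulrA.
rewrite (_ : (fun _ => _) = (fun x =>
    (\sum_(c <- finmap.enum_fset (fset_set (range s))) c * \1_(s @^-1` [set c]) x) * b x)) //.
apply/funext => x; congr (_ * _).
by rewrite [in LHS](fimfunE s x) fsbig_finite.
Qed.

(** [f] is the limit of [f * plateau m], and in the latter [f] can be replaced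
    by a simple function. *)
Theorem Cc_dense f : L1 setT f -> Cc_approx f.
Proof.
move=> Lf; have mf := L1_measurable Lf.
apply: (@Cc_approx_dominated _ _ (fun m x => f x * plateau m x) f (fun x => `|f x|)) => //.
- move=> m; have cp := Cc_plateau m; have mp := continuous_measurable_rV cp.1.
  have Lp : L1 setT (fun x => plateau m x * f x).
    apply: (@L1M _ _ _ _ _ 1) => // x _.
    by rewrite ger0_norm ?plateau_ge0// plateau_le1.
  have Lfp : L1 setT (fun x => f x * plateau m x).
    by apply: L1_eq Lp => // x _; rewrite mulrC.
  apply: Cc_approx_lim => // e e0.
  have [s [Ls _ sf]] := approximation_sfun_integrable measurableT Lf.
  have {}sf : (fun k => \int[mu]_x `|f x - s k x|) @ \oo --> (0 : R).
    exact: (fine_cvg sf).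
  have /cvgrPdist_le/(_ _ e0)[N _ /(_ N (leqnn N))] := sf.
  rewrite sub0r normrN /= => H.
  exists (fun x => s N x * plateau m x); first exact: Cc_approx_sfun.
  apply: le_trans (le_trans (ler_norm _) H).
  have [Lsp _] := Cc_approx_sfun (s N) cp.
  apply: le_Rintegral => //; first exact: L1_absB.
    by apply: L1_absB => //; exact: Ls.
  move=> x _; rewrite -mulrBl normrM ler_piMr// ger0_norm ?plateau_ge0//.
  exact: plateau_le1.
- move=> x; rewrite -[X in _ --> X]mulr1.
  by apply: cvgMr; exact: plateau_cvg.
- exact: L1_norm.
- move=> m x; rewrite normrM ler_piMr// ger0_norm ?plateau_ge0//.
  exact: plateau_le1.
Qed.

(** For a compactly supported continuous function this is uniform continuity
    on a fixed bounded set; density concludes, since translations are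
    isometries. *)
Theorem translation_continuous f (e : R) : L1 setT f -> 0 < e ->
  exists2 d : R, 0 < d & forall z, `|z| < d -> L1dist (fun x => f (x + z)) f <= e.
Proof.
move=> Lf e0; have e30 : 0 < e / 3 by exact: divr_gt0.
have [_ /(_ _ e30)[g cg fg]] := Cc_dense Lf.
have Lg := Cc_L1 cg; have [ctg [K cK gK]] := cg.
have [M M0 KM] := compact_sub_ball cK.
pose C := cball (0:rV) (M + 1); have cC : compact C by exact: compact_cball.
have mC := measurable_compact_rV cC.
pose V := fine (mu C); have V0 : 0 <= V by rewrite fine_ge0.
have V10 : 0 < V + 1 by rewrite ltr_wpDl.
have [d d0 dg] := unif_continuous_Cc cK ctg gK (divr_gt0 e30 V10).
(* for [z] of norm less than 1 the difference vanishes off [C] *)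
exists (Num.min d 1); first by rewrite lt_min d0 ltr01.
move=> z; rewrite lt_min => /andP[zd z1].
have Lfz := L1_shift z Lf; have Lgz := L1_shift z Lg.
have fgz : L1dist (fun x => f (x + z)) (fun x => g (x + z)) <= e / 3.
  by rewrite /L1dist (Rintegral_shift z (f := fun x => `|f x - g x|))//; exact: L1_absB.
have gz : L1dist (fun x => g (x + z)) g <= e / 3.
  apply: (@le_trans _ _ (\int[mu]_(x in C) (e / 3 / (V + 1)))).
    rewrite [leRHS]Rintegral_mkcond; apply: le_Rintegral => //.
    + exact: L1_absB.
    + apply: (L1_restrict _ mC).1; apply: L1_compact => //; exact: cst_continuous.
    move=> x _; rewrite patchE; case: ifPn => [_|].
      by apply: dg; rewrite addrAC subrr add0r.
    rewrite notin_setE /C /cball/= sub0r normrN => /negP; rewrite -ltNge => xM.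
    rewrite gK ?gK ?subrr ?normr0// => /KM; rewrite -ball_normE/= sub0r normrN => H.
      by have := lt_trans xM H; rewrite ltNge lerDl ler01.
    have := le_lt_trans (ler_normB (x + z) z) (ltrD H z1).
    by rewrite addrK ltNge (ltW xM).
  rewrite Rintegral_cst// -/V mulrAC ler_pdivrMr// ler_pM2l//.
  by rewrite lerDl ler01.
rewrite (le_trans (L1dist_triangle Lfz Lf Lgz))//.
rewrite (_ : e = e / 3 + (e / 3 + e / 3)); last by field.
rewrite lerD// (le_trans (L1dist_triangle Lgz Lf Lg))// lerD//.
by rewrite L1dist_sym.
Qed.

End translation_continuity.

(** * Mollification *)

Section mollification.
Variables (R : realType) (n : nat).
Local Notation rV := 'rV[R]_n.
Local Notation mu := (lebesgue_rV R n).
Implicit Types (f g h : rV -> R) (K : rV -> R).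

(** The convolution of [f] with the reflection of [K]. In this form the weight
    [fun y => K (y - x)] is a translate of [K], hence a test function that can
    be inserted as it is in the definition of a weak gradient. *)
Definition conv K f (x : rV) : R := \int[mu]_y (K (y - x) * f y).

Lemma L1_conv K f x : Cc K -> L1 setT f -> L1 setT (fun y => K (y - x) * f y).
Proof.
move=> [cK [C cC KC]] Lf; have [M M0 KM] := Cc_bounded cC cK KC.
apply: (@L1M _ _ _ _ _ M) => //.
apply: (@measurable_comp _ _ _ _ _ _ setT K _ (fun y : rV => y - x)) => //.
  exact: continuous_measurable_rV.
exact: measurable_shift_rV.
Qed.

Lemma conv_dist K K' f x x' (e : R) : Cc K -> Cc K' -> L1 setT f ->
  (forall y, `|K (y - x) - K' (y - x')| <= e) ->
  `|conv K f x - conv K' f x'| <= e * \int[mu]_y `|f y|.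
Proof.
move=> cK cK' Lf KK.
have L := L1_conv x cK Lf; have L' := L1_conv x' cK' Lf.
rewrite /conv -RintegralB//.
apply: le_trans (le_normr_Rintegral _ _) _ => //; first exact: L1B.
rewrite -RintegralZl//; last exact: L1_norm.
apply: le_Rintegral => //.
- by apply: L1_norm; exact: L1B.
- by apply: L1Z => //; exact: L1_norm.
move=> y _; rewrite -mulrBl normrM ler_wpM2r//.
Qed.

Lemma continuous_conv K f : Cc K -> L1 setT f -> continuous (conv K f).
Proof.
move=> cK Lf; suff H : forall x : rV, {for x, continuous (conv K f)} by move=> x; exact: H.
move=> x; have [ctK [C cC KC]] := cK.
apply: (iffRL (@cvgrPdist_le _ _ _ (nbhs x) (nbhs_filter x) (conv K f) (conv K f x))) => e e0.
pose I := \int[mu]_y `|f y|; have I0 : 0 <= I by exact: Rintegral_ge0.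
have I10 : 0 < I + 1 by rewrite ltr_wpDl.
have [d d0 dK] := unif_continuous_Cc cC ctK KC (divr_gt0 e0 I10).
apply/nbhs_ballP; exists d => // x'; rewrite -ball_normE/= => xx'.
have : `|conv K f x - conv K f x'| <= e / (I + 1) * I.
  apply: conv_dist => // y; apply: dK.
  by rewrite opprD opprK addrACA subrr add0r addrC distrC.
move=> /le_trans; apply; rewrite mulrAC ler_pdivrMr// ler_pM2l// lerDl.
exact: ler01.
Qed.

Lemma Cc_partial K i : Ck 1 K -> Cc K -> Cc (partial i K).
Proof.
move=> sK [_ [C cC KC]]; split; first exact: Ck_continuous (Ck_partial i sK).
exists C => //; apply: vanishes_off_partial => //.
by apply: compact_closed => //; exact: norm_hausdorff.
Qed.

Lemma CcN K : Cc K -> Cc (fun x => - K x).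
Proof.
move=> [cK [C cC KC]]; split; first exact: fun_continuousN.
by exists C => // x /KC ->; rewrite oppr0.
Qed.

(** By the mean value theorem, the difference quotients of [K] converge to its
    derivative uniformly, because the latter is uniformly continuous. *)
Lemma is_derive_conv K f x i : Ck 1 K -> Cc K -> L1 setT f ->
  is_derive x (delta_mx 0 i) (conv K f) (conv (fun z => - partial i K z) f x).
Proof.
move=> sK ccK Lf; set v := delta_mx 0 i : rV.
have cpK := Cc_partial i sK ccK; have [cp [C cC pC]] := cpK.
have dK y : derivable K y v by exact: Ck_derivable sK.
have H : h^-1 *: (conv K f (h *: v + x) - conv K f x) @[h --> 0^'] -->
    conv (fun z => - partial i K z) f x.
  apply/cvgrPdist_le => /= e e0.
  pose I := \int[mu]_y `|f y|; have I0 : 0 <= I by exact: Rintegral_ge0.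
  have I10 : 0 < I + 1 by rewrite ltr_wpDl.
  have [d d0 dp] := unif_continuous_Cc cC cp pC (divr_gt0 e0 I10).
  near=> h.
  have h0 : h != 0 by near: h; exact: nbhs_dnbhs_neq.
  have L1c := L1_conv (h *: v + x) ccK Lf; have L2c := L1_conv x ccK Lf.
  have L3c := L1_conv x (CcN cpK) Lf.
  have L4c := L1B measurableT L1c L2c.
  have L5c := L1Z h^-1 measurableT L4c.
  rewrite /conv -RintegralB// -[h^-1 *: _]/(h^-1 * _) -RintegralZl// -RintegralB//.
  apply: le_trans (le_normr_Rintegral _ _) _ => //; first exact: L1B.
  apply: (@le_trans _ _ (\int[mu]_y (e / (I + 1) * `|f y|))); last first.
    rewrite RintegralZl//; last exact: L1_norm.
    rewrite mulrAC ler_pdivrMr// ler_pM2l// lerDl; exact: ler01.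
  apply: le_Rintegral => //.
  - by apply: L1_norm; exact: L1B.
  - by apply: L1Z => //; exact: L1_norm.
  move=> y _.
  have [c ch] := line_MVT (y - x) (- h) dK.
  rewrite scaleNr [_ + (y - x)]addrC -addrA -opprD [x + _]addrC => E.
  rewrite [X in `|X|](_ : _ =
      (partial i K (c *: v + (y - x)) - partial i K (y - x)) * f y); last first.
    by rewrite -[_ - K (y - x) * f y]mulrBl E -/(partial i K _); field.
  rewrite normrM ler_wpM2r//; apply: dp.
  rewrite addrK normrZ.
  apply: (@le_lt_trans _ _ (`|h| * (`|v| + 1))).
    by rewrite normrN in ch; rewrite ler_pM// lerDl.
  rewrite -ltr_pdivlMr; last by rewrite ltr_wpDl.
  by near: h; apply: dnbhs0_lt; apply: divr_gt0.
apply: DeriveDef; first by apply/cvg_ex; eexists; exact: H.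
exact/cvg_lim.
Unshelve. all: by end_near. Qed.

Lemma partial_conv K f i : Ck 1 K -> Cc K -> L1 setT f ->
  partial i (conv K f) = conv (fun z => - partial i K z) f.
Proof.
by move=> sK cK Lf; apply/funext => x; have [] := is_derive_conv x i sK cK Lf.
Qed.

(** The convolutions with smooth compactly supported kernels are stable under
    partial derivatives. *)
Lemma smooth_conv K f : smooth K -> Cc K -> L1 setT f -> smooth (conv K f).
Proof.
move=> sK cK Lf.
apply: (@smooth_coind _ _ (fun g => exists2 K, smooth K /\ Cc K & g = conv K f)).
- by move=> _ [K' [_ cK'] ->]; exact: continuous_conv.
- move=> _ i [K' [sK' cK'] ->]; split.
    by move=> x; have [] := is_derive_conv x i (sK' 1%N) cK' Lf.
  rewrite partial_conv//; exists (fun z => - partial i K' z) => //.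
  split; last by apply: CcN; exact: Cc_partial.
  by move=> k; apply: CkN; exact: smooth_partial.
- by exists K.
Qed.

Lemma conv_shift K f x : Cc K -> L1 setT f ->
  conv K f x = \int[mu]_z (K z * f (z + x)).
Proof.
move=> cK Lf; rewrite /conv -(Rintegral_shift x); last exact: L1_conv.
by apply: eq_Rintegral => y _; rewrite addrK.
Qed.

Lemma measurable_add_rV :
  measurable_fun setT (fun p : rV * rV => p.1 + p.2).
Proof.
apply: measurable_fun_rV => i.
apply: (@eq_measurable_fun _ _ _ _ _ (fun p : rV * rV => p.1 0 i + p.2 0 i)).
  by move=> p _; rewrite mxE.
apply: measurable_funD.
  exact: measurableT_comp (@measurable_coord_rV R n i) measurable_fst.
exact: measurableT_comp (@measurable_coord_rV R n i) measurable_snd.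
Qed.

Lemma is_kernel_Cc (e : R) K : is_kernel e K -> Cc K.
Proof.
move=> [sK _ KC _]; split; first exact: Ck_continuous (sK 0%N).
by exists (cball 0 e) => //; exact: compact_cball.
Qed.

(** [conv K f - f] is the average of the differences [f (x + z) - f x] with
    weight [K z], and the order of integration can be exchanged by Tonelli's
    theorem. *)
Lemma L1dist_conv (e eta : R) K f : 0 <= eta -> is_kernel e K -> L1 setT f ->
  (forall z, `|z| <= e -> L1dist (fun x => f (x + z)) f <= eta) ->
  L1 setT (conv K f) /\ L1dist (conv K f) f <= eta.
Proof.
move=> eta0 kK Lf fe; have cK := is_kernel_Cc kK; have [sK K0 KC K1] := kK.
have LK := Cc_L1 cK; have mK := L1_measurable LK; have mf := L1_measurable Lf.
have mc := continuous_measurable_rV (continuous_conv cK Lf).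
have mcf : measurable_fun setT (fun x => conv K f x - f x).
  exact: measurable_funB.
pose F (p : rV * rV) := (K p.2 * `|f (p.2 + p.1) - f p.1|)%:E.
have mF : measurable_fun setT F.
  apply/measurable_EFinP; apply: measurable_funM.
    exact: measurableT_comp mK measurable_snd.
  apply: measurableT_comp => //; apply: measurable_funB.
    apply: measurableT_comp mf _.
    apply: (@eq_measurable_fun _ _ _ _ _ (fun p : rV * rV => p.1 + p.2)).
      by move=> p _; rewrite addrC.
    exact: measurable_add_rV.
  exact: measurableT_comp mf measurable_fst.
have F0 p : (0 <= F p)%E by rewrite lee_fin mulr_ge0.
have H : (\int[mu]_x `|(conv K f x - f x)%:E| <= eta%:E)%E.
  apply: (@le_trans _ _ (\int[mu]_x \int[mu]_z F (x, z)))%E.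
    apply: ge0_le_integral => //.
    - by apply: measurableT_comp => //; exact/measurable_EFinP.
    - exact: measurable_fun_fubini_tonelli_F.
    move=> x _ /=; rewrite conv_shift//.
    have LKf : L1 setT (fun z => K z * f (z + x)).
      have := L1_shift x (L1_conv x cK Lf).
      by apply: L1_eq => // z _; rewrite addrK.
    have -> : f x = \int[mu]_z (K z * f x).
      by rewrite RintegralZr// K1 mul1r.
    have LKx : L1 setT (fun z => K z * f x).
      by apply: (L1_eq _ (f := fun z => f x * K z)) => //;
        [move=> z _; rewrite mulrC|exact: L1Z].
    rewrite -RintegralB//.
    have LB := L1B measurableT LKf LKx.
    rewrite -[X in X%:E]/(`|_|)%R EFin_normr_Rintegral//.
    apply: le_trans (le_abse_integral _ _ _) _ => //.
      exact: (measurable_int mu LB).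
    rewrite le_eqVlt; apply/orP; left; apply/eqP; apply: eq_integral => z _.
    by rewrite /F/= -mulrBr normrM ger0_norm.
  rewrite (fubini_tonelli F)//.
  apply: (@le_trans _ _ (\int[mu]_z (K z * eta)%:E))%E.
    apply: ge0_le_integral => //.
    - by move=> z _; exact: integral_ge0.
    - exact: measurable_fun_fubini_tonelli_G.
    - by apply/measurable_EFinP; apply: measurable_funM => //; exact: measurable_cst.
    move=> z _; rewrite /F/=.
    have [ze|ze] := leP `|z| e; last first.
      have Kz : K z = 0 by apply: KC; rewrite /cball/= sub0r normrN leNgt ze.
      rewrite Kz mul0r; under eq_integral do rewrite mul0r.
      by rewrite integral0.
    under eq_integral do rewrite EFinM [z + _]addrC.
    have Lz := L1_absB (L1_shift z Lf) Lf.
    rewrite ge0_integralZl_EFin//; last exact: (measurable_int mu Lz).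
    rewrite EFinM lee_wpmul2l ?lee_fin//.
    rewrite -[leLHS]fineK; last exact: integrable_fin_num Lz.
    by rewrite lee_fin; exact: fe.
  have LKe : L1 setT (fun z => K z * eta).
    by apply: (L1_eq _ (f := fun z => eta * K z)) => //;
      [move=> z _; rewrite mulrC|exact: L1Z].
  rewrite -[leLHS]fineK; last exact: integrable_fin_num LKe.
  by rewrite lee_fin -[leLHS]/(\int[mu]_z (K z * eta)) RintegralZr// K1 mul1r.
have Lcf : L1 setT (fun x => conv K f x - f x).
  apply/integrableP; split; first exact/measurable_EFinP.
  exact: le_lt_trans H (ltry _).
split.
  have := L1D measurableT Lcf Lf.
  by apply: L1_eq => // x _; rewrite subrK.
by rewrite /L1dist /Rintegral -lee_fin fineK//; exact: integrable_fin_num (L1_norm Lcf).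
Qed.

End mollification.

(** * Integration by parts *)

Section by_parts.
Variables (R : realType) (n : nat).
Local Notation rV := 'rV[R]_n.
Local Notation mu := (lebesgue_rV R n).
Implicit Types (f g h phi : rV -> R) (Omega A C : set rV).

Lemma Rintegral_vanishing A f : vanishes_off A f ->
  \int[mu]_(x in A) f x = \int[mu]_x f x.
Proof. by move=> fA; rewrite Rintegral_mkcond restrict_vanishing. Qed.

Lemma vanishes_off_sub A C f : A `<=` C -> vanishes_off A f -> vanishes_off C f.
Proof. by move=> AC fA x nCx; apply: fA => /AC. Qed.

Lemma vanishes_offMr A f g : vanishes_off A g -> vanishes_off A (fun x => f x * g x).
Proof. by move=> fA x /fA ->; rewrite mulr0. Qed.

(** The integral of [fun y => f (y - x)] does not depend on [x]. For small [x]
    it is the convolution of [f] with the indicator of a large ball [B], whose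
    partial derivative at 0 is minus the integral of that of [f]. *)
Lemma Rintegral_partial f i : Ck 1 f -> Cc f -> \int[mu]_x partial i f x = 0.
Proof.
move=> C1f ccf; have [cf [C cC fC]] := ccf.
have [M M0 CM] := compact_sub_ball cC.
pose B := cball (0:rV) (M + 1); have mB : measurable B.
  by apply: measurable_compact_rV; exact: compact_cball.
have L1B1 : L1 setT (\1_B : rV -> R).
  rewrite (_ : (\1_B : rV -> R) = (cst 1 : rV -> R) \_ B).
    by apply: (L1_restrict _ mB).1; apply: L1_compact; [exact: compact_cball|exact: cst_continuous].
  by apply/funext => x; rewrite indicE patchE; case: ifPn.
have sh g (x : rV) : vanishes_off C g -> `|x| < 1 -> L1 setT g ->
    \int[mu]_y (g (y - x) * \1_B y) = \int[mu]_y g y.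
  move=> gC x1 Lg; rewrite -(Rintegral_shift (- x) Lg).
  apply: eq_Rintegral => y _; rewrite indicE; case: (boolP (y \in B)) => [|yB].
    by rewrite mulr1.
  rewrite mulr0 gC// => /CM; rewrite -ball_normE/= sub0r normrN => yx.
  move: yB; rewrite notin_setE; apply; rewrite /B/cball/= sub0r normrN.
  rewrite -[y](subrK x) (le_trans (ler_normD _ _))// lerD// ltW//.
have [ctp [C' cC' pC']] := Cc_partial i C1f ccf.
have [_ E] := is_derive_conv 0 i C1f ccf L1B1.
have pC : vanishes_off C (partial i f).
  apply: vanishes_off_partial => //.
  by apply: compact_closed => //; exact: norm_hausdorff.
have E0 : \forall x \near (0 : rV), conv f \1_B x = cst (\int[mu]_y f y) x.
  apply/nbhs_ballP; exists 1 => //= x; rewrite -ball_normE/= sub0r normrN => x1.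
  by rewrite /conv sh//; exact: Cc_L1.
have := E; rewrite (near_eq_derive _ E0) derive_cst /conv.
under eq_Rintegral do rewrite mulNr.
have -> : \int[mu]_y - (partial i f (y - 0) * \1_B y) =
    - \int[mu]_y (partial i f (y - 0) * \1_B y).
  rewrite -mulN1r -RintegralZl//; last exact: (L1_conv 0 (Cc_partial i C1f ccf) L1B1).
  by apply: eq_Rintegral => y _; rewrite mulN1r.
rewrite sh ?normr0//; last by apply: Cc_L1; exact: Cc_partial.
by move/esym/eqP; rewrite oppr_eq0 => /eqP.
Qed.

Lemma Rintegral_by_parts f phi i : Ck 1 f -> Ck 1 phi -> Cc phi ->
  \int[mu]_x (f x * partial i phi x) = - \int[mu]_x (partial i f x * phi x).
Proof.
move=> Cf Cp ccp.
have cpf := Ck_continuous Cf; have ctp := Ck_continuous (Ck_partial i Cf).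
have ccd := Cc_partial i Cp ccp.
have := @Rintegral_partial (fun x => f x * phi x) i (CkM Cf Cp) (CcM ccp cpf).
rewrite partialM; last 2 first.
- by move=> x; exact: Ck_derivable Cf.
- by move=> x; exact: Ck_derivable Cp.
rewrite RintegralD//; last 2 first.
- by apply: Cc_L1; exact: CcM.
- apply: (L1_eq _ (f := fun x => partial i f x * phi x)) => //.
    by move=> x _; rewrite mulrC.
  by apply: Cc_L1; exact: CcM.
move/eqP; rewrite addr_eq0 => /eqP ->; congr (- _).
by apply: eq_Rintegral => x _; rewrite mulrC.
Qed.

Lemma test_functionP Omega phi : test_function Omega phi <->
  smooth phi /\ exists C, [/\ compact C, C `<=` Omega & vanishes_off C phi].
Proof.
split=> [[sp cp pO]|[sp [C [cC CO pC]]]].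
  split => //; exists (closure [set x | phi x != 0]); split => // x nx.
  apply: contrapT => /eqP px; apply: nx; exact: subset_closure.
have sub : closure [set x | phi x != 0] `<=` C.
  have clC : closed C by apply: compact_closed => //; exact: norm_hausdorff.
  rewrite [X in _ `<=` X](closure_id C).1//; apply: closure_subset => x /= px.
  by apply: contrapT => /pC p0; rewrite p0 eqxx in px.
split => //; last exact: subset_trans CO.
by apply: subclosed_compact cC sub; exact: closed_closure.
Qed.

Lemma L1loc_mul Omega C u phi : L1loc Omega u -> compact C -> C `<=` Omega ->
  continuous phi -> vanishes_off C phi -> L1 setT (fun x => u x * phi x).
Proof.
move=> Lu cC CO cp pC; have mC := measurable_compact_rV cC.
have [M _ pM] := Cc_bounded cC cp pC.
rewrite -(restrict_vanishing (vanishes_offMr u pC)); apply: (L1_restrict _ mC).1.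
apply: (L1_eq _ (f := fun x => phi x * u x)) => //; first by move=> x _; rewrite mulrC.
apply: (@L1M _ _ _ _ _ M) => //; last exact: Lu.
by apply: measurable_funTS; exact: continuous_measurable_rV.
Qed.

Lemma test_partial Omega phi i : test_function Omega phi ->
  test_function Omega (partial i phi).
Proof.
move=> /test_functionP[sp [C [cC CO pC]]]; apply/test_functionP; split.
  exact: smooth_partial.
exists C; split => //; apply: vanishes_off_partial => //.
by apply: compact_closed => //; exact: norm_hausdorff.
Qed.

Lemma L1loc_test Omega u phi : L1loc Omega u -> test_function Omega phi ->
  L1 setT (fun x => u x * phi x) /\
  \int[mu]_(x in Omega) (u x * phi x) = \int[mu]_x (u x * phi x).
Proof.
move=> Lu /test_functionP[sp [C [cC CO pC]]]; split.
  exact: (L1loc_mul Lu cC CO (Ck_continuous (sp 0%N)) pC).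
by apply: Rintegral_vanishing; apply: vanishes_offMr; exact: vanishes_off_sub pC.
Qed.

End by_parts.

(** * Weak gradients *)

Section weak_gradients.
Variables (R : realType) (n : nat).
Local Notation rV := 'rV[R]_n.
Local Notation mu := (lebesgue_rV R n).
Implicit Types (f h phi u v : rV -> R) (g : rV -> rV) (Omega A C : set rV).

Lemma L1loc_lin (c : R) Omega u v : L1loc Omega u -> L1loc Omega v ->
  L1loc Omega (fun x => u x + c * v x).
Proof.
move=> Lu Lv K cK KO; have mK := measurable_compact_rV cK.
by apply: L1D => //; [exact: Lu|apply: L1Z => //; exact: Lv].
Qed.

Lemma is_weak_gradient_C1 Omega f : Ck 1 f ->
  is_weak_gradient Omega f (fun x => \row_i partial i f x).
Proof.
move=> Cf; have Lf : L1loc Omega f.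
  by move=> K cK _; apply: L1_compact => //; exact: Ck_continuous Cf.
have Lp i : L1loc Omega (fun x => (\row_i partial i f x) 0 i).
  move=> K cK _; under [X in L1 _ X]eq_fun do rewrite mxE.
  by apply: L1_compact => //; exact: Ck_continuous (Ck_partial i Cf).
split => // phi tp i.
rewrite (L1loc_test Lf (test_partial i tp)).2 (L1loc_test (Lp i) tp).2.
have /test_functionP[sp [C [cC _ pC]]] := tp.
rewrite Rintegral_by_parts//; last first.
  by split; [exact: Ck_continuous (sp 1%N)|exists C].
by congr (- _); apply: eq_Rintegral => x _; rewrite mxE.
Qed.

Lemma is_weak_gradient_lin (c : R) Omega u v g g' :
  is_weak_gradient Omega u g -> is_weak_gradient Omega v g' ->
  is_weak_gradient Omega (fun x => u x + c * v x) (fun x => g x + c *: g' x).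
Proof.
move=> [Lu Lg wg] [Lv Lg' wg']; have Luv := L1loc_lin c Lu Lv.
have Lgh i : L1loc Omega (fun x => (g x + c *: g' x) 0 i).
  by under [X in L1loc _ X]eq_fun do rewrite !mxE; exact: L1loc_lin.
split => // phi tp i; have tpi := test_partial i tp.
rewrite (L1loc_test Luv tpi).2 (L1loc_test (Lgh i) tp).2.
have := wg _ tp i; rewrite (L1loc_test Lu tpi).2 (L1loc_test (Lg i) tp).2 => Eg.
have := wg' _ tp i; rewrite (L1loc_test Lv tpi).2 (L1loc_test (Lg' i) tp).2 => Eg'.
have L1u := (L1loc_test Lu tpi).1; have L1v := (L1loc_test Lv tpi).1.
have L1g := (L1loc_test (Lg i) tp).1; have L1g' := (L1loc_test (Lg' i) tp).1.
transitivity (\int[mu]_x (u x * partial i phi x + c * (v x * partial i phi x))).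
  by apply: eq_Rintegral => x _; ring.
rewrite RintegralD//; last exact: L1Z.
rewrite RintegralZl// Eg Eg'.
transitivity (- \int[mu]_x (g x 0 i * phi x + c * (g' x 0 i * phi x))).
  rewrite RintegralD//; last exact: L1Z.
  by rewrite RintegralZl//; ring.
by congr (- _); apply: eq_Rintegral => x _; rewrite !mxE; ring.
Qed.

(** A compact exhaustion of the open set [Omega] as [r] tends to 0. *)
Definition inner Omega (r : R) : set rV :=
  cball 0 r^-1 `&` [set x | forall y, `|x - y| < r -> Omega y].

Lemma inner_sub Omega r : 0 < r -> inner Omega r `<=` Omega.
Proof. by move=> r0 x [_]; apply; rewrite subrr normr0. Qed.

Lemma inner_compact Omega r : compact (inner Omega r).
Proof.
apply: (@subclosed_compact _ _ (cball 0 r^-1)).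
- apply: closedI; first exact: closed_cball.
  rewrite -openC openE => x /= /existsNP[y /not_implyP[xy nOy]].
  apply/nbhs_ballP; exists (r - `|x - y|); first by rewrite /= subr_gt0.
  move=> z; rewrite -ball_normE/= => xz zO; apply: nOy; apply: zO.
  rewrite (le_lt_trans (ler_distD x _ _))//.
  by rewrite distrC -ltrBrDr.
- exact: compact_cball.
- by move=> x [].
Qed.

Lemma inner_near Omega r x y : 0 < r <= 1 -> inner Omega r x ->
  `|x - y| <= r / 2 -> inner Omega (r / 2) y.
Proof.
move=> /andP[r0 r1] [xr xO] xy; split.
  move: xr; rewrite /cball/= !sub0r !normrN => xr.
  rewrite -[y](subrK x) (le_trans (ler_normD _ _))// distrC.
  rewrite (@le_trans _ _ (r / 2 + r^-1)) ?lerD//.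
  rewrite invfM invrK [leRHS]mulrC mulr2n mulrDl mul1r lerD2r.
  rewrite (@le_trans _ _ 1) ?invf_ge1//; first by rewrite ler_pdivrMr; lra.
move=> z yz; apply: xO.
rewrite (le_lt_trans (ler_distD y _ _))// [ltRHS]splitr.
exact: ler_ltD.
Qed.

Lemma inner_cover Omega : open Omega ->
  Omega = \bigcup_k inner Omega (k.+1%:R^-1).
Proof.
move=> oO; apply/seteqP; split => x; last first.
  by move=> [k _]; apply: inner_sub; rewrite invr_gt0.
move=> Ox; have /nbhs_ballP[e /= e0 eO] : nbhs x Omega by exact: open_nbhs_nbhs.
pose m := maxn (Num.truncn `|x|) (Num.truncn e^-1).
exists m => //; split.
  rewrite /cball/= sub0r normrN invrK ltW// (lt_le_trans (truncnS_gt _))//.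
  by rewrite ler_nat ltnS leq_maxl.
move=> y xy; apply: eO; rewrite -ball_normE/=; apply: lt_le_trans xy _.
rewrite -[e]invrK lef_pV2 ?posrE ?invr_gt0// ltW// (lt_le_trans (truncnS_gt _))//.
by rewrite ler_nat ltnS leq_maxr.
Qed.

Lemma measurable_inner Omega r : measurable (inner Omega r).
Proof. by apply: measurable_compact_rV; exact: inner_compact. Qed.

Lemma L1loc_measurable Omega u : open Omega -> L1loc Omega u -> measurable_fun Omega u.
Proof.
move=> oO Lu; rewrite [X in measurable_fun X](inner_cover oO).
apply/measurable_fun_bigcup; first by move=> k; exact: measurable_inner.
move=> k; apply: L1_measurable; apply: Lu; first exact: inner_compact.
by apply: inner_sub; rewrite invr_gt0.
Qed.

Lemma conv_restrict C K f x (e : R) : is_kernel e K -> cball x e `<=` C ->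
  conv K (f \_ C) x = \int[mu]_y (f y * K (y - x)).
Proof.
move=> [_ _ K0 _] xC; apply: eq_Rintegral => y _; rewrite patchE.
case: ifPn => [_|]; first by rewrite mulrC.
rewrite notin_setE => nCy; rewrite K0 ?mul0r ?mulr0// /cball/= sub0r normrN => yx.
by apply/nCy/xC; rewrite /cball/= distrC.
Qed.

Lemma test_kernel Omega K x (e : R) : is_kernel e K -> cball x e `<=` Omega ->
  test_function Omega (fun y => K (y - x)).
Proof.
move=> [sK _ K0 _] xO; apply/test_functionP; split.
  by move=> k; exact: Ck_shift.
exists (cball x e); split => //; first exact: compact_cball.
move=> y nxy; apply: K0; rewrite /cball/= sub0r normrN => yx.
by apply: nxy; rewrite /cball/= distrC.
Qed.

Lemma L1_patch Omega C f : compact C -> C `<=` Omega -> L1loc Omega f ->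
  L1 setT (f \_ C).
Proof.
move=> cC CO Lf; apply: (L1_restrict _ (measurable_compact_rV cC)).1.
exact: Lf.
Qed.

Lemma conv_L1_cvg f (eta : R) : L1 setT f -> 0 < eta ->
  exists2 d : R, 0 < d & forall e K, e < d -> is_kernel e K ->
    L1 setT (conv K f) /\ L1dist (conv K f) f <= eta.
Proof.
move=> Lf eta0; have [d d0 fd] := translation_continuous Lf eta0.
exists d => // e K ed kK; apply: (L1dist_conv (ltW eta0) kK Lf) => z ze.
by apply: fd; exact: le_lt_trans ed.
Qed.

(** At a point of [inner Omega r], the convolution of [h] with a kernel of
    small radius is the integral of [h] against a test function on [Omega],
    hence zero, while these convolutions converge to [h] in [L^1]. *)
Lemma fundamental_lemma_inner Omega h (r : R) : 0 < r <= 1 -> L1loc Omega h ->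
  (forall phi, test_function Omega phi -> \int[mu]_(x in Omega) (h x * phi x) = 0) ->
  {ae mu, forall x, inner Omega r x -> h x = 0}.
Proof.
move=> /andP[r0 r1] Lh h0; have r20 : 0 < r / 2 by exact: divr_gt0.
pose C := inner Omega (r / 2); have cC : compact C by exact: inner_compact.
have CO : C `<=` Omega by exact: inner_sub.
have Lb := L1_patch cC CO Lh.
pose A := inner Omega r; have mA : measurable A by exact: measurable_inner.
have AC : A `<=` C.
  move=> x Ax; apply: (@inner_near _ _ x) => //; first by rewrite r0.
  by rewrite subrr normr0 ltW.
have LAh : L1 A h by apply: Lh; [exact: inner_compact|exact: inner_sub].
have I0 : \int[mu]_(x in A) `|h x| = 0.
  apply/eqP; rewrite eq_le Rintegral_ge0 ?andbT//; apply/ler_addgt0Pr => eta eta0.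
  rewrite add0r; have [d d0 dK] := conv_L1_cvg Lb eta0.
  pose e := Num.min (d / 2) (r / 2); have e0 : 0 < e by rewrite lt_min !divr_gt0.
  have [K kK] := is_kernel_exists n e0.
  have ed : e < d.
    by rewrite /e gt_min ltr_pdivrMr// ltr_pMr// ltr1n.
  have [Lc cK] := dK _ _ ed kK; apply: le_trans cK.
  rewrite Rintegral_mkcond; apply: le_Rintegral => //; last 2 first.
  - exact: L1_absB.
  - move=> x _; rewrite patchE; case: ifPn => [/set_mem Ax|_]; last exact: normr_ge0.
    have xe y : cball x e y -> C y.
      move=> xy; apply: (@inner_near _ _ x) => //; first by rewrite r0.
      by apply: le_trans xy _; rewrite ge_min lexx orbT.
    rewrite (conv_restrict _ kK xe).
    have tK := test_kernel kK (subset_trans xe CO).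
    have := h0 _ tK; rewrite (L1loc_test Lh tK).2 => ->.
    by rewrite sub0r normrN patchE mem_set//; exact: AC.
  - by apply: (L1_restrict _ mA).1; exact: L1_norm.
have /ae_eq_integral_abs : measurable_fun A (EFin \o h) by exact: (measurable_int mu LAh).
move=> /(_ mu mA)[+ _].
have -> : (\int[mu]_(x in A) `|(EFin \o h) x| = 0)%E.
  have Ln := L1_norm LAh.
  by rewrite -[LHS]fineK ?(integrable_fin_num mA Ln)//; congr EFin.
move=> /(_ erefl); apply: filterS => x hx Ax.
by have := hx Ax; case.
Qed.

Lemma fundamental_lemma Omega h : open Omega -> L1loc Omega h ->
  (forall phi, test_function Omega phi -> \int[mu]_(x in Omega) (h x * phi x) = 0) ->
  {ae mu, forall x, Omega x -> h x = 0}.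
Proof.
move=> oO Lh h0.
have : {ae mu, forall x k, inner Omega (k.+1%:R^-1) x -> h x = 0}.
  apply: ae_foralln => k; apply: fundamental_lemma_inner => //.
  by rewrite invr_gt0 ltr0n/= invf_le1// ler1n.
by apply: filterS => x hx; rewrite [X in X x -> _](inner_cover oO) => -[k _ /hx].
Qed.

(** The difference of two weak gradients of [u] is a weak gradient of
    [u - u]. *)
Lemma weak_gradient_unique Omega u g g' : open Omega ->
  is_weak_gradient Omega u g -> is_weak_gradient Omega u g' ->
  {ae mu, forall x, Omega x -> g x = g' x}.
Proof.
move=> oO wg wg'.
have [_ Lh wh] := is_weak_gradient_lin (-1) wg wg'.
have H i : {ae mu, forall x, Omega x -> (g x + (-1) *: g' x) 0 i = 0}.
  apply: fundamental_lemma => // phi tp.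
  have := wh _ tp i.
  under eq_Rintegral do rewrite mulN1r subrr mul0r.
  rewrite Rintegral_cst; last exact: open_measurable_rV.
  by rewrite mul0r => /esym/eqP; rewrite oppr_eq0 => /eqP.
have : {ae mu, forall x i, Omega x -> (g x + (-1) *: g' x) 0 i = 0}.
  by apply: filter_forall => i; exact: H.
apply: filterS => x hx Ox; apply/rowP => i.
by have := hx i Ox; rewrite !mxE mulN1r => /eqP; rewrite subr_eq0 => /eqP.
Qed.

Lemma weak_gradientP Omega u : W11loc Omega u ->
  is_weak_gradient Omega u (weak_gradient Omega u).
Proof. exact: xgetPex. Qed.

(** Differentiating the kernel and moving the derivative onto [u] with the test
    function [fun y => K (y - x)] cancels the two signs. *)
Lemma partial_conv_weak Omega u g C K (e : R) i x :
  is_weak_gradient Omega u g -> compact C -> C `<=` Omega -> is_kernel e K ->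
  cball x e `<=` C ->
  partial i (conv K (u \_ C)) x = conv K ((fun y => g y 0 i) \_ C) x.
Proof.
move=> [Lu Lg wg] cC CO kK xC; have [sK K0 KC K1] := kK.
have cK := is_kernel_Cc kK; have Lub := L1_patch cC CO Lu.
rewrite (partial_conv i (sK 1%N) cK Lub) (conv_restrict _ kK xC).
have tK := test_kernel kK (subset_trans xC CO).
have := wg _ tK i.
rewrite (L1loc_test Lu (test_partial i tK)).2 (L1loc_test (Lg i) tK).2.
rewrite partial_shift; last by move=> z; exact: Ck_derivable (sK 1%N).
move/eqP; rewrite -eqr_oppLR => /eqP <-.
have cpK := Cc_partial i (sK 1%N) cK.
have Lc := L1_conv x (CcN cpK) Lub.
rewrite -mulN1r -RintegralZl//; last first.
  have [+ _] := L1loc_test Lu (test_partial i tK).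
  rewrite partial_shift//; by move=> z; exact: Ck_derivable (sK 1%N).
apply: eq_Rintegral => y _; rewrite patchE; case: ifPn => [_|].
  by rewrite mulN1r mulNr mulrC.
rewrite notin_setE => nCy; rewrite mulr0.
rewrite (vanishes_off_partial i (@closed_cball _ _ 0 e) KC) ?mulr0//.
rewrite /cball/= sub0r normrN => yx.
by apply/nCy/xC; rewrite /cball/= distrC.
Qed.

End weak_gradients.

(** * Zero boundary values by approximation *)

Section zero_trace.
Variables (R : realType) (n : nat).
Local Notation rV := 'rV[R]_n.
Local Notation mu := (lebesgue_rV R n).
Implicit Types (f h phi u v b : rV -> R) (g G : rV -> rV) (Omega A C D : set rV).

(** Zero boundary values for [v], with its gradient [G] given explicitly and
    the approximations compared through classical derivatives: no choice of
    a representative is involved. *)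
Definition W11_approx D v G :=
  [/\ L1 D v, forall i, L1 D (fun x => G x 0 i) &
   exists phi : nat -> rV -> R, [/\ forall k, test_function D (phi k),
     (fun k => \int[mu]_(x in D) `|phi k x - v x|) @ \oo --> (0 : R) &
     forall i, (fun k => \int[mu]_(x in D) `|partial i (phi k) x - G x 0 i|)
       @ \oo --> (0 : R)]].

Lemma test_L1 D phi : measurable D -> test_function D phi -> L1 D phi.
Proof.
move=> mD /test_functionP[sp [C [cC CD pC]]].
apply: (@L1S _ _ setT) => //; apply: (L1_Cc cC) => //.
exact: Ck_continuous (sp 0%N).
Qed.

Lemma W11_approxZ (c : R) D v G : measurable D -> W11_approx D v G ->
  W11_approx D (fun x => c * v x) (fun x => c *: G x).
Proof.
move=> mD [Lv LG [phi [tp pv pG]]]; split.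
- exact: L1Z.
- by move=> i; under [X in L1 _ X]eq_fun do rewrite mxE; exact: L1Z.
exists (fun k x => c * phi k x); split.
- move=> k; have /test_functionP[sp [C [cC CD pC]]] := tp k.
  apply/test_functionP; split; first by move=> m; exact: CkZ.
  by exists C; split => //; exact: vanishes_offMr.
- have -> : (fun k => \int[mu]_(x in D) `|c * phi k x - c * v x|) =
      (fun k => `|c| * \int[mu]_(x in D) `|phi k x - v x|).
    apply/funext => k; rewrite -RintegralZl//; last first.
      by apply: L1_norm; apply: L1B => //; exact: test_L1.
    by apply: eq_Rintegral => x _; rewrite -mulrBr normrM.
  by rewrite -[X in _ --> X](mulr0 `|c|); apply: cvgMr.
- move=> i; have -> : (fun k => \int[mu]_(x in D)
        `|partial i (fun x => c * phi k x) x - (c *: G x) 0 i|) =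
      (fun k => `|c| * \int[mu]_(x in D) `|partial i (phi k) x - G x 0 i|).
    apply/funext => k; rewrite -RintegralZl//; last first.
      by apply: L1_norm; apply: L1B => //; apply: test_L1 => //; exact: test_partial.
    apply: eq_Rintegral => x _.
    have [sp _] := (test_functionP _ _).1 (tp k).
    rewrite partialM; last 2 first.
    + by move=> y; exact: (derivable_cst c y (delta_mx 0 i)).
    + by move=> y; exact: Ck_derivable (sp 1%N).
    have -> : partial i (fun _ : rV => c) x = 0 by exact: (derive_cst c x (delta_mx 0 i)).
    by rewrite mulr0 addr0 mxE -mulrBr normrM.
  by rewrite -[X in _ --> X](mulr0 `|c|); apply: cvgMr.
Qed.

Lemma cvg_Rintegral_bounded D (f_ : nat -> rV -> R) f b (M : R) : measurable D ->
  (forall k, L1 D (f_ k)) -> L1 D f -> measurable_fun D b ->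
  (forall x, D x -> `|b x| <= M) ->
  (fun k => \int[mu]_(x in D) `|f_ k x - f x|) @ \oo --> (0 : R) ->
  (fun k => \int[mu]_(x in D) (b x * f_ k x)) @ \oo -->
    \int[mu]_(x in D) (b x * f x).
Proof.
move=> mD Lf_ Lf mb bM cf.
apply/subr_cvg0.
have H k : `|\int[mu]_(x in D) (b x * f_ k x) - \int[mu]_(x in D) (b x * f x)| <=
    `|M| * \int[mu]_(x in D) `|f_ k x - f x|.
  have L1k := L1M mD mb bM (Lf_ k); have L1f := L1M mD mb bM Lf.
  rewrite -RintegralB//; apply: le_trans (le_normr_Rintegral mD _) _.
    exact: L1B.
  have Lk : L1 D (fun x => `|f_ k x - f x|) by apply: L1_norm; exact: L1B.
  rewrite -RintegralZl//; apply: le_Rintegral => //.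
  - by apply: L1_norm; exact: L1B.
  - exact: L1Z.
  move=> x Dx; rewrite -mulrBr normrM ler_wpM2r//.
  exact: le_trans (bM _ Dx) (ler_norm _).
apply: norm_cvg0.
apply: (@squeeze_cvgr _ _ _ _ (cst 0) (fun k => `|M| * \int[mu]_(x in D) `|f_ k x - f x|)).
- by apply: nearW => k; rewrite normr_ge0 H.
- exact: cvg_cst.
- by rewrite -[X in _ --> X](mulr0 `|M|); apply: cvgMr.
Qed.

(** Both sides are continuous for the convergence of the approximations, for
    which this is [Rintegral_by_parts]. No boundary term appears, whatever the
    values of [b] on the boundary of [D]. *)
Lemma W11_approx_by_parts D v G b i (M : R) : measurable D ->
  W11_approx D v G -> Ck 1 b -> (forall x, D x -> `|b x| <= M) ->
  (forall x, D x -> `|partial i b x| <= M) ->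
  \int[mu]_(x in D) (partial i b x * v x) = - \int[mu]_(x in D) (b x * G x 0 i).
Proof.
move=> mD [Lv LG [phi [tp pv pG]]] Cb bM pbM.
have mb : measurable_fun D b.
  by apply: measurable_funTS; apply: continuous_measurable_rV; exact: Ck_continuous Cb.
have mpb : measurable_fun D (partial i b).
  apply: measurable_funTS; apply: continuous_measurable_rV.
  exact: Ck_continuous (Ck_partial i Cb).
have c1 := cvg_Rintegral_bounded mD (fun k => test_L1 mD (tp k)) Lv mpb pbM pv.
have c2 := cvg_Rintegral_bounded mD (fun k => test_L1 mD (test_partial i (tp k)))
  (LG i) mb bM (pG i).
have E k : \int[mu]_(x in D) (partial i b x * phi k x) =
    - \int[mu]_(x in D) (b x * partial i (phi k) x).
  have /test_functionP[sp [C [cC CD pC]]] := tp k.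
  have ccp : Cc (phi k) by split; [exact: Ck_continuous (sp 0%N)|exists C].
  have pD := vanishes_off_sub CD pC.
  have ppD : vanishes_off D (partial i (phi k)).
    apply: (vanishes_off_sub CD); apply: vanishes_off_partial => //.
    by apply: compact_closed => //; exact: norm_hausdorff.
  rewrite (Rintegral_vanishing (vanishes_offMr _ pD)).
  rewrite (Rintegral_vanishing (vanishes_offMr _ ppD)).
  by rewrite (Rintegral_by_parts i Cb (sp 1%N) ccp) opprK.
have c3 : (fun k => \int[mu]_(x in D) (partial i b x * phi k x)) @ \oo -->
    - \int[mu]_(x in D) (b x * G x 0 i).
  by under eq_fun do rewrite E; exact: cvgN.
exact: cvg_unique c1 c3.
Qed.

Lemma L1_ae A f h : measurable A -> L1 A f -> measurable_fun A h ->
  {ae mu, forall x, A x -> f x = h x} ->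
  L1 A h /\ \int[mu]_(x in A) f x = \int[mu]_(x in A) h x.
Proof.
move=> mA Lf mh fh; have mf := L1_measurable Lf.
have fhE : ae_eq mu A (EFin \o f) (EFin \o h).
  by apply: filterS fh => x /= H Ax; rewrite H.
split; last first.
  by congr fine; apply: ae_eq_integral => //; exact/measurable_EFinP.
apply/integrableP; split; first exact/measurable_EFinP.
have /integrableP[_] := Lf; apply: le_lt_trans.
rewrite le_eqVlt; apply/orP; left; apply/eqP; apply: ge0_ae_eq_integral => //.
- by apply: measurableT_comp => //; exact/measurable_EFinP.
- by apply: measurableT_comp => //; exact/measurable_EFinP.
by apply: filterS fhE => x H Ax; congr (`|_|)%E; exact/esym/(H Ax).
Qed.

Lemma patch0_integral D Omega f b : D `<=` Omega ->
  \int[mu]_(x in Omega) (patch (cst 0) D f x * b x) =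
  \int[mu]_(x in D) (b x * f x).
Proof.
move=> DO.
have vD : vanishes_off D (fun x => patch (cst 0) D f x * b x).
  by move=> x nDx; rewrite /patch memNset// mul0r.
rewrite (Rintegral_vanishing (vanishes_off_sub DO vD)) -(Rintegral_vanishing vD).
by apply: eq_Rintegral => x Dx; rewrite /patch Dx mulrC.
Qed.

Lemma L1loc_patch0 D Omega f : measurable D -> L1 D f -> L1loc Omega (patch (cst 0) D f).
Proof.
move=> mD Lf K cK KO; apply: (@L1S _ _ setT) => //.
  exact: measurable_compact_rV.
exact: (L1_restrict _ mD).1.
Qed.

(** The extension by zero has no jump across the boundary of [D], by
    [W11_approx_by_parts] with a test function on [Omega] for [b]. *)
Lemma W11_approx_extension D Omega v G : measurable D -> D `<=` Omega ->
  W11_approx D v G ->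
  is_weak_gradient Omega (patch (cst 0) D v) (patch (cst 0) D G).
Proof.
move=> mD DO aG; have [Lv LG _] := aG.
have GE i : (fun x => patch (cst 0) D G x 0 i) = patch (cst 0) D (fun x => G x 0 i).
  by apply/funext => x; rewrite /patch; case: ifPn => // _; rewrite /= mxE.
split; first exact: L1loc_patch0.
  by move=> i; rewrite GE; exact: L1loc_patch0.
move=> phi tp i.
rewrite patch0_integral//.
have -> : \int[mu]_(x in Omega) (patch (cst 0) D G x 0 i * phi x) =
    \int[mu]_(x in Omega) (patch (cst 0) D (fun x => G x 0 i) x * phi x).
  by rewrite -GE.
rewrite patch0_integral//.
have /test_functionP[sp [C [cC _ pC]]] := tp.
have /test_functionP[spi [C' [cC' _ pC']]] := test_partial i tp.
have [M _ pM] := Cc_bounded cC (Ck_continuous (sp 0%N)) pC.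
have [M' _ pM'] := Cc_bounded cC' (Ck_continuous (spi 0%N)) pC'.
apply: (@W11_approx_by_parts _ _ _ _ _ (Num.max M M')) => // x _.
  by rewrite le_max pM.
by rewrite le_max pM' orbT.
Qed.

Lemma W11_approx_weak_gradient D v G : measurable D -> W11_approx D v G ->
  is_weak_gradient D v G.
Proof.
move=> mD aG; have := W11_approx_extension mD (@subset_refl _ D) aG.
move=> [L1v L1G wG]; have [Lv LG _] := aG.
have mK (K : set rV) : compact K -> measurable K by exact: measurable_compact_rV.
split.
- by move=> K cK KD; apply: (@L1S _ _ D) => //; exact: mK.
- by move=> i K cK KD; apply: (L1S _ _ _ (LG i)) => //; exact: mK.
move=> phi tp i; have := wG _ tp i.
have E (f h : rV -> R) : (forall x, D x -> f x = h x) ->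
    \int[mu]_(x in D) f x = \int[mu]_(x in D) h x.
  by move=> fh; apply: eq_Rintegral => x /set_mem; exact: fh.
move=> H; rewrite (E _ (fun x => patch (cst 0) D v x * partial i phi x)); last first.
  by move=> x Dx; rewrite /patch mem_set.
rewrite H; congr (- _); apply: E => x Dx; by rewrite /patch mem_set.
Qed.

(** The weak gradient chosen in [W11norm] agrees almost everywhere with
    [partial i (phi k) - G]. *)
Lemma W11_approx_W11_0 D v G : open D -> W11_approx D v G -> W11_0 D v.
Proof.
move=> oD aG; have mD := open_measurable_rV oD.
have wG := W11_approx_weak_gradient mD aG.
have [Lv LG [phi [tp pv pG]]] := aG.
have Wv : W11loc D v by exists G.
split.
  have wv := weak_gradientP Wv; split => // i.
  have [_ Lw _] := wv.
  apply: (L1_ae mD (LG i) (L1loc_measurable oD (Lw i)) _).1.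
  apply: filterS (weak_gradient_unique oD wG wv) => x H Dx.
  by rewrite H.
exists phi => //.
have E k : W11norm D (phi k \- v) = (\int[mu]_(x in D) `|phi k x - v x| +
    \sum_(i < n) \int[mu]_(x in D) `|partial i (phi k) x - G x 0 i|)%:E.
  have /test_functionP[sp _] := tp k.
  have := is_weak_gradient_lin (-1) (is_weak_gradient_C1 D (sp 1%N)) wG.
  have -> : (fun x => phi k x + -1 * v x) = (phi k \- v).
    by apply/funext => x; rewrite mulN1r.
  move=> wk; have Wk : W11loc D (phi k \- v) by eexists; exact: wk.
  have wk' := weak_gradientP Wk; have [_ Lw _] := wk'.
  have Lp := test_L1 mD (tp k).
  rewrite /W11norm EFinD -sumEFin; congr (_ + _)%E.
    have L : L1 D (fun x => `|phi k x - v x|) by apply: L1_norm; exact: L1B.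
    by rewrite fineK//; exact: integrable_fin_num L.
  apply: eq_bigr => i _.
  have Lpi := test_L1 mD (test_partial i (tp k)).
  have L : L1 D (fun x => `|partial i (phi k) x - G x 0 i|).
    by apply: L1_norm; exact: L1B.
  have mw := L1loc_measurable oD (Lw i).
  have mnw : measurable_fun D (fun x => `|weak_gradient D (phi k \- v) x 0 i|).
    exact: measurableT_comp.
  have ae : {ae mu, forall x, D x -> `|partial i (phi k) x - G x 0 i| =
      `|weak_gradient D (phi k \- v) x 0 i|}.
    apply: filterS (weak_gradient_unique oD wk wk') => x H Dx.
    by rewrite -H// !mxE mulN1r.
  have [L' ->] := L1_ae mD L mnw ae.
  by rewrite fineK//; exact: integrable_fin_num L'.
rewrite (_ : (fun k => W11norm D (phi k \- v)) = EFin \o (fun k =>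
  \int[mu]_(x in D) `|phi k x - v x| +
    \sum_(i < n) \int[mu]_(x in D) `|partial i (phi k) x - G x 0 i|)); last first.
  by apply/funext => k; exact: E.
apply/fine_cvgP; split; first exact: nearW.
have S0 : (fun k => \sum_(i < n) \int[mu]_(x in D) `|partial i (phi k) x - G x 0 i|)
    @ \oo --> (0 : R).
  rewrite /index_enum; elim: (Finite.enum _) => [|i s IH].
    by under eq_fun do rewrite big_nil; exact: cvg_cst.
  under eq_fun do rewrite big_cons.
  by have := cvgD (pG i) IH; rewrite addr0; exact.
by have := cvgD pv S0; rewrite addr0; exact.
Qed.

End zero_trace.

(** * Superlevel sets *)

Section superlevel.
Variables (R : realType) (n : nat).
Local Notation rV := 'rV[R]_n.
Local Notation mu := (lebesgue_rV R n).
Variables (Omega : set rV) (w : rV -> R) (g : rV -> rV) (a : rV) (r rho : R).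
Hypothesis w_cont : forall x, Omega x -> {for x, continuous w}.
Hypothesis w_grad : is_weak_gradient Omega w g.
Hypothesis r_rho : 0 < r < rho.
Hypothesis ball_sub : cball a rho `<=` Omega.
Hypothesis w_le0 : forall x, cball a rho x -> r < `|a - x| -> w x <= 0.

Let B := cball a rho.
Definition superlevel (c : R) : set rV := [set x | `|a - x| <= rho /\ c < w x].
Local Notation D := (superlevel 0).

Lemma superlevel_near (c : R) x : 0 <= c -> superlevel c x -> `|a - x| <= r.
Proof.
move=> c0 [xB wx]; rewrite leNgt; apply/negP => /(w_le0 xB).
by rewrite leNgt (le_lt_trans c0 wx).
Qed.

Lemma open_superlevel : open D.
Proof.
have /andP[r0 rR] := r_rho.
rewrite openE => x Dx; have [xB wx] := Dx; have ar := superlevel_near (lexx 0) Dx.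
have wc := w_cont (ball_sub xB).
have /cvgrPdist_lt/(_ _ wx)/nbhs_ballP[d /= d0 dw] := wc.
apply/nbhs_ballP; exists (Num.min d (rho - r)) => /=.
  by rewrite lt_min d0 subr_gt0.
move=> y; rewrite -ball_normE/= lt_min => /andP[yd yr]; split.
  rewrite (le_trans (ler_distD x _ _))// -[leRHS](subrK r) addrC.
  by rewrite lerD// ltW.
have : `|w x - w y| < w x by apply: dw; rewrite -ball_normE.
by rewrite ltr_norml => /andP[_]; rewrite ltrBlDr ltrDl.
Qed.

Lemma compact_superlevel (c : R) : compact (B `&` [set x | c <= w x]).
Proof.
apply: (@subclosed_compact _ _ B); [|exact: compact_cball|by move=> x []].
rewrite -openC openE => x nBx.
have [xB|xB] := pselect (B x); last first.
  have : nbhs x (~` B) by apply: open_nbhs_nbhs; split => //; apply: closed_openC; exact: closed_cball.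
  by apply: filterS => y nBy [By _].
have wx : 0 < c - w x.
  by rewrite subr_gt0 ltNge; apply/negP => wc; apply: nBx.
have /cvgrPdist_lt/(_ _ wx)/nbhs_ballP[d /= d0 dw] := w_cont (ball_sub xB).
apply/nbhs_ballP; exists d => // y /dw + [_ /=].
rewrite distrC => /(le_lt_trans (ler_norm _)) /=; rewrite ltrBlDr subrK.
by rewrite ltNge => /negP.
Qed.

Lemma closure_superlevel : closure D `<=` cball a r.
Proof.
rewrite [X in _ `<=` X](closure_id _).1; last exact: closed_cball.
by apply: closure_subset => x; exact: superlevel_near.
Qed.

Let wB := w \_ B.
Let gB i := (fun x => g x 0 i) \_ B.

Let L1wB : L1 setT wB.
Proof. by have [Lw _ _] := w_grad; apply: (L1_patch _ _ Lw) => //; exact: compact_cball. Qed.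

Let L1gB i : L1 setT (gB i).
Proof. by have [_ Lg _] := w_grad; apply: (L1_patch _ _ (Lg i)) => //; exact: compact_cball. Qed.

Lemma superlevel_sub : D `<=` B.
Proof. by move=> x []. Qed.

Let mD : measurable D.
Proof. by apply: open_measurable_rV; exact: open_superlevel. Qed.

Let L1Dw : L1 D w.
Proof.
have [Lw _ _] := w_grad; have cB : compact B by exact: compact_cball.
apply: (L1S (measurable_compact_rV cB) mD superlevel_sub).
exact: Lw.
Qed.

Let L1Dg i : L1 D (fun x => g x 0 i).
Proof.
have [_ Lg _] := w_grad; have cB : compact B by exact: compact_cball.
apply: (L1S (measurable_compact_rV cB) mD superlevel_sub).
exact: Lg.
Qed.

Let L1D_of (f : rV -> R) : L1 setT f -> L1 D f.
Proof. exact: L1S. Qed.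

(** The kernel has integral 1, so that [w x] can be put under the
    integral. *)
Lemma conv_superlevel (e d : R) K x : is_kernel e K -> cball x e `<=` B ->
  (forall y, `|x - y| <= e -> `|w x - w y| <= d) ->
  `|conv K wB x - w x| <= d.
Proof.
move=> kK xB xd; have cK := is_kernel_Cc kK; have [sK K0 KC K1] := kK.
have Lc := L1_conv x cK L1wB; have LK := Cc_L1 cK.
have LKx := L1_shift (- x) LK.
have E : \int[mu]_y (K (y - x) * w x) = w x.
  by rewrite RintegralZr// Rintegral_shift// K1 mul1r.
have LKw : L1 setT (fun y => K (y - x) * w x).
  by apply: (L1_eq _ (f := fun y => w x * K (y - x))) => //;
    [move=> y _; rewrite mulrC|exact: L1Z].
rewrite -[X in _ - X]E /conv -RintegralB//.
apply: le_trans (le_normr_Rintegral _ _) _ => //; first exact: L1B.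
have -> : d = \int[mu]_y (d * K (y - x)).
  by rewrite RintegralZl// Rintegral_shift// K1 mulr1.
apply: le_Rintegral => //.
- by apply: L1_norm; exact: L1B.
- exact: L1Z.
move=> y _; rewrite -mulrBr normrM ger0_norm// mulrC.
have [yx|yx] := leP `|x - y| e; last first.
  by rewrite KC ?mulr0// /cball/= sub0r normrN distrC leNgt yx.
apply: ler_wpM2r => //; rewrite /wB patchE mem_set; last exact: xB.
by rewrite distrC; exact: xd.
Qed.

(** [phi] is the truncation [H] of a mollification [c] of [w], and [zeta] is
    [derive1 H \o c]. Continuity of [w] makes [c] uniformly close to [w] well
    inside the ball, and [w <= 0] makes [c <= 0] near its boundary; so the
    support of [phi] lies in a compact set where [w] is positive. *)
Lemma superlevel_step : exists2 M : R, 0 <= M & forall d : R, 0 < d ->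
  exists phi zeta : rV -> R,
  [/\ test_function D phi,
      measurable_fun D zeta /\ (forall x, `|zeta x| <= M),
      forall x, D x -> 3 * d < w x -> zeta x = 1,
      \int[mu]_(x in D) `|phi x - w x| <= d + 2 * d * fine (mu D) &
      forall i, \int[mu]_(x in D) `|partial i phi x - zeta x * g x 0 i| <= M * d].
Proof.
have /andP[r0 rR] := r_rho; have cB : compact B by exact: compact_cball.
have [M M0 trunc] := smooth_truncation R; exists M => // d d0.
have [H [CH H0 Hd HM H1]] := trunc _ d0.
have [e1 e10 e1w] := unif_continuous_compact cB (fun x Bx => w_cont (ball_sub Bx))
  (divr_gt0 d0 (ltr0n R 2)).
have [e2 e20 e2w] := conv_L1_cvg L1wB d0.
have [e3 e30 e3g] : exists2 e : R, 0 < e & forall i (e' : R) K, e' < e -> is_kernel e' K ->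
    L1 setT (conv K (gB i)) /\ L1dist (conv K (gB i)) (gB i) <= d.
  have /choice[f fP] : forall i : 'I_n, exists e : R, 0 < e /\ forall (e' : R) K, e' < e ->
    is_kernel e' K -> L1 setT (conv K (gB i)) /\ L1dist (conv K (gB i)) (gB i) <= d.
    by move=> i; have [e e0 eP] := conv_L1_cvg (L1gB i) d0; exists e.
  exists (\big[Num.min/1]_i f i).
    by apply/bigmin_gtP; split => // i _; have [] := fP i.
  move=> i e' K e'f; have [_] := fP i; apply; apply: lt_le_trans e'f _.
  exact: bigmin_le_cond.
(* smaller than the three moduli, and such that a point is either at distance
   at least [e] from the complement of [B] or at distance at least [e] from the
   ball of radius [r], outside which [w <= 0] *)
pose e := Num.min (Num.min e1 e2) (Num.min e3 (rho - r)) / 2.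
have m0 : 0 < Num.min (Num.min e1 e2) (Num.min e3 (rho - r)).
  by rewrite !lt_min e10 e20 e30 subr_gt0.
have e0 : 0 < e by exact: divr_gt0.
have : e < Num.min (Num.min e1 e2) (Num.min e3 (rho - r)).
  by rewrite /e ltr_pdivrMr// ltr_pMr// ltr1n.
rewrite !lt_min => /andP[/andP[ee1 ee2] /andP[ee3 _]].
have eR : e <= (rho - r) / 2.
  by rewrite /e ler_pM2r ?invr_gt0// !ge_min lexx !orbT.
have [K kK] := is_kernel_exists n e0.
have cK := is_kernel_Cc kK; have [sK K0 KC K1] := kK.
have [Lc cw] := e2w _ _ ee2 kK.
pose c := conv K wB; have sc : smooth c by exact: smooth_conv.
have Bx x : `|a - x| <= rho - e -> cball x e `<=` B.
  move=> ax y xy; rewrite /B/cball/= (le_trans (ler_distD x _ _))//.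
  by rewrite -[leRHS](subrK e) lerD.
have cnear x : `|a - x| <= rho - e -> `|c x - w x| <= d / 2.
  move=> ax; apply: (conv_superlevel kK (Bx _ ax)) => y xy.
  apply: e1w; last exact: le_lt_trans ee1.
  by rewrite /B/cball/= (le_trans ax)// gerBl ltW.
have cfar x : rho - e < `|a - x| -> c x <= 0.
  move=> ax; rewrite /c /conv.
  apply: (@le_trans _ _ (\int[mu]_(y in setT) 0)); last first.
    by rewrite Rintegral_cst// mul0r.
  apply: le_Rintegral => //; [exact: L1_conv|exact: L1_0|].
  move=> y _; have [yx|yx] := leP `|y - x| e; last first.
    by rewrite KC ?mul0r// /cball/= sub0r normrN leNgt yx.
  rewrite mulr_ge0_le0// /wB patchE; case: ifPn => // /set_mem By.
  apply: w_le0 => //; rewrite ltNge; apply/negP => ay.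
  have : `|a - x| <= r + e.
    by rewrite (le_trans (ler_distD y _ _))// lerD.
  rewrite leNgt => /negP; apply; apply: le_lt_trans ax.
  rewrite -lerBrDr; move: eR; lra.
have Dnear x : D x -> `|a - x| <= rho - e.
  move=> /(superlevel_near (lexx 0))/le_trans; apply; move: eR; lra.
pose phi := H \o c; pose zeta := derive1 H \o c.
have sphi : smooth phi by move=> k; exact: Ck_comp.
have cz : continuous zeta.
  have : Ck 0 zeta by apply: Ck_comp; [have [_ []] := CH 1%N|exact: sc].
  by case.
have pE i x : partial i phi x = zeta x * partial i c x.
  rewrite /phi partial_comp//; first by move=> t; have [_ [dH _]] := CH 1%N; exact: dH.
  by move=> y; exact: Ck_derivable (sc 1%N).
have tphi : test_function D phi.
  apply/test_functionP; split => //.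
  exists (B `&` [set x | d / 2 <= w x]); split.
  - exact: compact_superlevel.
  - by move=> x [Bxx /= wx]; split => //; apply: lt_le_trans wx; exact: divr_gt0.
  - move=> x nx; apply: H0; rewrite leNgt; apply/negP => dc.
    have [ax|ax] := leP `|a - x| (rho - e); last first.
      by have := cfar _ ax; rewrite leNgt (lt_trans d0 dc).
    apply: nx; split; first by rewrite /B/cball/= (le_trans ax)// gerBl ltW.
    rewrite /=; have := cnear _ ax; rewrite ler_norml => /andP[_].
    move: dc; lra.
have Dfin : (mu D < +oo)%E.
  apply: le_lt_trans (lebesgue_compact_fin cB).
  by apply: le_measure; rewrite ?inE//; [exact: measurable_compact_rV|exact: superlevel_sub].
have intD (f : rV -> R) : L1 setT f -> (forall x, 0 <= f x) ->
    \int[mu]_(x in D) f x <= \int[mu]_x f x.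
  move=> Lf f0; rewrite [leLHS]Rintegral_mkcond; apply: le_Rintegral => //.
    by apply: (L1_restrict _ mD).1; exact: L1D_of.
  by move=> x _; rewrite patchE; case: ifPn => // _; exact: f0.
exists phi, zeta; split => //.
- split; last by move=> x; exact: HM.
  by apply: measurable_funTS; exact: continuous_measurable_rV.
- move=> x Dx wx; apply: H1; have := cnear _ (Dnear _ Dx).
  rewrite ler_norml => /andP[+ _]; move: wx; lra.
- have Lphi : L1 D phi by exact: test_L1.
  have Lcw : L1 setT (fun x => `|c x - wB x|) by exact: L1_absB.
  have L2d : L1 D (fun _ : rV => 2 * d).
    by apply: (@L1_bounded _ _ _ _ (2 * d)) => // x _; rewrite gtr0_norm// mulr_gt0.
  apply: (@le_trans _ _ (\int[mu]_(x in D) (`|c x - wB x| + 2 * d))).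
    apply: le_Rintegral => //.
    + by apply: L1_norm; exact: L1B.
    + by apply: L1D => //; exact: L1D_of.
    move=> x Dx; have [xB wx] := Dx.
    rewrite {1}/wB patchE mem_set//.
    have [c0|c0] := leP 0 (c x).
      rewrite (le_trans (ler_distD (c x) _ _))// addrC lerD//.
      by apply: Hd.
    rewrite /phi/= H0; last by rewrite (le_trans (ltW c0))// ltW.
    rewrite sub0r normrN distrC gtr0_norm// gtr0_norm ?subr_gt0 ?(lt_trans c0)//.
    by move: c0 d0; lra.
  rewrite RintegralD//; last exact: L1D_of.
  rewrite Rintegral_cst// lerD2r; apply: le_trans cw.
  exact: intD.
- move=> i; have [Lgc gd] := e3g i _ _ ee3 kK.
  have Lgd : L1 setT (fun x => `|conv K (gB i) x - gB i x|) by exact: L1_absB.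
  have mz : measurable_fun D zeta.
    by apply: measurable_funTS; exact: continuous_measurable_rV.
  apply: (@le_trans _ _ (\int[mu]_(x in D) (M * `|conv K (gB i) x - gB i x|))).
    apply: le_Rintegral => //.
    + apply: L1_norm; apply: L1B => //.
        by apply: test_L1 => //; exact: test_partial.
      by apply: (@L1M _ _ _ _ _ M) => // x _; exact: HM.
    + by apply: L1Z => //; exact: L1D_of.
    move=> x Dx; have [xB wx] := Dx.
    rewrite pE -mulrBr normrM {2}/gB patchE mem_set//.
    rewrite /c (partial_conv_weak i w_grad cB ball_sub kK (Bx _ (Dnear _ Dx))).
    by rewrite ler_wpM2r//; exact: HM.
  rewrite RintegralZl//; last exact: L1D_of.
  apply: ler_wpM2l => //; apply: le_trans gd.
  exact: intD.
Qed.

(** The factors [zeta] converge to 1 at each point where [w] is positive and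
    are bounded by [M], so that dominated convergence applies to the
    gradients. *)
Lemma W11_approx_superlevel : W11_approx D w g.
Proof.
have [M M0 step] := superlevel_step.
pose d (k : nat) : R := k.+1%:R^-1.
have d0 k : 0 < d k by rewrite invr_gt0.
have /choice[phi /choice[zeta pz]] := fun k => step _ (d0 k).
have dcvg : d @ \oo --> (0 : R) by exact: cvg_harmonic.
split => //; exists phi; split.
- by move=> k; have [] := pz k.
- apply: (@squeeze_cvgr _ _ _ _ (cst 0) (fun k => d k * (1 + 2 * fine (mu D)))).
  + apply: nearW => k; rewrite Rintegral_ge0//=.
    have [_ _ _ + _] := pz k; move=> /le_trans; apply.
    by rewrite mulrDr mulr1 mulrCA mulrA.
  + exact: cvg_cst.
  + rewrite -[X in _ --> X](mul0r (1 + 2 * fine (mu D))).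
    by apply: cvgMl; exact: dcvg.
- move=> i.
  have mzk k : measurable_fun D (zeta k) by have [_ [] ] := pz k.
  have zM k x : `|zeta k x| <= M by have [_ []] := pz k.
  have Lzg k : L1 D (fun x => zeta k x * g x 0 i).
    by apply: (@L1M _ _ _ _ _ M).
  have mg := L1_measurable (L1Dg i).
  have LMg : L1 D (fun x => M * `|g x 0 i|) by apply: L1Z => //; exact: L1_norm.
  have [||_ cz] := @L1_dominated _ _ D (fun k x => zeta k x * g x 0 i) (fun x => g x 0 i)
    (fun x => M * `|g x 0 i|) mD (fun k => L1_measurable (Lzg k)) mg _ LMg _.
  + move=> x Dx; have [xB wx] := Dx.
    apply: cvg_near_cst.
    have w3 : 0 < w x / 3 by exact: divr_gt0.
    have /cvgr0_norm_lt/(_ _ w3) := dcvg; apply: filterS => k.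
    rewrite gtr0_norm// ltr_pdivlMr// mulrC => dk.
    by have [_ _ /(_ _ Dx dk) -> _ _] := pz k; rewrite mul1r.
  + by move=> k x _; rewrite normrM ler_wpM2r.
  apply: (@squeeze_cvgr _ _ _ _ (cst 0)
    (fun k => M * d k + \int[mu]_(x in D) `|zeta k x * g x 0 i - g x 0 i|)).
  + apply: nearW => k; rewrite Rintegral_ge0//=.
    have [tk _ _ _ /(_ i) Mk] := pz k.
    have Lp : L1 D (partial i (phi k)) by apply: test_L1 => //; exact: test_partial.
    have L1a : L1 D (fun x => `|partial i (phi k) x - zeta k x * g x 0 i|).
      by apply: L1_norm; exact: L1B.
    have L1b : L1 D (fun x => `|zeta k x * g x 0 i - g x 0 i|).
      by apply: L1_norm; exact: L1B.
    apply: le_trans (lerD Mk (lexx _)); rewrite -RintegralD//.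
    apply: le_Rintegral => //.
    * by apply: L1_norm; exact: L1B.
    * exact: L1D.
    by move=> x _; exact: ler_distD.
  + exact: cvg_cst.
  + have Md : (fun k => M * d k) @ \oo --> (0 : R).
      by rewrite -[X in _ --> X](mulr0 M); apply: cvgMr; exact: dcvg.
    by have := cvgD Md cz; rewrite addr0; exact.
Qed.

End superlevel.

(** * Quadratic functions and convexity *)

Section quadratic.
Variables (R : realType) (n : nat).
Local Notation rV := 'rV[R]_n.
Implicit Types (x v p z a : rV) (Y : 'M[R]_n) (f H : rV -> R).

Lemma dotE p z : dot p z = (p *m z^T) 0 0.
Proof. by rewrite /dot mxE; apply: eq_bigr => i _; rewrite mxE. Qed.

Lemma quadE Y z : quad Y z = (z *m Y *m z^T) 0 0.
Proof.
rewrite /quad mxE exchange_big/=; apply: eq_bigr => j _.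
rewrite !mxE mulr_suml; apply: eq_bigr => i _; ring.
Qed.

Lemma dotDl p p' z : dot (p + p') z = dot p z + dot p' z.
Proof. by rewrite !dotE mulmxDl mxE. Qed.

Lemma dotDr p z z' : dot p (z + z') = dot p z + dot p z'.
Proof. by rewrite !dotE linearD/= mulmxDr mxE. Qed.

Lemma dotZr (c : R) p z : dot p (c *: z) = c * dot p z.
Proof. by rewrite !dotE linearZ/= -scalemxAr mxE. Qed.

Lemma quad_expand Y z v (h : R) : Y^T = Y ->
  quad Y (h *: v + z) = quad Y z + 2 * h * dot (z *m Y) v + h ^+ 2 * quad Y v.
Proof.
move=> sY; rewrite !quadE dotE.
have -> : (h *: v + z)^T = h *: v^T + z^T by rewrite linearD linearZ.
rewrite !(mulmxDl, mulmxDr) -!(scalemxAl, scalemxAr).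
have mx11D (A A' : 'M[R]_1) : (A + A') 0 0 = A 0 0 + A' 0 0 by rewrite mxE.
have mx11Z (k : R) (A : 'M[R]_1) : (k *: A) 0 0 = k * A 0 0 by rewrite mxE.
rewrite !(mx11D, mx11Z).
have -> : (v *m Y *m z^T) 0 0 = (z *m Y *m v^T) 0 0.
  have -> : v *m Y *m z^T = (z *m Y *m v^T)^T.
    by rewrite !trmx_mul trmxK sY mulmxA.
  by rewrite mxE.
ring.
Qed.

Definition quadratic (c : R) p Y a x : R :=
  c + dot p (x - a) + 2^-1 * quad Y (x - a).

(** The gradient of [quadratic c p Y a] when [Y] is symmetric. *)
Definition affine p Y a x : rV := p + (x - a) *m Y.

Lemma quadratic_center c p Y a : quadratic c p Y a a = c.
Proof.
rewrite /quadratic subrr /dot /quad big1 => [|i _]; last by rewrite mxE mulr0.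
rewrite big1 ?mulr0 ?addr0// => i _; rewrite big1// => j _.
by rewrite !mxE !mulr0.
Qed.

Lemma is_derive_quadratic c p Y a x v : Y^T = Y ->
  is_derive x v (quadratic c p Y a) (dot (affine p Y a x) v).
Proof.
move=> sY.
have E (h : R) : quadratic c p Y a (h *: v + x) - quadratic c p Y a x =
    h * dot (affine p Y a x) v + h ^+ 2 / 2 * quad Y v.
  rewrite /quadratic /affine (_ : h *: v + x - a = h *: v + (x - a)); last by rewrite addrA.
  rewrite (dotDr _ (h *: v)) dotZr quad_expand// dotDl.
  by field.
have H : h^-1 *: (quadratic c p Y a (h *: v + x) - quadratic c p Y a x) @[h --> 0^']
    --> dot (affine p Y a x) v.
  apply/cvgrPdist_le => e e0; near=> h.
  have h0 : h != 0 by near: h; exact: nbhs_dnbhs_neq.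
  have -> : dot (affine p Y a x) v -
      h^-1 *: (quadratic c p Y a (h *: v + x) - quadratic c p Y a x) =
      - (h / 2 * quad Y v).
    rewrite E /GRing.scale/=; by field.
  have q0 : 0 < `|quad Y v| + 1 by rewrite ltr_wpDl.
  rewrite normrN normrM (@le_trans _ _ (`|h| * (`|quad Y v| + 1)))//.
    rewrite ler_pM// ?lerDl// normrM ler_piMr// gtr0_norm ?invf_le1//.
    by rewrite ler1n.
  rewrite -ler_pdivlMr// ltW//; near: h; apply: dnbhs0_lt; exact: divr_gt0.
apply: DeriveDef; first by apply/cvg_ex; eexists; exact: H.
exact/cvg_lim.
Unshelve. all: by end_near. Qed.

Lemma dot_delta p i : dot p (delta_mx 0 i) = p 0 i.
Proof.
rewrite /dot (bigD1 i)//= big1 ?addr0; first by rewrite mxE !eqxx mulr1.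
by move=> j ji; rewrite mxE (negPf ji) andbF mulr0.
Qed.

Lemma partial_quadratic c p Y a i : Y^T = Y ->
  partial i (quadratic c p Y a) = (fun x => affine p Y a x 0 i).
Proof.
move=> sY; apply/funext => x.
by have [_ +] := is_derive_quadratic c p a x (delta_mx 0 i) sY; rewrite dot_delta.
Qed.

Lemma continuous_affine_coord p Y a i : continuous (fun x => affine p Y a x 0 i).
Proof.
have -> : (fun x => affine p Y a x 0 i) =
    (fun x => p 0 i + \sum_j (x 0 j + - a 0 j) * Y j i).
  by apply/funext => x; rewrite !mxE; congr (_ + _); apply: eq_bigr => j _; rewrite !mxE.
apply: (@Ck_continuous _ _ 0); apply: CkD; first exact: Ck_cst.
apply: Ck_sum => j; apply: CkM; last exact: Ck_cst.
by apply: CkD; [exact: Ck_coord|exact: Ck_cst].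
Qed.

Lemma continuous_coords (P : rV -> rV) :
  (forall i, continuous (fun x => P x 0 i)) -> continuous P.
Proof.
move=> cP; suff H : forall x : rV, {for x, continuous P} by move=> x; exact: H.
move=> x; apply: (iffRL (@cvgrPdist_lt _ _ _ (nbhs x) (nbhs_filter x) P (P x))) => e e0.
have : \forall y \near nbhs x, forall i, `|P x 0 i - P y 0 i| < e.
  apply: (@filter_forall _ _ _ (nbhs x) (nbhs_filter x)) => i.
  by have /cvgrPdist_lt/(_ _ e0) := cP i x.
apply: filterS => y H.
have : ball (P x) e (P y) by rewrite cube_boxE// => i; rewrite -ball_normE; exact: H.
by rewrite -ball_normE.
Qed.

Lemma continuous_affine p Y a : continuous (affine p Y a).
Proof. by apply: continuous_coords => i; exact: continuous_affine_coord. Qed.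

Lemma Ck1_quadratic c p Y a : Y^T = Y -> Ck 1 (quadratic c p Y a).
Proof.
move=> sY; split.
  move=> x.
  have E : quadratic c p Y a = (fun x => c + \sum_i p 0 i * (x 0 i + - a 0 i) +
      2^-1 * \sum_i \sum_j Y i j * (x 0 i + - a 0 i) * (x 0 j + - a 0 j)).
    apply/funext => y; rewrite /quadratic /dot /quad; congr (_ + _ + _ * _).
      by apply: eq_bigr => i _; rewrite !mxE.
    by apply: eq_bigr => i _; apply: eq_bigr => j _; rewrite !mxE.
  rewrite E; move: x; apply: (@Ck_continuous _ _ 0).
  have Cc i : Ck 0 (fun x : rV => x 0 i + - a 0 i).
    by apply: CkD; [exact: Ck_coord|exact: Ck_cst].
  apply: CkD; first apply: CkD; first exact: Ck_cst.
    by apply: Ck_sum => i; exact: CkZ.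
  apply: CkZ; apply: Ck_sum => i; apply: Ck_sum => j.
  by apply: CkM => //; exact: CkZ.
move=> i; split; first by move=> x; have [] := is_derive_quadratic c p a x (delta_mx 0 i) sY.
split=> //; rewrite partial_quadratic//; exact: continuous_affine_coord.
Qed.

(** An increment of [x] along [v] is one of [affine p Y a x] along
    [v *m Y]. *)
Lemma is_derive_comp_affine H p Y a x v : Ck 1 H ->
  is_derive x v (H \o affine p Y a)
    (\sum_i (v *m Y) 0 i * partial i H (affine p Y a x)).
Proof.
move=> CH; have [dH <-] := is_derive_C1 (affine p Y a x) (v *m Y) CH.
have E : (fun h : R => h^-1 *: ((H \o affine p Y a) (h *: v + x) -
    (H \o affine p Y a) x)) =
  (fun h : R => h^-1 *: (H (h *: (v *m Y) + affine p Y a x) - H (affine p Y a x))).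
  apply/funext => h; congr (_ *: (H _ - _)).
  by rewrite /affine -addrA mulmxDl -scalemxAl addrCA.
by apply: DeriveDef; [rewrite /derivable E; exact: dH|rewrite /derive E].
Qed.

Lemma partial_comp_affine H p Y a j x : Ck 1 H ->
  partial j (H \o affine p Y a) x = \sum_i Y j i * partial i H (affine p Y a x).
Proof.
move=> CH; have [_ E] := is_derive_comp_affine p Y a x (delta_mx 0 j) CH.
rewrite /partial E; apply: eq_bigr => i _; congr (_ * _).
by rewrite -rowE mxE.
Qed.

Lemma Ck1_comp_affine H p Y a : Ck 1 H -> Ck 1 (H \o affine p Y a).
Proof.
move=> CH; have cP := @continuous_affine p Y a.
split; first by move=> x; apply: continuous_comp; [exact: cP|exact: (Ck_continuous CH)].
move=> j; split; first by move=> x; have [] := is_derive_comp_affine p Y a x (delta_mx 0 j) CH.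
split=> //.
rewrite (_ : partial j _ = (fun x => \sum_i Y j i * (partial i H \o affine p Y a) x)).
  have C0 i : Ck 0 (partial i H \o affine p Y a).
    split=> // x; apply: continuous_comp; first exact: cP.
    exact: (Ck_continuous (Ck_partial i CH)).
  by apply: (@Ck_continuous _ _ 0); apply: Ck_sum => i; exact: CkZ.
by apply/funext => x; rewrite partial_comp_affine.
Qed.

(** By convexity the difference quotients of [F] at [p] towards [q] are at most
    [F q - F p]; the derivative is their limit from the right. *)
Lemma convex_gradient_le (F : rV -> R) p q : Ck 1 F ->
  convex_function [set: convex_lmodType rV] F ->
  \sum_i (q - p) 0 i * partial i F p <= F q - F p.
Proof.
move=> CF cF; have [dF E] := is_derive_C1 p (q - p) CF; rewrite -E.
have dc : h^-1 *: (F (h *: (q - p) + p) - F p) @[h --> 0^'] --> 'D_(q - p) F p.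
  exact: dF.
have dr : h^-1 *: (F (h *: (q - p) + p) - F p) @[h --> 0^'+] --> 'D_(q - p) F p.
  exact: cvg_dnbhs_at_right.
apply: (cvgr_to_le dr); near=> h.
have h0 : 0 < h by near: h; exact: nbhs_right_gt.
have h1 : h <= 1 by apply: ltW; near: h; apply: nbhs_right_lt.
have H : F (h *: q + (1 - h) *: p) <= h * F q + (1 - h) * F p.
  exact: (cF (Itv01 (ltW h0) h1) q p (mem_setT _) (mem_setT _)).
rewrite -[h^-1 *: _]/(h^-1 * _) ler_pdivrMl//.
rewrite (_ : h *: (q - p) + p = h *: q + (1 - h) *: p); last first.
  by rewrite scalerBr scalerBl scale1r -addrA [- _ + p]addrC.
by move: H; lra.
Unshelve. all: by end_near. Qed.

End quadratic.

(** * Touching a minimiser by a strict subsolution or supersolution *)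

Section touching.
Variables (R : realType) (n : nat).
Local Notation rV := 'rV[R]_n.
Local Notation mu := (lebesgue_rV R n).
Implicit Types (F u : rV -> R) (Omega D : set rV) (a p : rV) (Y : 'M[R]_n).

(** The extension of [g] by zero is measurable on the whole space, where
    measurability of a vector-valued function can be tested on
    coordinates. *)
Lemma measurable_comp_coords D (g : rV -> rV) F : measurable D ->
  (forall i, measurable_fun D (fun x => g x 0 i)) -> continuous F ->
  measurable_fun D (F \o g).
Proof.
move=> mD mg cF.
pose gD x : rV := \row_i ((fun y => g y 0 i) \_ D) x.
have mgD : measurable_fun setT gD.
  apply: measurable_fun_rV => i.
  apply: (@eq_measurable_fun _ _ _ _ _ ((fun y => g y 0 i) \_ D)).
    by move=> x _; rewrite /gD mxE.
  apply: (measurable_restrictT _ mD).1; exact: mg.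
apply: (@eq_measurable_fun _ _ _ _ _ (F \o gD)).
  move=> x Dx /=; congr F; apply/rowP => i.
  by rewrite mxE patchE Dx.
apply: measurable_funTS; apply: measurableT_comp mgD.
exact: continuous_measurable_rV.
Qed.

(** Otherwise [s] would vanish almost everywhere on [D], which contains a
    cube. *)
Lemma Rintegral_lt0 D (s : rV -> R) : open D -> D !=set0 -> L1 D s ->
  (forall x, D x -> s x < 0) -> \int[mu]_(x in D) s x < 0.
Proof.
move=> oD [a Da] Ls s0; have mD := open_measurable_rV oD.
rewrite ltNge; apply/negP => I0.
have In : \int[mu]_(x in D) `|s x| = 0.
  apply/eqP; rewrite eq_le Rintegral_ge0 ?andbT//.
  have -> : \int[mu]_(x in D) `|s x| = (-1) * \int[mu]_(x in D) s x.
    rewrite -RintegralZl//; apply: eq_Rintegral => x /set_mem Dx.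
    by rewrite ltr0_norm ?s0// mulN1r.
  by rewrite mulN1r oppr_le0.
have /ae_eq_integral_abs : measurable_fun D (EFin \o s) by exact: (measurable_int mu Ls).
move=> /(_ mu mD)[+ _].
have -> : (\int[mu]_(x in D) `|(EFin \o s) x| = 0)%E.
  have Ln := L1_norm Ls.
  by rewrite -[LHS]fineK ?(integrable_fin_num mD Ln)//; congr EFin.
move=> /(_ erefl)[N [mN N0 DN]].
have /nbhs_ballP[d /= d0 dD] : nbhs a D by exact: open_nbhs_nbhs.
have aN : ball a d `<=` N.
  move=> x /dD Dx; apply: DN => /= /(_ Dx)[]; apply/eqP.
  by rewrite lt_eqF// s0.
have : (mu (ball a d) <= mu N)%E.
  by apply: le_measure; rewrite ?inE//; exact: measurable_ball_rV.
rewrite N0 (_ : mu (ball a d) = ((d *+ 2) ^+ n)%:E); last exact: lebesgue_cube.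
by rewrite lee_fin leNgt exprn_gt0// mulrn_wgt0.
Qed.

(** The contradiction at the heart of the theorem. The competitor for [u] is
    [quadratic - sg * kap] on the superlevel set [D] of [w], with gradient [P];
    convexity compares [F (Du)] with [F P], and an integration by parts against
    [F_A (P)] contradicts the sign of its divergence. *)
Lemma minimiser_not_touched Omega F u (sg eps rho : R) a p Y :
  open Omega -> Ck 2 F -> convex_function [set: convex_lmodType rV] F ->
  (forall x, Omega x -> {for x, continuous u}) -> local_minimiser F Omega u ->
  sg * sg = 1 -> Y^T = Y -> 0 < eps -> 0 < rho -> cball a rho `<=` Omega ->
  (forall x, cball a rho x ->
    sg * (u x - quadratic (u a) p Y a x) <= - (eps * `|a - x| ^+ 2)) ->
  (forall x, cball a rho x ->
    sg * mxdot (hessian F (affine p Y a x)) Y < 0) ->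
  False.
Proof.
move=> oO CF cvxF cu [Wu umin] sg1 sY eps0 rho0 aO touch ell.
have CF1 : Ck 1 F by exact: CkW.
pose q := quadratic (u a) p Y a; pose P := affine p Y a.
have Cq : Ck 1 q by exact: Ck1_quadratic.
pose r := rho / 2; have r0 : 0 < r by exact: divr_gt0.
(* the margin of the contact at distance [r], so that [w <= 0] from there on *)
pose kap := eps * r ^+ 2; have kap0 : 0 < kap by rewrite mulr_gt0// exprn_gt0.
pose v0 x := kap + - sg * q x.
have Cv0 : Ck 1 v0 by apply: CkD; [exact: Ck_cst|exact: CkZ].
pose w x := v0 x + sg * u x.
have wE x : w x = sg * (u x - q x) + kap by rewrite /w /v0; ring.
pose gu := weak_gradient Omega u.
have wgu : is_weak_gradient Omega u gu := weak_gradientP Wu.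
pose gw x := \row_i partial i v0 x + sg *: gu x.
have wgw : is_weak_gradient Omega w gw.
  by apply: is_weak_gradient_lin => //; exact: is_weak_gradient_C1.
have gwE x : gw x = sg *: (gu x - P x).
  apply/rowP => i; rewrite !mxE.
  have -> : partial i v0 x = - sg * P x 0 i.
    rewrite /v0 partialD; last 2 first.
    - by move=> y; exact: (derivable_cst kap y (delta_mx 0 i)).
    - by move=> y; exact: Ck_derivable (CkZ (- sg) Cq).
    have -> : partial i (fun _ : rV => kap) x = 0 by exact: (derive_cst kap x (delta_mx 0 i)).
    rewrite partialM; last 2 first.
    - by move=> y; exact: (derivable_cst (- sg) y (delta_mx 0 i)).
    - by move=> y; exact: Ck_derivable Cq.
    have -> : partial i (fun _ : rV => - sg) x = 0 by exact: (derive_cst (- sg) x (delta_mx 0 i)).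
    by rewrite mulr0 addr0 add0r partial_quadratic.
  by rewrite !mxE; ring.
have cw x : Omega x -> {for x, continuous w}.
  move=> Ox; apply: continuousD; first exact: (Ck_continuous Cv0).
  by apply: continuousM; [exact: cst_continuous|exact: cu].
have rrho : 0 < r < rho by rewrite r0 /r ltr_pdivrMr// ltr_pMr// ltr1n.
have w0 x : cball a rho x -> r < `|a - x| -> w x <= 0.
  move=> ax rx; rewrite wE -lerBrDr sub0r; apply: le_trans (touch x ax) _.
  by rewrite lerN2 ler_pM2l// ler_pXn2r ?nnegrE ?(ltW r0)// ltW.
pose D := superlevel w a rho 0.
have oD : open D := open_superlevel cw rrho aO w0.
have mD := open_measurable_rV oD.
have DB : D `<=` cball a rho by move=> x [].
have cB : compact (cball a rho) by exact: compact_cball.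
have mB := measurable_compact_rV cB.
have DO : D `<=` Omega by exact: subset_trans aO.
have clD : closure D `<=` cball a r by exact: (closure_superlevel w0).
have aw : W11_approx D w gw := W11_approx_superlevel cw wgw rrho aO w0.
have aw' := W11_approxZ (- sg) mD aw.
have Da : D a.
  split; first by rewrite subrr normr0 ltW.
  by rewrite wE /q quadratic_center subrr mulr0 add0r.
have cclD : compact (closure D).
  by apply: subclosed_compact (@compact_cball _ _ a r) clD; exact: closed_closure.
have clO : closure D `<=` Omega.
  apply: subset_trans clD _ => x ax; apply: aO; apply: le_trans ax _.
  by case/andP: rrho => _ /ltW.
have := umin D oD cclD clO _ (W11_approx_W11_0 oD aw').
set comp := (u \+ _)%R.
have wcomp := is_weak_gradient_lin 1 wgu (W11_approx_extension mD DO aw').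
have compE : comp = (fun x => u x + 1 * patch (cst 0) D (fun x => - sg * w x) x).
  by apply/funext => x; rewrite mul1r.
rewrite -compE in wcomp.
pose gc := weak_gradient Omega comp.
have wgc : is_weak_gradient Omega comp gc.
  by apply: weak_gradientP; eexists; exact: wcomp.
have gcP : {ae mu, forall x, D x -> P x = gc x}.
  apply: filterS (weak_gradient_unique oO wcomp wgc) => x H Dx.
  rewrite -H; last exact: DO.
  rewrite /patch mem_set// scale1r gwE scalerA mulNr sg1 scaleN1r.
  by rewrite opprB addrC subrK.
have cP : continuous P by exact: continuous_affine.
have cFP : continuous (F \o P).
  by move=> x; apply: continuous_comp; [exact: cP|exact: (Ck_continuous CF)].
have LFP : L1 D (F \o P).
  by apply: (L1S mB mD DB); exact: L1_compact.
have mgcoord g v i : is_weak_gradient Omega v g -> measurable_fun D (fun x => g x 0 i).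
  move=> [_ Lg _]; apply: (measurable_funS _ DO); first exact: open_measurable_rV.
  exact: L1loc_measurable.
have mFgc : measurable_fun D (F \o gc).
  apply: measurable_comp_coords => //; last exact: Ck_continuous CF.
  by move=> i; exact: mgcoord wgc.
have [LFgc IFgc] : L1 D (F \o gc) /\
    \int[mu]_(x in D) (F \o P) x = \int[mu]_(x in D) (F \o gc) x.
  by apply: L1_ae => //; apply: filterS gcP => x H Dx /=; rewrite H.
(* the energy of the competitor is finite, hence so is that of [u] *)
have Ec : energy F Omega comp D = (\int[mu]_(x in D) (F \o P) x)%:E.
  rewrite /energy asboolT// IFgc /Rintegral fineK//.
  exact: integrable_fin_num LFgc.
rewrite Ec /energy; case: asboolP => [LFgu|_]; last by rewrite leye_eq.
have -> : (\int[mu]_(x in D) (F (weak_gradient Omega u x))%:E)%E =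
    (\int[mu]_(x in D) (F \o gu) x)%:E.
  by rewrite /Rintegral fineK//; exact: integrable_fin_num LFgu.
rewrite lee_fin => Ile.
pose b i := partial i F \o P.
have Cb i : Ck 1 (b i) by apply: Ck1_comp_affine; exact: Ck_partial CF.
have [M bM] : exists M : 'I_n -> R, forall i x, D x ->
    `|b i x| <= M i /\ `|partial i (b i) x| <= M i.
  have /choice[M HM] : forall i : 'I_n, exists M : R, forall x, D x ->
      `|b i x| <= M /\ `|partial i (b i) x| <= M.
    move=> i.
    have [M1 _ H1] := compact_continuous_bounded cB (Ck_continuous (Cb i)).
    have [M2 _ H2] := compact_continuous_bounded cB (Ck_continuous (Ck_partial i (Cb i))).
    exists (Num.max M1 M2) => x /DB Bx.
    by split; rewrite le_max ?(H1 _ Bx) ?(H2 _ Bx) ?orbT.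
  by exists M.
have [Lw Lgw _] := aw.
have mb i : measurable_fun D (b i).
  by apply: measurable_funTS; apply: continuous_measurable_rV; exact: Ck_continuous (Cb i).
have mpb i : measurable_fun D (partial i (b i)).
  apply: measurable_funTS; apply: continuous_measurable_rV.
  exact: Ck_continuous (Ck_partial i (Cb i)).
have Lbg i : L1 D (fun x => b i x * gw x 0 i).
  by apply: (@L1M _ _ _ _ _ (M i)) => // x Dx; have [] := bM i x Dx.
have Lbw i : L1 D (fun x => partial i (b i) x * w x).
  by apply: (@L1M _ _ _ _ _ (M i)) => // x Dx; have [] := bM i x Dx.
have parts i : \int[mu]_(x in D) (partial i (b i) x * w x) =
    - \int[mu]_(x in D) (b i x * gw x 0 i).
  by apply: (W11_approx_by_parts (M := M i)) => // x Dx; have [] := bM i x Dx.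
have convex_le x : \sum_i sg * (b i x * gw x 0 i) <= F (gu x) - F (P x).
  apply: le_trans (convex_gradient_le (P x) (gu x) CF1 cvxF).
  rewrite le_eqVlt; apply/orP; left; apply/eqP; apply: eq_bigr => i _.
  transitivity (sg * sg * ((gu x - P x) 0 i * partial i F (P x))); last first.
    by rewrite sg1 mul1r.
  by rewrite gwE [X in sg * (_ * X)]mxE /b /=; ring.
(* the integrand is at most [F (Du) - F P] by convexity, and the integral of the
   latter is nonpositive by minimality *)
have I1 : \sum_i sg * \int[mu]_(x in D) (b i x * gw x 0 i) <= 0.
  have -> : \sum_i sg * \int[mu]_(x in D) (b i x * gw x 0 i) =
      \int[mu]_(x in D) (\sum_i sg * (b i x * gw x 0 i)).
    rewrite Rintegral_sum//; last by move=> i _; exact: L1Z.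
    by apply: eq_bigr => i _; rewrite RintegralZl//; exact: Lbg.
  apply: (@le_trans _ _ (\int[mu]_(x in D) (F (gu x) - F (P x)))).
    apply: le_Rintegral => //.
    - by apply: L1_sum => // i _; exact: L1Z.
    - exact: L1B.
  by rewrite RintegralB// subr_le0.
(* the divergence of [F_A (P)] times [w] *)
pose s x := \sum_i sg * (partial i (b i) x * w x).
have sE x : s x = (sg * mxdot (hessian F (P x)) Y) * w x.
  rewrite /s -mulr_sumr -mulr_suml -mulrA; congr (_ * (_ * _)).
  rewrite /mxdot exchange_big/=; apply: eq_bigr => i _.
  rewrite partial_comp_affine; last exact: Ck_partial CF.
  by apply: eq_bigr => j _; rewrite mxE -[in RHS]sY mxE mulrC.
have Ls : L1 D s by apply: L1_sum => // i _; exact: L1Z.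
have : \int[mu]_(x in D) s x < 0.
  apply: Rintegral_lt0 => //; first by exists a.
  move=> x Dx; rewrite sE nmulr_rlt0; first by case: Dx.
  by apply: ell; exact: DB.
rewrite ltNge => /negP; apply.
rewrite Rintegral_sum//; last by move=> i _; exact: L1Z.
rewrite (eq_bigr (fun i => - (sg * \int[mu]_(x in D) (b i x * gw x 0 i)))); last first.
  by move=> i _; rewrite (RintegralZl _ mD (Lbw i)) parts mulrN.
by rewrite sumrN oppr_ge0.
Qed.

End touching.

(** * Jets *)

Section jets.
Variables (R : realType) (n : nat).
Local Notation rV := 'rV[R]_n.
Implicit Types (F u : rV -> R) (Omega : set rV) (a p z : rV) (X Y : 'M[R]_n).

Lemma dot_ge0 z : 0 <= dot z z.
Proof. by apply: sumr_ge0 => i _; rewrite -expr2 sqr_ge0. Qed.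

Lemma norm_sqr_le_dot z : `|z| ^+ 2 <= dot z z.
Proof.
rewrite -[leRHS]sqr_sqrtr ?dot_ge0// ler_pXn2r ?nnegrE ?sqrtr_ge0//.
rewrite [leLHS]/Num.norm/= mx_normrE; apply: bigmax_le; first exact: sqrtr_ge0.
move=> [i j] _; rewrite (ord1 i)/= -sqrtr_sqr ler_sqrt ?dot_ge0//.
rewrite /dot (bigD1 j)//= -expr2 lerDl.
by apply: sumr_ge0 => l _; rewrite -expr2 sqr_ge0.
Qed.

Lemma mxdotDr (A X Y : 'M[R]_n) : mxdot A (X + Y) = mxdot A X + mxdot A Y.
Proof.
rewrite /mxdot -big_split; apply: eq_bigr => i _.
by rewrite -big_split; apply: eq_bigr => j _; rewrite mxE mulrDr.
Qed.

Lemma mxdot_scalar (A : 'M[R]_n) (c : R) : mxdot A c%:M = c * \tr A.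
Proof.
rewrite /mxdot /mxtrace mulr_sumr; apply: eq_bigr => i _.
rewrite (bigD1 i)//= big1 ?addr0; first by rewrite mxE eqxx mulr1n mulrC.
by move=> j ji; rewrite mxE eq_sym (negPf ji) mulr0n mulr0.
Qed.

Lemma quad_add_scalar X (c : R) z : quad (X + c%:M) z = quad X z + c * dot z z.
Proof.
rewrite /quad /dot mulr_sumr -big_split; apply: eq_bigr => i _.
rewrite (eq_bigr (fun j => X i j * z 0 i * z 0 j + (c%:M : 'M[R]_n) i j * z 0 i * z 0 j)); last first.
  by move=> j _; rewrite mxE; ring.
rewrite big_split/=; congr (_ + _).
rewrite (bigD1 i)//= big1 ?addr0; first by rewrite mxE eqxx mulr1n mulrA.
by move=> j ji; rewrite mxE eq_sym (negPf ji) mulr0n !mul0r.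
Qed.

(** Continuity of the second derivatives of [F] lets the sign of the operator
    at [a] persist in a neighbourhood. *)
Lemma continuous_ellipticity F p Y a : Ck 2 F ->
  continuous (fun x => mxdot (hessian F (affine p Y a x)) Y).
Proof.
move=> CF; apply: (@Ck_continuous _ _ 0); apply: Ck_sum => i; apply: Ck_sum => j.
apply: CkM; last exact: Ck_cst.
have -> : (fun x => hessian F (affine p Y a x) i j) =
    partial i (partial j F) \o affine p Y a.
  by apply/funext => x; rewrite /hessian mxE.
split=> // x; apply: continuous_comp; first exact: continuous_affine.
exact: (Ck_continuous (Ck_partial i (Ck_partial j CF))).
Qed.

(** Adding [2 * sg * eps] times the identity to [X] turns the contact of order
    [o(|z|^2)] into a strict one, with a margin of [eps / 2 * |z|^2], and keeps
    the wrong sign when [eps] is small. *)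
Lemma no_jet_of_wrong_sign Omega F u (sg : R) a p X (r : rV -> R) :
  open Omega -> Ck 2 F -> convex_function [set: convex_lmodType rV] F ->
  (forall x, Omega x -> {for x, continuous u}) -> local_minimiser F Omega u ->
  Omega a -> `|sg| = 1 -> X^T = X -> r =o_ (0 : rV) (fun z => dot z z) ->
  (\forall z \near (0 : rV),
     sg * u (a + z) <= sg * (u a + dot p z + 2^-1 * quad X z + r z)) ->
  0 <= sg * mxdot (hessian F p) X.
Proof.
move=> oO CF cvxF cu umin Oa nsg sX ro jet; rewrite leNgt; apply/negP => neg.
have sg1 : sg * sg = 1 by rewrite -expr2 -real_normK ?num_real// nsg expr1n.
set m := sg * _ in neg; set T := \tr (hessian F p).
have T0 : 0 < `|T| + 1 by rewrite ltr_wpDl.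
(* small enough that the trace term is at most half of [- m] *)
pose eps := - m / (4 * (`|T| + 1)).
have eps0 : 0 < eps by rewrite divr_gt0 ?oppr_gt0// mulr_gt0.
pose Y := X + (2 * sg * eps)%:M.
have sY : Y^T = Y by rewrite linearD/= sX tr_scalar_mx.
pose P := affine p Y a.
have Pa : P a = p by rewrite /P /affine subrr mul0mx addr0.
have ella : sg * mxdot (hessian F (P a)) Y < 0.
  rewrite Pa mxdotDr mxdot_scalar -/T mulrDr -/m.
  have -> : sg * (2 * sg * eps * T) = 2 * eps * T.
    by transitivity (sg * sg * (2 * eps * T)); [ring|rewrite sg1 mul1r].
  have : 2 * eps * T <= 2 * eps * (`|T| + 1).
    apply: ler_wpM2l; first by rewrite mulr_ge0// ltW.
    by apply: (le_trans (ler_norm _)); rewrite lerDl ler01.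
  have -> : 2 * eps * (`|T| + 1) = - m / 2.
    by rewrite /eps; field; rewrite gt_eqF.
  by move: neg; lra.
have neg_of_dist (A B : R) : `|A - B| < - A -> B < 0.
  by rewrite ltr_norml => /andP[+ _]; lra.
have cell := @continuous_ellipticity F p Y a CF a.
have ell_near : \forall x \near a, sg * mxdot (hessian F (P x)) Y < 0.
  have c : {for a, continuous (fun x => sg * mxdot (hessian F (P x)) Y)}.
    by apply: continuousM; [exact: cst_continuous|exact: cell].
  have /cvgrPdist_lt/(_ (- (sg * mxdot (hessian F (P a)) Y))) := c.
  rewrite oppr_gt0 => /(_ ella); apply: filterS => x.
  exact: neg_of_dist.
have r_near : \forall z \near (0 : rV), `|r z| <= eps / 2 * `|dot z z|.
  by move/eqoP: ro; apply; exact: divr_gt0.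
have /nbhs_ballP[d1 /= d10 jet1] : nbhs (0:rV)
    [set z | sg * u (a + z) <= sg * (u a + dot p z + 2^-1 * quad X z + r z) /\
      `|r z| <= eps / 2 * `|dot z z|].
  exact: filterI.
have /nbhs_ballP[d2 /= d20 ell2] := ell_near.
have /nbhs_ballP[d3 /= d30 O3] : nbhs a Omega by exact: open_nbhs_nbhs.
pose rho := Num.min d1 (Num.min d2 d3) / 2.
have d0 : 0 < Num.min d1 (Num.min d2 d3) by rewrite !lt_min d10 d20.
have rho0 : 0 < rho by exact: divr_gt0.
have inball x : cball a rho x -> [/\ `|a - x| < d1, `|a - x| < d2 & `|a - x| < d3].
  move=> ax; have : `|a - x| < Num.min d1 (Num.min d2 d3).
    by apply: le_lt_trans ax _; rewrite /rho ltr_pdivrMr// ltr_pMr// ltr1n.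
  by rewrite !lt_min => /and3P[].
apply: (@minimiser_not_touched _ _ Omega F u sg (eps / 2) rho a p Y
  oO CF cvxF cu umin sg1 sY (divr_gt0 eps0 (ltr0n R 2)) rho0).
- by move=> x /inball[_ _ ax]; apply: O3; rewrite -ball_normE.
- move=> x /inball[ax _ _].
  have [] : [set z | sg * u (a + z) <= sg * (u a + dot p z + 2^-1 * quad X z + r z) /\
      `|r z| <= eps / 2 * `|dot z z|] (x - a).
    by apply: jet1; rewrite -ball_normE/= sub0r opprB.
  rewrite addrC subrK; set z := x - a => j1 rz.
  have zE : `|a - x| = `|z| by rewrite distrC.
  have nz := norm_sqr_le_dot z; have dz := dot_ge0 z.
  rewrite (ger0_norm dz) in rz.
  have srz : sg * r z <= eps / 2 * dot z z.
    by apply: le_trans (ler_norm _) _; rewrite normrM nsg mul1r.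
  rewrite zE /quadratic -/z quad_add_scalar.
  have -> : sg * (u x - (u a + dot p z + 2^-1 * (quad X z + 2 * sg * eps * dot z z))) =
      sg * u x - sg * (u a + dot p z + 2^-1 * quad X z) - sg * sg * (eps * dot z z).
    by field.
  rewrite sg1 mul1r.
  have : eps / 2 * `|z| ^+ 2 <= eps / 2 * dot z z by rewrite ler_pM2l// divr_gt0.
  move: j1; rewrite mulrDr; move: srz; lra.
- by move=> x /inball[_ ax _]; apply: ell2; rewrite -ball_normE.
Qed.

End jets.

Theorem theorem1 (R : realType) (n : nat) (Omega : set 'rV[R]_n)
    (F u : 'rV[R]_n -> R)
    (Omega_open : open Omega)
    (F_C2 : Ck 2 F)
    (F_convex : convex_function [set: convex_lmodType 'rV[R]_n] F)
    (u_continuous : {within Omega, continuous u})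
    (u_W11loc : W11loc Omega u)
    (u_min : local_minimiser F Omega u) :
  viscosity_solution F Omega u.
Proof.
split => // x Ox.
have cu y : Omega y -> {for y, continuous u}.
  move=> Oy; move: u_continuous; rewrite continuous_open_subspace//.
  by apply; rewrite inE.
split=> p X [sX [r ro jet]].
- rewrite -[leRHS]mul1r.
  apply: (no_jet_of_wrong_sign Omega_open F_C2 F_convex cu u_min Ox (normr1 _) sX ro (r := r)).
  by apply: filterS jet => z; rewrite !mul1r.
- rewrite -oppr_ge0 -mulN1r.
  apply: (no_jet_of_wrong_sign Omega_open F_C2 F_convex cu u_min Ox _ sX ro (r := r)).
    by rewrite normrN1.
  by apply: filterS jet => z; rewrite !mulN1r lerN2.
Qed.
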